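(* Let $M$ be a dense regular ordered abelian group, viewed in the multi-sorted language described below, and let $T=\mathrm{Th}(M)$. Then $T$ has weak elimination of imaginaries.
   Context: An ordered abelian group is dense if it is nontrivial with no least positive element; it is regular if it eliminates quantifiers in $L_{\mathrm{Pres}}=\{+,0,-,<,1,\equiv_n\ (n\in\omega)\}$ ($1$ the least positive element if discrete, $0$ otherwise; $\equiv_n$ congruence modulo $n$). The language has one home sort for $M$ itself with $\{+,0,-,<\}$; for each prime $\mathfrak p$ and $n>0$ a sort $\mathrm S_{\mathfrak p^n}$ with $\{+,0,-\}$, interpreted as $M/\mathfrak p^nM$ (also when finite); function symbols $\pi_{\mathfrak p^n}$ for the quotient maps $M\to M/\mathfrak p^nM$; and $\rho_{\mathfrak p^{n+1}}$ for the canonical surjections $M/\mathfrak p^{n+1}M\to M/\mathfrak p^nM$. $T$ has weak elimination of imaginaries if for every imaginary element $e$ (of a monster model of $T^{\mathrm{eq}}$) there is a tuple $a$ from the sorts of the language with $e\in\mathrm{dcl}^{\mathrm{eq}}(a)$ and $a\in\mathrm{acl}^{\mathrm{eq}}(e)$. *)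

(* Defs.v *)
From HB Require Import structures.
From mathcomp Require Import all_boot all_order all_algebra.
From mathcomp Require Import boolp classical_sets functions cardinality.
Set Implicit Arguments.
Unset Strict Implicit.
Unset Printing Implicit Defensive.
Import Order.TTheory GRing.Theory Num.Theory.
Local Open Scope classical_set_scope.
Local Open Scope card_scope.
Local Open Scope ring_scope.
Local Open Scope quotient_scope.

(** * Many-sorted first-order logic *)

Record signature := Signature {
  sort : Type;
  func : Type;
  fdom : func -> seq sort;
  fcod : func -> sort;
  pred_symb : Type;
  pdom : pred_symb -> seq sort }.

(* [var G s] is the type of (de Bruijn) variables of sort [s] in context [G]. *)
Inductive var (S : Type) : seq S -> S -> Type :=
| V0 s G : var (s :: G) s
| VS s t G : var G t -> var (s :: G) t.
Arguments V0 {S s G}.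
Arguments VS {S s t G} v.

Definition env (S : Type) (D : S -> Type) (G : seq S) := forall s, var G s -> D s.

Section Env.
Context {S : Type} {D : S -> Type}.

Definition enil : env D [::] := fun s v =>
  match v in var G t return (match G with [::] => D t | _ => unit end) with
  | V0 _ _ => tt
  | VS _ _ _ _ => tt
  end.

Definition econs s G (x : D s) (e : env D G) : env D (s :: G) := fun t v =>
  match v in var H t return
    (match H with [::] => unit | s' :: H' => D s' -> env D H' -> D t end) with
  | V0 _ _ => fun x _ => x
  | VS _ _ _ w => fun _ e => e _ w
  end x e.

Fixpoint ecat G H : env D G -> env D H -> env D (G ++ H) :=
  match G with
  | [::] => fun _ b => b
  | s :: G' => fun a b => econs (a s V0) (ecat (fun t v => a t (VS v)) b)
  end.

Definition entries G (e : env D G) : set {s : S & D s} :=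
  [set x | exists s (v : var G s), x = Tagged D (e s v)].

End Env.

Fixpoint vmap (S S' : Type) (g : S -> S') G s (v : var G s) :
    var (map g G) (g s) :=
  match v with
  | V0 _ _ => V0
  | VS _ _ _ w => VS (vmap g w)
  end.

Section Syntax.
Variable L : signature.

Inductive term (G : seq (sort L)) : sort L -> Type :=
| Var s : var G s -> term G s
| App (f : func L) : (forall s, var (fdom f) s -> term G s) -> term G (fcod f).

Inductive formula : seq (sort L) -> Type :=
| FEq G s : term G s -> term G s -> formula G
| FPred G (r : pred_symb L) : (forall s, var (pdom r) s -> term G s) -> formula G
| FBot G : formula G
| FImp G : formula G -> formula G -> formula G
| FAll G s : formula (s :: G) -> formula G.

Fixpoint quantifier_free G (phi : formula G) : bool :=
  match phi with
  | FEq _ _ _ _ | FPred _ _ _ | FBot _ => true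
  | FImp _ phi psi => quantifier_free phi && quantifier_free psi
  | FAll _ _ _ => false
  end.

Record structure := Structure {
  carrier :> sort L -> Type;
  finterp : forall f : func L, env carrier (fdom f) -> carrier (fcod f);
  pinterp : forall r : pred_symb L, env carrier (pdom r) -> Prop }.

Fixpoint eval (N : structure) G (e : env N G) s (t : term G s) : N s :=
  match t with
  | Var _ v => e _ v
  | App f args => finterp (fun s v => eval e (args s v))
  end.

Fixpoint sat (N : structure) G (phi : formula G) : env N G -> Prop :=
  match phi with
  | FEq _ _ t u => fun e => eval e t = eval e u
  | FPred _ r args => fun e => pinterp (fun s v => eval e (args s v))
  | FBot _ => fun=> False
  | FImp _ phi psi => fun e => sat phi e -> sat psi e
  | FAll _ s phi => fun e => forall x : N s, sat phi (econs x e)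
  end.

End Syntax.
Arguments term : clear implicits.
Arguments formula : clear implicits.
Arguments App {L G} f args : rename.
Arguments FPred {L G} r args : rename.

Definition theory (L : signature) := set (formula L [::]).

Definition Th (L : signature) (N : structure L) : theory L :=
  [set phi | sat phi (enil : env N [::])].

Definition models (L : signature) (N : structure L) (T : theory L) : Prop :=
  T `<=` Th N.

Definition eliminates_quantifiers (L : signature) (N : structure L) : Prop :=
  forall G (phi : formula L G), exists psi : formula L G,
    quantifier_free psi /\ forall e : env N G, sat phi e <-> sat psi e.

(** * Definable and algebraic closure, monster models *)

Section Closure.
Context {L : signature} (N : structure L).

Definition elt := {s : sort L & N s}.

(* A formula in one variable of sort [s] (variable [V0]), with parameters. *)
Definition pformula (s : sort L) := {G : seq (sort L) & (formula L (s :: G) * env N G)%type}.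

Definition params s (f : pformula s) : set elt := entries (tagged f).2.

Definition realizes s (x : N s) (f : pformula s) : Prop :=
  sat (tagged f).1 (econs x (tagged f).2).

Definition dcl (A : set elt) : set elt :=
  [set e | exists f : pformula (tag e),
     params f `<=` A /\ forall x, realizes x f <-> x = tagged e].

Definition acl (A : set elt) : set elt :=
  [set e | exists f : pformula (tag e),
     [/\ params f `<=` A, finite_set [set x | realizes x f]
       & realizes (tagged e) f]].

(* The type [K] stands for the cardinal |K|. *)
Definition card_lt (K T : Type) (A : set T) : Prop :=
  (A #<= [set: K]) /\ ~ ([set: K] #<= A).

Definition saturated (K : Type) : Prop :=
  forall s (A : set elt) (p : set (pformula s)),
    card_lt K A ->
    (forall f, p f -> params f `<=` A) ->
    (forall q, finite_set q -> q `<=` p ->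
       exists x, forall f, q f -> realizes x f) ->
    exists x, forall f, p f -> realizes x f.

Definition automorphism (g : forall s, N s -> N s) : Prop :=
  [/\ forall s, bijective (g s),
      forall f (e : env N (fdom f)),
        g _ (finterp e) = finterp (fun s v => g s (e s v))
    & forall r (e : env N (pdom r)),
        pinterp e <-> pinterp (fun s v => g s (e s v))].

(* Only the restriction of [h] to [A] matters. *)
Definition elementary_on (A : set elt) (h : forall s, N s -> N s) : Prop :=
  forall G (phi : formula L G) (e : env N G), entries e `<=` A ->
    (sat phi e <-> sat phi ((fun s v => h s (e s v)) : env N G)).

Definition strongly_homogeneous (K : Type) : Prop :=
  forall (A : set elt) (h : forall s, N s -> N s),
    card_lt K A -> elementary_on A h ->
    exists g, automorphism g /\
      forall s (x : N s), A (Tagged N x) -> g s x = h s x.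

(* There are max(aleph_0, |L|) formulas, so |K| is uncountable and exceeds |L|. *)
Definition monster (K : Type) (T : theory L) : Prop :=
  [/\ card_lt K [set: {G : seq (sort L) & formula L G}],
      models N T, saturated K & strongly_homogeneous K].

End Closure.

(** * Imaginaries *)

Section Eq.
Context {L : signature} (N : structure L).

(* Parameter-free definable equivalence relations on finite products of sorts.
   For a complete theory T and N a model of T, that a formula defines an
   equivalence relation in N means that it does so in every model of T, so
   [eq_sig N] is the language of T^eq and [eq_structure N] is N^eq. *)
Record def_equiv := DefEquiv {
  de_ctx : seq (sort L);
  de_form : formula L (de_ctx ++ de_ctx);
  de_rel := fun a b : env N de_ctx => sat de_form (ecat a b);
  de_refl : forall a, de_rel a a;
  de_sym : forall a b, de_rel a b -> de_rel b a;
  de_trans : forall a b c, de_rel a b -> de_rel b c -> de_rel a c }.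

Inductive eq_sort := Real of sort L | Imag of def_equiv.

Inductive eq_func := OldFunc of func L | Proj of def_equiv.

Definition eq_sig : signature := {|
  sort := eq_sort;
  func := eq_func;
  fdom := fun f => match f with
                   | OldFunc f => map Real (fdom f)
                   | Proj E => map Real (de_ctx E)
                   end;
  fcod := fun f => match f with
                   | OldFunc f => Real (fcod f)
                   | Proj E => Imag E
                   end;
  pred_symb := pred_symb L;
  pdom := fun r => map Real (pdom r) |}.

Definition de_class (E : def_equiv) (a : env N (de_ctx E)) :
    set (env N (de_ctx E)) :=
  [set b | de_rel a b].

Definition de_quot (E : def_equiv) :=
  {C : set (env N (de_ctx E)) | exists a, C = de_class a}.

Definition de_proj (E : def_equiv) (a : env N (de_ctx E)) : de_quot E :=
  exist _ (de_class a) (ex_intro _ a erefl).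

Definition eq_carrier (s : eq_sort) : Type :=
  match s with
  | Real s => N s
  | Imag E => de_quot E
  end.

Definition real_env G (e : env eq_carrier (map Real G)) : env N G :=
  fun s v => e (Real s) (vmap Real v).

Definition eq_structure : structure eq_sig := {|
  carrier := eq_carrier : sort eq_sig -> Type;
  finterp := fun f : func eq_sig =>
    match f return env eq_carrier (@fdom eq_sig f) -> eq_carrier (@fcod eq_sig f) with
    | OldFunc f => fun e => finterp (real_env e)
    | Proj E => fun e => de_proj (real_env e)
    end;
  pinterp := fun (r : pred_symb eq_sig) (e : env eq_carrier (pdom r)) =>
    pinterp (real_env e) |}.

Definition real_entries G (a : env N G) : set (elt eq_structure) :=
  [set x | exists s (v : var G s),
     x = Tagged eq_structure (a s v : eq_structure (Real s))].

End Eq.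

Definition weak_elimination_of_imaginaries (L : signature) (T : theory L) : Prop :=
  forall (K : Type) (U : structure L), monster U K T ->
  forall e : elt (eq_structure U),
  exists (G : seq (sort L)) (a : env U G),
    dcl (real_entries a) e /\ real_entries a `<=` acl [set e].

(** * Ordered abelian groups *)

Definition ordered_abelian_group (M : porderZmodType) : Prop :=
  total (<=%R : rel M) /\ forall x y z : M, x <= y -> x + z <= y + z.

Section Groups.
Variable M : porderZmodType.

Definition least_positive (x : M) : Prop :=
  0 < x /\ forall y : M, 0 < y -> x <= y.

Definition dense_oag : Prop :=
  (exists x : M, x != 0) /\ ~ exists x : M, least_positive x.

(** ** The Presburger language and regularity *)

Inductive pres_func := PZero | PAdd | POpp | POne.
Inductive pres_pred := PLt | PCong of nat.

Definition pres_sig : signature := {|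
  sort := unit;
  func := pres_func;
  fdom := fun f => match f with
                   | PZero | POne => [::]
                   | PAdd => [:: tt; tt]
                   | POpp => [:: tt]
                   end;
  fcod := fun _ => tt;
  pred_symb := pres_pred;
  pdom := fun _ => [:: tt; tt] |}.

(* [xget 0 P] is an element satisfying [P] if there is one, and 0 otherwise. *)
Definition pres_one : M := xget 0 [set x | least_positive x].

Definition pres_structure : structure pres_sig := {|
  carrier := (fun _ => M) : sort pres_sig -> Type;
  finterp := fun f : func pres_sig =>
    match f return env (fun _ => M) (@fdom pres_sig f) -> M with
    | PZero => fun _ => 0
    | PAdd => fun e => e tt V0 + e tt (VS V0)
    | POpp => fun e => - e tt V0
    | POne => fun _ => pres_one
    end;
  pinterp := fun r : pred_symb pres_sig =>
    match r return env (fun _ => M) (@pdom pres_sig r) -> Prop with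
    | PLt => fun e => e tt V0 < e tt (VS V0)
    | PCong n => fun e => exists z : M, e tt V0 - e tt (VS V0) = z *+ n
    end |}.

Definition regular : Prop := eliminates_quantifiers pres_structure.

(** ** The language with sorts for the quotients M / p^n M *)

Definition multiples (m : nat) : {pred M} :=
  fun x => `[< exists y : M, x = y *+ m >].

Lemma multiples_zmod_closed m : zmod_closed (multiples m).
Proof.
split; first by apply/asboolP; exists 0; rewrite mul0rn.
move=> x y /asboolP[x' ->] /asboolP[y' ->].
by apply/asboolP; exists (x' - y'); rewrite mulrnBl.
Qed.

HB.instance Definition _ m :=
  GRing.isZmodClosed.Build M (multiples m) (multiples_zmod_closed m).

Definition quo (m : nat) : zmodType := Quotient.quot (multiples m).

Definition primes_t := {p : nat | prime p}.

(* [Quo p k] is the sort S_{p^(k+1)}, so that the exponent is positive. *)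
Inductive quo_sort := Home | Quo of primes_t & nat.

(* [Pi p k] is pi_{p^(k+1)}, from M to M / p^(k+1) M, and [Rho p k] is
   rho_{p^(k+2)}, from M / p^(k+2) M to M / p^(k+1) M. *)
Inductive quo_func :=
| Zero of quo_sort
| Add of quo_sort
| Opp of quo_sort
| Pi of primes_t & nat
| Rho of primes_t & nat.

Definition quo_sig : signature := {|
  sort := quo_sort;
  func := quo_func;
  fdom := fun f => match f with
                   | Zero _ => [::]
                   | Add s => [:: s; s]
                   | Opp s => [:: s]
                   | Pi _ _ => [:: Home]
                   | Rho p k => [:: Quo p k.+1]
                   end;
  fcod := fun f => match f with
                   | Zero s | Add s | Opp s => s
                   | Pi p k | Rho p k => Quo p k
                   end;
  pred_symb := unit;
  pdom := fun _ => [:: Home; Home] |}.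

Definition quo_carrier (s : quo_sort) : zmodType :=
  match s with
  | Home => M
  | Quo p k => quo (val p ^ k.+1)
  end.

Definition quo_pi (m : nat) (x : M) : quo m := \pi_(Quotient.quot (multiples m)) x.

Definition quo_rho (m m' : nat) (x : quo m) : quo m' :=
  quo_pi m' (repr (x : Quotient.quot (multiples m))).

Definition quo_structure : structure quo_sig := {|
  carrier := (fun s => quo_carrier s : Type) : sort quo_sig -> Type;
  finterp := fun f : func quo_sig =>
    match f return env (fun s => quo_carrier s : Type) (@fdom quo_sig f) ->
                   quo_carrier (@fcod quo_sig f) with
    | Zero s => fun _ => 0
    | Add s => fun e => e s V0 + e s (VS V0)
    | Opp s => fun e => - e s V0
    | Pi p k => fun e => quo_pi (val p ^ k.+1) (e Home V0)
    | Rho p k => fun e => quo_rho (val p ^ k.+1) (e (Quo p k.+1) V0)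
    end;
  pinterp := fun (_ : unit) (e : env (fun s => quo_carrier s : Type) [:: Home; Home]) =>
    (e Home V0 : M) < e Home (VS V0) |}.

End Groups.

(* Main.v *)
(** Every model [U] carries an ordered abelian group [V] on its home sort, every quotient sort is an
    image of [V], and the definable sets of home tuples are determined by finitely many signs and
    congruences of integral linear forms; density of the subgroups [n V] follows from quantifier
    elimination. So an imaginary is the class of a home tuple [a] for a definable equivalence
    relation [E].

    Describe this class by a definable condition on a tuple [c] of [V] and on the residues modulo
    [N] of a tuple [d]; initially [c = a] and [d] is empty. If infinitely many [c] describe the same
    class, then [c] can be moved along an integral line, in an interval, without changing the class.
    The interval extends to one bounded by walls that are determined by the projection [c'] of [c]
    along the line, so [c'] and some residues suffice, and [c'] is shorter than [c]. If only
    finitely many [c] but infinitely many tuples of residues describe the class, then they can be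
    moved in a direction [z] by infinitely many elements that are incongruent modulo a prime [p] with
    [V / p V] infinite. The class is then described by the residues of [p d_i] and
    [d_j - z_j d_i], as the class that is common to sufficiently many points of that line, and these
    residues generate a smaller subgroup of [V / N V]. So for a choice of [c] and [d] that minimizes
    first the length of [c] and then this subgroup, only finitely many [c] and residues of [d]
    describe the class. They are algebraic over the imaginary, which is definable from them. *)

Require Import Defs.
From HB Require Import structures.
From mathcomp Require Import all_boot all_order all_algebra.
From mathcomp Require Import boolp classical_sets functions cardinality.
From mathcomp Require Import zify ring.
Set Implicit Arguments.
Unset Strict Implicit.
Unset Printing Implicit Defensive.
Import Order.TTheory GRing.Theory Num.Theory.
Local Open Scope ring_scope.

Section Zmodule_normalization.
Context {V : zmodType}.

Inductive zexp :=
| ZVar of nat | ZZero | ZAdd of zexp & zexp | ZOpp of zexp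
| ZMulz of zexp & int | ZMuln of zexp & nat.

Fixpoint zeval (r : seq V) (e : zexp) : V :=
  match e with
  | ZVar n => r`_n
  | ZZero => 0
  | ZAdd a b => zeval r a + zeval r b
  | ZOpp a => - zeval r a
  | ZMulz a k => zeval r a *~ k
  | ZMuln a n => zeval r a *+ n
  end.

Fixpoint zcoef (i : nat) (e : zexp) : int :=
  match e with
  | ZVar n => if Nat.eqb i n then 1 else 0
  | ZZero => 0
  | ZAdd a b => zcoef i a + zcoef i b
  | ZOpp a => - zcoef i a
  | ZMulz a k => zcoef i a * k
  | ZMuln a n => zcoef i a * n%:Z
  end.

Fixpoint zwf (m : nat) (e : zexp) : bool :=
  match e with
  | ZVar n => (n < m)%N
  | ZZero => true
  | ZAdd a b => zwf m a && zwf m b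
  | ZOpp a | ZMulz a _ | ZMuln a _ => zwf m a
  end.

Lemma zevalE r e : zwf (size r) e ->
  zeval r e = \sum_(i < size r) r`_i *~ zcoef i e.
Proof.
elim: e => /= [n hn||a IHa b IHb /andP[/IHa-> /IHb->]|a IHa /IHa->
  |a IHa k /IHa->|a IHa n /IHa->].
- rewrite (bigD1 (Ordinal hn)) //= PeanoNat.Nat.eqb_refl mulr1z big1 ?addr0 //.
  move=> i hi; case: PeanoNat.Nat.eqb_spec => // h.
  by case/negP: hi; apply/eqP/val_inj.
- by rewrite big1.
- by rewrite -big_split; apply: eq_bigr => i _; rewrite mulrzDr.
- by rewrite -sumrN; apply: eq_bigr => i _; rewrite mulrNz.
- by rewrite mulrz_suml; apply: eq_bigr => i _; rewrite mulrzA.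
- by rewrite -sumrMnl; apply: eq_bigr => i _; rewrite pmulrn mulrzA.
Qed.

Fixpoint zagree (m : nat) (a b : zexp) : Prop :=
  match m with
  | 0 => True
  | m'.+1 => zcoef m' a = zcoef m' b /\ zagree m' a b
  end.

Lemma zmodule_eq r a b : zwf (size r) a && zwf (size r) b ->
  zagree (size r) a b -> zeval r a = zeval r b.
Proof.
case/andP => ha hb h; rewrite !zevalE //; apply: eq_bigr => i _.
congr (_ *~ _); case: i => i /= hi.
elim: (size r) hi h => //= m IH; rewrite ltnS leq_eqVlt => /orP[/eqP-> []//|].
by move=> hi [_]; apply: IH.
Qed.
End Zmodule_normalization.

Ltac zindex x r :=
  lazymatch r with
  | nil => constr:(O)
  | ?y :: ?r' => lazymatch y with
                 | x => constr:(O)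
                 | _ => let n := zindex x r' in constr:(S n)
                 end
  end.

Ltac zin x r :=
  lazymatch r with
  | nil => constr:(false)
  | x :: _ => constr:(true)
  | _ :: ?r' => zin x r'
  end.

Ltac zatoms e r :=
  lazymatch e with
  | (?a + ?b)%R => let r := zatoms a r in zatoms b r
  | (- ?a)%R => zatoms a r
  | (?a *~ ?k)%R => zatoms a r
  | (?a *+ ?k)%R => zatoms a r
  | 0%R => r
  | ?x => lazymatch zin x r with true => r | false => constr:(x :: r) end
  end.

Ltac zquote e r :=
  lazymatch e with
  | (?a + ?b)%R => let a' := zquote a r in let b' := zquote b r in constr:(ZAdd a' b')
  | (- ?a)%R => let a' := zquote a r in constr:(ZOpp a')
  | (?a *~ ?k)%R => let a' := zquote a r in constr:(ZMulz a' k)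
  | (?a *+ ?k)%R => let a' := zquote a r in constr:(ZMuln a' k)
  | 0%R => constr:(ZZero)
  | ?x => let n := zindex x r in constr:(ZVar n)
  end.

(* Proves equalities in a Z-module by comparing the integer coefficients of the atoms with [ring]. *)
Ltac zmod :=
  lazymatch goal with
  | |- @eq ?T ?a ?b =>
    let r := zatoms a (@nil T) in
    let r := zatoms b r in
    let a' := zquote a r in
    let b' := zquote b r in
    refine (@zmodule_eq _ r a' b' isT _); cbn [zagree size zcoef Nat.eqb];
    repeat split; try ring
  end.

(** * Ordered groups in which the multiples of every integer are dense *)

Record regular_oag (V : zmodType) (pos : V -> Prop) : Prop := RegularOag {
  pos_irr : ~ pos 0;
  posD : forall x y, pos x -> pos y -> pos (x + y);
  pos_total : forall x, x <> 0 -> pos x \/ pos (- x);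
  pos_ex : exists x, pos x;
  pos_dense : forall n a b, (0 < n)%N -> pos (b - a) ->
    exists z, pos (z *+ n - a) /\ pos (b - z *+ n) }.

Section Order.
Context {V : zmodType} {pos : V -> Prop} (ho : regular_oag pos).
Implicit Types (x y z a b e t : V) (k l : int) (n : nat).

Definition sgn x : int := if `[<pos x>] then 1 else if `[<pos (- x)>] then -1 else 0.

Definition within x y := pos (y - x) /\ pos (y + x).

Lemma pos_asym x : pos x -> pos (- x) -> False.
Proof. by move=> p q; apply: (pos_irr ho); rewrite -(subrr x); apply: posD. Qed.

Lemma pos_neq0 x : pos x -> x <> 0.
Proof. by move=> + h; rewrite h; exact: pos_irr ho. Qed.

Variant sgn_spec x : int -> Prop :=
| SgnPos of pos x : sgn_spec x 1
| SgnZero of x = 0 : sgn_spec x 0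
| SgnNeg of pos (- x) : sgn_spec x (-1).

Lemma sgnP x : sgn_spec x (sgn x).
Proof.
rewrite /sgn; case: asboolP => [/SgnPos//|p]; case: asboolP => [/SgnNeg//|q].
by apply: SgnZero; apply: contrapT => /(pos_total ho)[].
Qed.

Lemma sgn_pos x : pos x <-> sgn x = 1.
Proof.
case: sgnP => // [->|h]; split => //; first by move/(pos_irr ho).
by move=> /pos_asym /(_ h).
Qed.

Lemma sgn0 : sgn 0 = 0.
Proof. by case: sgnP => // [/(pos_irr ho)//|]; rewrite oppr0 => /(pos_irr ho). Qed.

Lemma sgn_eq0 x : sgn x = 0 <-> x = 0.
Proof. by split=> [|->]; [case: sgnP | exact: sgn0]. Qed.

Lemma sgnN x : sgn (- x) = - sgn x.
Proof.
case: (sgnP x) => [p|->|p]; last by apply/sgn_pos.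
  rewrite /sgn opprK; case: asboolP => [/(pos_asym p)//|_].
  by case: asboolP.
by rewrite !oppr0 sgn0.
Qed.

Lemma posMn x n : (0 < n)%N -> pos x -> pos (x *+ n).
Proof.
case: n => // n _ p; elim: n => [|n IH]; first by rewrite mulr1n.
by rewrite mulrS; apply: posD.
Qed.

Lemma posMn_inv x n : pos (x *+ n) -> pos x.
Proof.
case: n => [|n]; first by rewrite mulr0n => /(pos_irr ho).
move=> p; case: (sgnP x) => // [h|h]; first by rewrite h mul0rn in p; case: (pos_irr ho).
by case: (@pos_asym (x *+ n.+1)) => //; rewrite -mulNrn; apply: posMn.
Qed.

Lemma sgnMz x k : sgn (x *~ k) = sgn x * sgz k.
Proof.
have H n y : sgn (y *+ n) = sgn y * sgz n%:Z.
  case: n => [|n]; first by rewrite mulr0n sgn0 sgz0 mulr0.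
  rewrite gtr0_sgz // mulr1; case: (sgnP y) => [p|->|p].
  - by apply/sgn_pos; apply: posMn.
  - by rewrite mul0rn sgn0.
  - by apply/eqP; rewrite -eqr_opp opprK -sgnN; apply/eqP/sgn_pos; rewrite -mulNrn; apply: posMn.
case: (intP k) => [|n|n]; rewrite ?mulr0z ?sgn0 ?sgz0 ?mulr0 //.
- by rewrite -pmulrn H.
- by rewrite mulrNz sgnN -pmulrn H sgzN mulrN.
Qed.

Lemma torsion_free x k : x *~ k = 0 -> k != 0 -> x = 0.
Proof.
move=> h k0; apply/sgn_eq0; have := sgnMz x k; rewrite h sgn0 => /esym/eqP.
by rewrite mulf_eq0 sgz_eq0 (negPf k0) orbF => /eqP.
Qed.

Lemma torsion_freen x n : x *+ n = 0 -> (0 < n)%N -> x = 0.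
Proof. by move=> h n0; apply: (@torsion_free x n); [rewrite -pmulrn | lia]. Qed.

Lemma within_pos x y : within x y -> pos y.
Proof.
case=> p q; apply: (@posMn_inv y 2).
have -> : y *+ 2 = (y - x) + (y + x) by zmod.
exact: posD.
Qed.

Lemma withinN x y : within (- x) y <-> within x y.
Proof. by rewrite /within opprK; split=> -[]. Qed.

Lemma within0 y : pos y -> within 0 y.
Proof. by move=> p; rewrite /within subr0 addr0. Qed.

Lemma withinD x x' y y' : within x y -> within x' y' -> within (x + x') (y + y').
Proof.
case=> p q [p' q']; split.
  by rewrite (_ : _ - _ = (y - x) + (y' - x')); [apply: posD | zmod].
by rewrite (_ : _ + _ = (y + x) + (y' + x')); [apply: posD | zmod].
Qed.

Lemma within_weak x y z : within x y -> pos (z - y) -> within x z.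
Proof.
move=> [p q] h; split.
  by rewrite (_ : _ - _ = (y - x) + (z - y)); [apply: posD | zmod].
by rewrite (_ : _ + _ = (y + x) + (z - y)); [apply: posD | zmod].
Qed.

Lemma withinMn x y n B : within x y -> (n <= B)%N -> (0 < B)%N -> within (x *+ n) (y *+ B).
Proof.
move=> h; elim: n B => [|n IH] [|B] //; rewrite ?ltnS.
  by move=> _ _; rewrite mulr0n; apply: within0; apply: posMn => //; apply: within_pos h.
case: B => [|B] nB _; first by move: nB; rewrite leqn0 => /eqP->; rewrite !mulr1n.
rewrite mulrS (mulrS y); apply: withinD => //.
exact: IH.
Qed.

Lemma withinMz x y k B : within x y -> (`|k| <= B)%N -> (0 < B)%N ->
  within (x *~ k) (y *+ B).
Proof.
move=> h; case: (intP k) => [|n|n] hk B0.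
- by rewrite mulr0z; apply: within0; apply: posMn => //; apply: within_pos h.
- by rewrite -pmulrn; apply: withinMn.
- by rewrite mulrNz withinN -pmulrn; apply: withinMn => //; move: hk; rewrite abszN.
Qed.

Lemma within_ex x : exists y, within x y.
Proof.
have [p hp] := pos_ex ho.
case: (sgnP x) => [h|->|h].
- exists (x + p); split; first by rewrite (_ : _ - _ = p) //; zmod.
  by rewrite addrAC; do !apply: posD.
- by exists p; apply: within0.
- exists (- x + p); split; last by rewrite (_ : _ + x = p) //; zmod.
  by rewrite addrAC; do !apply: posD.
Qed.

Lemma sgn_perturb x e : within e x \/ within e (- x) -> sgn (x + e) = sgn x.
Proof.
case=> h; have p := within_pos h; case: h => h1 h2.
  by have /sgn_pos-> := p; apply/sgn_pos.
have : sgn (- (x + e)) = sgn (- x).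
  by have /sgn_pos-> := p; apply/sgn_pos; rewrite opprD.
by rewrite !sgnN => /oppr_inj.
Qed.

Lemma sgn_dominated x h k : within x h -> k != 0 -> sgn (x + h *~ k) = sgz k.
Proof.
move=> w k0; have hp := within_pos w; rewrite addrC sgn_perturb.
  by rewrite sgnMz; have /sgn_pos-> := hp; rewrite mul1r.
have H m : within x (h *+ m.+1).
  by rewrite -[x]mulr1n; apply: withinMn.
case: (intP k) k0 => // m _; [left | right]; first by rewrite -pmulrn.
by rewrite mulrNz opprK -pmulrn.
Qed.

Lemma huge_ex (s : seq V) : exists h, pos h /\ forall x, x \in s -> within x h.
Proof.
elim: s => [|y s [h [hp IH]]]; first by have [p] := pos_ex ho; exists p.
have [h' hh'] := within_ex y; have hp' := within_pos hh'.
exists (h + h'); split=> [|x]; first exact: posD.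
rewrite inE => /orP[/eqP->|/IH w].
  by apply: within_weak hh' _; rewrite addrK.
by apply: within_weak w _; rewrite addrC addKr.
Qed.

Lemma pos_min x y : pos x -> pos y ->
  exists z, [/\ pos z, pos (x - z) & pos (y - z)].
Proof.
move=> px py.
have H u w : pos u -> pos (w - u) -> exists z, [/\ pos z, pos (u - z) & pos (w - z)].
  move=> pu pwu; have [|z [z1 z2]] := pos_dense ho (n := 1) (a := 0) (b := u) erefl.
    by rewrite subr0.
  rewrite subr0 mulr1n in z1; rewrite mulr1n in z2; exists z; split=> //.
  by rewrite (_ : w - z = (w - u) + (u - z)); [apply: posD | zmod].
case: (sgnP (y - x)) => [||h].
- exact: H.
- move/eqP; rewrite subr_eq0 => /eqP->.
  have [|z [z1 z2]] := pos_dense ho (n := 1) (a := 0) (b := x) erefl; first by rewrite subr0.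
  by move: z1 z2; rewrite subr0 mulr1n; exists z.
- by move: h; rewrite opprB => /(H y x py)[z []]; exists z.
Qed.

Lemma pos_small n y : (0 < n)%N -> pos y -> exists z, pos z /\ pos (y - z *+ n).
Proof.
move=> n0 py; have [|z []] := pos_dense ho (n := n) (a := 0) (b := y) n0.
  by rewrite subr0.
by rewrite subr0 => /posMn_inv; exists z.
Qed.

Lemma small_ex (s : seq V) B : (0 < B)%N -> exists e, pos e /\
  forall x, x \in s -> x <> 0 -> forall t, within t (e *+ B) -> sgn (x + t) = sgn x.
Proof.
move=> B0; elim: s => [|y s [e [he IH]]]; first by have [e] := pos_ex ho; exists e.
have [y0|y0] := pselect (y = 0).
  by exists e; split=> // x; rewrite inE => /orP[/eqP->|/IH].
have [a [ha hya]] : exists a, pos a /\ forall t, within t a -> sgn (y + t) = sgn y.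
  case: (sgnP y) => // h; [exists y | exists (- y)]; split=> // t ht.
  - by have /sgn_pos<- := h; apply: sgn_perturb; left.
  - by rewrite sgn_perturb; [apply/oppr_inj; rewrite opprK -sgnN; apply/sgn_pos | right].
have [b [hb hab]] := pos_small B0 ha.
have [c [hc hec hbc]] := pos_min he hb.
have W t d : pos (d - c) -> within t (c *+ B) -> within t (d *+ B).
  by move=> h /within_weak; apply; rewrite -mulrnBl; apply: posMn.
exists c; split=> // x; rewrite inE => /orP[/eqP-> _ t /(W _ _ hbc) h|/IH {}IH x0 t /(W _ _ hec)].
  by apply: hya; apply: within_weak h _.
exact: IH.
Qed.

Lemma coset_dense n c a b : (0 < n)%N -> pos (b - a) ->
  exists z, pos (c + z *+ n - a) /\ pos (b - (c + z *+ n)).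
Proof.
move=> n0 hab; have [|z [h1 h2]] := pos_dense ho (n := n) (a := a - c) (b := b - c) n0.
  by rewrite (_ : _ - _ = b - a) //; zmod.
exists z; split.
  by rewrite (_ : _ - _ = z *+ n - (a - c)) //; zmod.
by rewrite (_ : _ - _ = b - c - z *+ n) //; zmod.
Qed.

Lemma coset_avoid n c a b (ws : seq (int * V)) : (0 < n)%N -> pos (b - a) ->
  exists z, [/\ pos (c + z *+ n - a), pos (b - (c + z *+ n)) &
    forall w : int * V, w \in ws -> w.1 != 0 -> (c + z *+ n) *~ w.1 + w.2 <> 0].
Proof.
move=> n0 hab; elim: ws => [|[k u] ws [z [h1 h2 IH]]].
  by have [z []] := coset_dense c n0 hab; exists z.
pose f y (w : int * V) := (c + y *+ n) *~ w.1 + w.2.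
have [hf|hf] := pselect (f z (k, u) = 0); last first.
  by exists z; split=> // w; rewrite inE => /orP[/eqP->|/IH].
have [e [he hs]] := small_ex [seq f z w | w <- ws] (ltn0Sn (\max_(w <- ws) `|w.1|)).
have [d [hd hde hdb]] := pos_min he h2.
have [|y [y1 y2]] := @coset_dense n c (c + z *+ n) (c + z *+ n + d) n0.
  by rewrite addrC addKr.
have hy : within ((y - z) *+ n) e.
  split; first by rewrite (_ : _ - _ = (c + z *+ n + d - (c + y *+ n)) + (e - d)); [apply: posD | zmod].
  by rewrite (_ : _ + _ = e + (c + y *+ n - (c + z *+ n))); [apply: posD | zmod].
exists y; split.
- rewrite (_ : _ - _ = (c + y *+ n - (c + z *+ n)) + (c + z *+ n - a)); [exact: posD | zmod].
- rewrite (_ : _ - _ = (c + z *+ n + d - (c + y *+ n)) + (b - (c + z *+ n) - d)).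
    exact: posD.
  zmod.
move=> w; rewrite inE => /orP[/eqP-> /= k0|wws w0].
  have -> : (c + y *+ n) *~ k + u = f z (k, u) + (c + y *+ n - (c + z *+ n)) *~ k.
    by rewrite /f /=; zmod.
  by rewrite hf add0r => h; have := torsion_free h k0; exact: pos_neq0.
have h0 : sgn (f z w) <> 0 by move/sgn_eq0; apply: IH.
move/sgn_eq0; rewrite (_ : _ + _ = f z w + (y - z) *+ n *~ w.1); last by rewrite /f; zmod.
rewrite hs //; [exact: map_f | exact: IH |].
apply: withinMz => //; apply: leqW.
exact: (@leq_bigmax_seq _ _ xpredT (fun w : int * V => `|w.1|%N)).
Qed.

Lemma sgn_mid x t u : ~ pos (- t) -> ~ pos (- u) -> sgn x = sgn (x + t + u) ->
  sgn (x + t) = sgn x.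
Proof.
move=> ht hu; case: (sgnP t) ht => // [pt _|->]; last by rewrite addr0.
case: (sgnP u) hu => // [pu _|-> _]; last by rewrite addr0.
case: (sgnP x) => [px _|-> h|px].
- by apply/sgn_pos; apply: posD.
- have /sgn_pos q : pos (0 + t + u) by rewrite add0r; apply: posD.
  by rewrite q in h.
- move=> /esym h; apply/eqP; rewrite -eqr_opp -sgnN opprK; apply/eqP/sgn_pos.
  have : pos (- (x + t + u)) by apply/sgn_pos; rewrite sgnN h.
  move=> p; rewrite (_ : - _ = - (x + t + u) + u); [exact: posD | zmod].
Qed.

Definition between x y z :=
  (~ pos (x - y) /\ ~ pos (y - z)) \/ (~ pos (y - x) /\ ~ pos (z - y)).

Lemma sgn_between x y z k u : between x y z ->
  sgn (x *~ k + u) = sgn (z *~ k + u) -> sgn (y *~ k + u) = sgn (x *~ k + u).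
Proof.
have npos k' t : 0 <= k' -> ~ pos (- t) -> ~ pos (- (t *~ k')).
  move=> k0 ht; rewrite -mulNrz => /sgn_pos; rewrite sgnMz.
  by case: sgnP ht => // h _; case: sgzP k0.
have H x' y' z' k' u' : 0 <= k' -> ~ pos (x' - y') -> ~ pos (y' - z') ->
    sgn (x' *~ k' + u') = sgn (z' *~ k' + u') -> sgn (y' *~ k' + u') = sgn (x' *~ k' + u').
  move=> k0 h1 h2.
  have -> : y' *~ k' + u' = x' *~ k' + u' + (y' - x') *~ k' by zmod.
  have -> : z' *~ k' + u' = x' *~ k' + u' + (y' - x') *~ k' + (z' - y') *~ k' by zmod.
  by apply: sgn_mid; apply: npos; rewrite // opprB.
have H' x' y' z' : ~ pos (x' - y') -> ~ pos (y' - z') ->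
    sgn (x' *~ k + u) = sgn (z' *~ k + u) -> sgn (y' *~ k + u) = sgn (x' *~ k + u).
  move=> h1 h2; case: (lerP 0 k) => k0; first exact: H.
  have := H x' y' z' (- k) (- u) _ h1 h2; rewrite !mulrNz -!opprD !sgnN => {}H h.
  by apply: oppr_inj; apply: H; rewrite ?h //; lia.
case=> -[h1 h2] h; first exact: H' h1 h2 h.
by rewrite h; apply: H' h2 h1 (esym h).
Qed.

Lemma between0 x y z : sgn (x - y) <> sgn (z - y) -> between x y z.
Proof.
rewrite /between -(opprB x y) -(opprB z y).
case: (sgnP (x - y)) => [h1|->|h1]; case: (sgnP (z - y)) => [h2|->|h2] //= _;
  rewrite ?oppr0; try (by left; split; do 1?[exact: pos_irr ho|
    by move=> h; apply: (pos_asym h); rewrite ?opprK]);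
  by right; split; do 1?[exact: pos_irr ho|by move=> h; apply: (pos_asym h); rewrite ?opprK].
Qed.

(* Walks from [s] towards [s'] up to the wall [x *~ k + u = 0] that separates them. *)
Lemma wall_approach n k u s s' e : (0 < n)%N -> pos e ->
  sgn (s *~ k + u) <> sgn (s' *~ k + u) ->
  exists t, [/\ between s (s + t *+ n) s',
    sgn ((s + t *+ n) *~ k + u) = sgn (s *~ k + u) &
    within ((s + t *+ n) *~ k + u) e].
Proof.
move=> n0 he.
have H k' u' : pos (- (s *~ k' + u')) -> ~ pos (- (s' *~ k' + u')) ->
    exists t, [/\ between s (s + t *+ n) s', pos (- ((s + t *+ n) *~ k' + u')) &
    within ((s + t *+ n) *~ k' + u') e].
  set f := s *~ k' + u' => h h'.
  have k0 : k' != 0 by apply/eqP => k0; move: h h'; rewrite /f k0 !mulr0z.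
  have [d [hd hde hdf]] := pos_min he h.
  have [||z [z1 z2]] := @coset_dense (n * `|k'|)%N f (- d) 0; first by lia.
    by rewrite sub0r opprK.
  pose t := z *~ sgz k'; exists t.
  have ft : (s + t *+ n) *~ k' + u' = f + z *+ (n * `|k'|)%N.
    rewrite /f /t [in RHS]pmulrn PoszM.
    have -> : (`|k'|%N : int) = sgz k' * k' by case: sgzP; lia.
    zmod.
  rewrite ft; move: z1 z2; set F := f + _; rewrite opprK sub0r => z1 z2; split=> //; last first.
    split; last by rewrite (_ : _ + _ = (F + d) + (e - d)); [apply: posD | zmod].
    by rewrite addrC; apply: posD.
  have tk : pos (t *~ k').
    have : pos ((t *~ k') *+ n).
      rewrite (_ : _ *+ _ = F + d + (- f - d)); first exact: posD.
      by rewrite /F -ft /f; zmod.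
    exact: posMn_inv.
  have sk : pos ((s' - (s + t *+ n)) *~ k').
    case: (sgnP (s' *~ k' + u')) h' => // [p _|p _].
      rewrite (_ : _ *~ _ = (s' *~ k' + u') - F); first exact: posD.
      by rewrite /F -ft; zmod.
    rewrite (_ : _ *~ _ = (s' *~ k' + u') - F); last by rewrite /F -ft; zmod.
    by rewrite p sub0r.
  have P v : pos (v *~ k') -> pos (v *~ sgz k').
    by move=> /sgn_pos; rewrite sgnMz => q; apply/sgn_pos; rewrite sgnMz sgz_id.
  move: (P _ tk) (P _ sk); rewrite /between (_ : s - _ = - (t *+ n)); last by zmod.
  rewrite (_ : _ + _ - s = t *+ n); last by zmod.
  rewrite -(opprB s'); set r := s' - _.
  case: sgzP k0 => // kk _; rewrite ?mulr1z ?mulrN1z => p1 p2.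
    left; split=> q; last exact: (pos_asym p2).
    by apply: (@pos_asym (t *+ n)) => //; apply: posMn.
  right; split=> q; last exact: (pos_asym q).
  by apply: (pos_asym q); rewrite -mulNrn; apply: posMn.
case: (sgnP (s *~ k + u)) => [h hh|h _|h hh].
- have [||t [t1 t2 t3]] := H (- k) (- u).
  + by rewrite !mulrNz -opprD opprK.
  + by rewrite !mulrNz -opprD opprK => /sgn_pos h2; apply: hh; rewrite h2.
  move: t2 t3; rewrite !mulrNz -opprD opprK withinN => t2 t3.
  by exists t; split=> //; apply/sgn_pos.
- exists 0; rewrite mul0rn addr0 h; split; [|exact: sgn0|exact: within0].
  rewrite /between subrr; case: (sgnP (s - s')) => [p|->|p].
  + by right; split; [exact: pos_irr ho|rewrite -opprB; exact: pos_asym].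
  + by left; split; exact: pos_irr ho.
  + by left; split; [exact: pos_irr ho|move=> q; exact: (pos_asym q)].
- have [|t [t1 t2 t3]] := H k u h.
  + by move=> /sgn_pos; rewrite sgnN => h2; apply: hh; rewrite -h2 opprK.
  exists t; split=> //; apply/eqP; rewrite -eqr_opp -sgnN opprK; exact/eqP/sgn_pos.
Qed.

(* A union of cells of a wall arrangement that is constant around each wall is constant. *)
Lemma wall_path n (c : V) (C P : V -> Prop) (ws : seq (int * V)) : (0 < n)%N ->
  (forall x y z, C x -> C z -> between x y z -> C y) ->
  (forall w : int * V, w \in ws -> forall s s', C s -> C s' ->
     sgn (s *~ w.1 + w.2) <> sgn (s' *~ w.1 + w.2) ->
     exists e, pos e /\ forall x y, C (c + x *+ n) -> C (c + y *+ n) ->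
       within ((c + x *+ n) *~ w.1 + w.2) e -> within ((c + y *+ n) *~ w.1 + w.2) e ->
       (P (c + x *+ n) <-> P (c + y *+ n))) ->
  (forall s s', C (c + s *+ n) -> C (c + s' *+ n) ->
     (forall w : int * V, w \in ws -> sgn ((c + s *+ n) *~ w.1 + w.2) =
                        sgn ((c + s' *+ n) *~ w.1 + w.2)) ->
     (P (c + s *+ n) <-> P (c + s' *+ n))) ->
  forall s s', C (c + s *+ n) -> C (c + s' *+ n) ->
  (P (c + s *+ n) <-> P (c + s' *+ n)).
Proof.
move=> n0 convC; elim: ws => [_ det s s' hs hs'|[k u] ws IH loc det]; first exact: det.
apply: IH => [w hw|s s' hs hs' hws]; first by apply: loc; rewrite inE hw orbT.
set S := c + s *+ n; set S' := c + s' *+ n.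
have [heq|hne] := pselect (sgn (S *~ k + u) = sgn (S' *~ k + u)).
  by apply: det => // w; rewrite inE => /orP[/eqP->|/hws].
have [e [he hloc]] := loc (k, u) (mem_head _ _) _ _ hs hs' hne.
have [t [t1 t2 t3]] := wall_approach n0 he hne.
have [t' [t1' t2' t3']] := wall_approach n0 he (fun h => hne (esym h)).
have E : S + t *+ n = c + (s + t) *+ n by rewrite /S; zmod.
have E' : S' + t' *+ n = c + (s' + t') *+ n by rewrite /S'; zmod.
rewrite E in t1 t2 t3; rewrite E' in t1' t2' t3'.
have C1 := convC _ _ _ hs hs' t1; have C2 := convC _ _ _ hs' hs t1'.
apply: (iff_trans (B := P (c + (s + t) *+ n))).
  apply: det => // w; rewrite inE => /orP[/eqP-> //=|hw].
  by rewrite (sgn_between t1) //; apply: hws.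
apply: (iff_trans (hloc _ _ C1 C2 t3 t3')).
apply: iff_sym; apply: det => // w; rewrite inE => /orP[/eqP-> //=|hw].
by rewrite (sgn_between t1') //; apply/esym/hws.
Qed.
End Order.

(** * Integral linear forms and definability *)

Section Linear_forms.
Context {V : zmodType}.

Definition dvdV (n : nat) (x : V) : Prop := exists z, x = z *+ n.

Lemma dvdV0 n : dvdV n 0.
Proof. by exists 0; rewrite mul0rn. Qed.

Lemma dvdVD n x y : dvdV n x -> dvdV n y -> dvdV n (x + y).
Proof. by move=> [a ->] [b ->]; exists (a + b); rewrite mulrnDl. Qed.

Lemma dvdVMz n x k : dvdV n x -> dvdV n (x *~ k).
Proof. by move=> [a ->]; exists (a *~ k); zmod. Qed.

Lemma dvdVMn n x k : dvdV n x -> dvdV n (x *+ k).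
Proof. by rewrite pmulrn; apply: dvdVMz. Qed.

Lemma dvdVN n x : dvdV n (- x) <-> dvdV n x.
Proof. by split=> -[a e]; exists (- a); rewrite mulNrn -e ?opprK. Qed.

Lemma dvdVB n x y : dvdV n x -> dvdV n y -> dvdV n (x - y).
Proof. by move=> h /dvdVN; apply: dvdVD. Qed.

Lemma dvdVC n x y : dvdV n (x - y) <-> dvdV n (y - x).
Proof. by rewrite -dvdVN opprB. Qed.

Lemma dvdV_sum n (I : finType) (F : I -> V) : (forall i, dvdV n (F i)) ->
  dvdV n (\sum_i F i).
Proof. by move=> h; apply: (big_ind (dvdV n)) => //; [exact: dvdV0|exact: dvdVD]. Qed.

Lemma dvdV_trans m n x : (m %| n)%N -> dvdV n x -> dvdV m x.
Proof. by move=> /dvdnP[q ->] [z ->]; exists (z *+ q); rewrite mulrnA. Qed.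

Lemma dvdV_dvdz (n : nat) x (k : int) : (n %| k)%Z -> dvdV n (x *~ k).
Proof. by move=> /dvdzP[q ->]; exists (x *~ q); zmod. Qed.

Lemma dvdV_eqr n x y : dvdV n (x - y) -> (dvdV n x <-> dvdV n y).
Proof.
move=> h; split=> h'; last by rewrite -(subrK y x); apply: dvdVD.
by rewrite -(subKr x y); apply: dvdVB.
Qed.

Definition dot (I : finType) (k : I -> int) (x : I -> V) : V := \sum_i x i *~ k i.

Lemma dotDr (I : finType) (k : I -> int) x y :
  dot k (fun i => x i + y i) = dot k x + dot k y.
Proof. by rewrite /dot -big_split; apply: eq_bigr => i _; rewrite mulrzDl. Qed.

Lemma dotZr (I : finType) (k : I -> int) (x : V) (w : I -> int) :
  dot k (fun i => x *~ w i) = x *~ (\sum_i k i * w i).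
Proof.
by rewrite /dot mulrz_sumr; apply: eq_bigr => i _; rewrite -mulrzA mulrC.
Qed.

Lemma dotMnr (I : finType) (k : I -> int) (x : I -> V) n :
  dot k (fun i => x i *+ n) = dot k x *+ n.
Proof. by rewrite /dot -sumrMnl; apply: eq_bigr => i _; zmod. Qed.

Lemma dvdV_dot n (I : finType) (k : I -> int) x :
  (forall i, dvdV n (x i)) -> dvdV n (dot k x).
Proof. by move=> h; apply: dvdV_sum => i; apply: dvdVMz. Qed.

Definition act m n (A : 'M[int]_(m, n)) (x : 'I_n -> V) : 'I_m -> V :=
  fun i => dot (A i) x.

Lemma actM m n p (A : 'M[int]_(m, n)) (B : 'M[int]_(n, p)) x i :
  act A (act B x) i = act (A *m B) x i.
Proof.
rewrite /act /dot.
under eq_bigr do rewrite mulrz_suml.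
rewrite exchange_big /=; apply: eq_bigr => j _.
rewrite mxE mulrz_sumr; apply: eq_bigr => k _; zmod.
Qed.

Lemma act1 n (x : 'I_n -> V) i : act 1%:M x i = x i.
Proof.
rewrite /act /dot (bigD1 i) //= mxE eqxx big1 ?addr0 // => j ji.
by rewrite mxE eq_sym (negPf ji).
Qed.

Hypothesis tf : forall (x : V) k, x *~ k = 0 -> k != 0 -> x = 0.

Lemma dvdV_cofactor (n : nat) (d : int) (y : V) : dvdV n (y *~ d) ->
  exists2 g : nat, dvdV g y & (n %| d * g)%Z.
Proof.
move=> [z e]; have [n0|n0] := posnP n.
  rewrite n0 mulr0n in e; have [d0|d0] := eqVneq d 0.
    by exists 1%N; [exists y; rewrite mulr1n | rewrite d0 mul0r].
  by exists 0%N; [exists 0; rewrite (tf e d0) | rewrite mulr0].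
pose c := gcdn `|d| n; have c0 : (0 < c)%N by rewrite gcdn_gt0 n0 orbT.
exists (n %/ c)%N.
  have cn : (c %| n)%N by apply: dvdn_gcdr.
  have cd : (c %| `|d|)%N by apply: dvdn_gcdl.
  have [u [v uv]] := Bezoutz d n.
  have gE : gcdz d n = c by rewrite /gcdz absz_nat.
  exists (z *~ u + y *~ v).
  have h : (y - (z *~ u + y *~ v) *+ (n %/ c)) *~ c = 0.
    have -> : (y - (z *~ u + y *~ v) *+ (n %/ c)) *~ c =
       y *~ c - z *+ (n %/ c * c)%N *~ u - y *~ (v * ((n %/ c)%N * c)%N) by zmod.
    rewrite divnK // -e -[in y *~ c]gE -uv; zmod.
  by apply/eqP; rewrite -subr_eq0; apply/eqP; apply: tf h _; rewrite eqz_nat -lt0n.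
apply/dvdzP; exists (d %/ c)%Z.
rewrite -{1}(divzK (_ : (c %| d)%Z)) ?dvdzE ?dvdn_gcdl //.
rewrite -mulrA; congr (_ * _); rewrite -PoszM mulnC divnK //.
exact: dvdn_gcdr.
Qed.

(* An integral linear system that has a solution in [V / n] which does not vanish modulo [p]
   already has such a solution in the integers; [n = p = 0] stands for equations over [V]. *)
Lemma int_solution (D : finType) (ks : seq {ffun D -> int}) (n p : nat) (z : D -> V) :
  (forall k, k \in ks -> dvdV n (dot k z)) -> ~ (forall j, dvdV p (z j)) ->
  exists z0 : D -> int, (forall k, k \in ks -> (n %| \sum_j k j * z0 j)%Z) /\
    exists j, ~~ (p %| z0 j)%Z.
Proof.
move=> hk hz; pose q := size ks; pose m := #|D|.
pose K : 'M[int]_(q, m) := \matrix_(i, j) nth [ffun=> 0] ks i (enum_val j).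
pose x : 'I_m -> V := fun j => z (enum_val j).
have [L uL [R uR [d _ EK]]] := int_Smith_normal_form K.
set Dg : 'M_(q, m) := (\matrix_(i, j) _) in EK.
have hKx i : dvdV n (act K x i).
  rewrite (_ : act K x i = dot (nth [ffun=> 0] ks i) z); first exact/hk/mem_nth.
  rewrite /act /dot [RHS](reindex_onto enum_val enum_rank) /=; last by move=> *; exact: enum_rankK.
  by apply: eq_big => [j|j _]; rewrite ?mxE // enum_valK eqxx.
pose y := act R x.
have hDy i : dvdV n (act Dg y i).
  rewrite (_ : act Dg y i = act (invmx L) (act K x) i).
    by apply: dvdV_dot => j; exact: hKx.
  by rewrite actM EK -mulmxA mulKmx // -actM.
have xE j : x j = act (invmx R) y j by rewrite actM mulVmx // act1.
have [j hj] : exists j, ~ dvdV p (y j).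
  apply: contrapT => h; apply: hz => j; rewrite -(enum_rankK j) -/(x _) xE.
  by apply: dvdV_dot => i; apply: contrapT => hi; apply: h; exists i.
have DgE (v : 'I_m -> int) i : \sum_l Dg i l * v l =
    if insub (i : nat) is Some l then d`_i * v l else 0.
  case: insubP => [l li lE|li].
    rewrite (bigD1 l) //= mxE -lE eqxx mulr1n big1 ?addr0 // => l' ne.
    rewrite mxE -lE (_ : (_ == _ :> nat) = false) ?mul0r //.
    by apply/negbTE; rewrite eq_sym; apply: contra ne => /eqP/val_inj->.
  rewrite big1 // => l _; rewrite mxE (_ : (_ == _ :> nat) = false) ?mul0r //.
  by apply/negbTE; apply: contra li => /eqP->.
have [g gy gd] : exists2 g : nat, dvdV g (y j) & forall i : 'I_q, (n %|
  \sum_l Dg i l * (g%:Z *+ (l == j)))%Z.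
  have [jq|jq] := ltnP j q; last first.
    exists 1%N; first by exists (y j).
    move=> i; rewrite DgE; case: insubP => [l li lE|]; last by rewrite dvdz0.
    case: eqP => [lj|_]; last by rewrite mulr0n mulr0 dvdz0.
    by move: jq; rewrite -lj lE leqNgt ltn_ord.
  have := hDy (Ordinal jq); rewrite /act /dot (bigD1 j) //= mxE eqxx mulr1n big1 ?addr0; last first.
    move=> l lj; rewrite mxE /= (_ : (_ == _ :> nat) = false) ?mulr0n //.
    by apply/negbTE; apply: contra lj => /eqP/val_inj->.
  case/dvdV_cofactor => g gy gd; exists g => // i; rewrite DgE.
  case: insubP => [l li lE|]; last by rewrite dvdz0.
  case: eqP => [lj|_]; last by rewrite mulr0n mulr0 dvdz0.
  by rewrite -lE lj mulr1n.
have pg : ~~ (p %| g)%N by apply/negP => pg; apply: hj; apply: dvdV_trans gy.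
pose v : 'cV[int]_m := \col_l (g%:Z *+ (l == j)).
pose z1 := invmx R *m v.
exists (fun j' => z1 (enum_rank j') 0); split.
  move=> k hkk; have i_lt : (index k ks < q)%N by rewrite index_mem.
  pose i := Ordinal i_lt.
  have -> : \sum_j' k j' * z1 (enum_rank j') 0 = (K *m z1) i 0.
    rewrite mxE [LHS](reindex_onto enum_val enum_rank) /=; last by move=> *; exact: enum_rankK.
    apply: eq_big => [l|l _]; rewrite ?mxE enum_valK ?eqxx // nth_index //.
  rewrite EK /z1 -mulmxA mulKVmx // -mulmxA mxE.
  apply: (big_ind (fun t => (n %| t)%Z)) => [||l _]; [exact: dvdz0 | by move=> *; apply: rpredD |].
  apply: dvdz_mull; rewrite mxE.
  have := gd l; rewrite (eq_bigr (fun l' => Dg l l' * v l' 0)) // => l' _.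
  by rewrite [v _ _]mxE.
apply: contrapT => h.
have hz1 l : (p %| (z1 l 0)%R)%Z.
  by apply: contraT => hl; case: h; exists (enum_val l); rewrite enum_valK.
case/negP: pg; have : (p %| ((R *m z1) j 0)%R)%Z.
  by rewrite mxE; apply: (big_ind (fun t => (p %| t)%Z)) => [||l _]; [exact: dvdz0 | by move=> *;
    apply: rpredD | apply: dvdz_mull].
by rewrite /z1 mulKVmx // mxE eqxx mulr1n dvdzE.
Qed.
End Linear_forms.

Lemma int_generic (J : finType) (ks : seq {ffun J -> int}) :
  exists w : J -> int, forall k, k \in ks -> k <> [ffun=> 0] -> \sum_j k j * w j <> 0.
Proof.
elim: ks => [|k ks [w IH]]; first by exists (fun=> 0).
have [hk|hk] := pselect (\sum_j k j * w j = 0 /\ k <> [ffun=> 0]); last first.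
  exists w => k'; rewrite inE => /orP[/eqP->|/IH//] k0 h; exact: hk.
have [hk0 kn0] := hk.
have [j0 kj0] : exists j0, k j0 != 0.
  apply: contrapT => h; apply: kn0; apply/ffunP => j; rewrite ffunE.
  by apply: contrapT => /eqP hj; apply: h; exists j.
pose B : int := (\max_(k' <- ks) `|k' j0|).+1.
pose w' j := B * w j + (j == j0)%:R.
have E (k' : {ffun J -> int}) : \sum_j k' j * w' j = B * (\sum_j k' j * w j) + k' j0.
  rewrite mulr_sumr -(big_pred1_eq (+%R) j0 (fun j => k' j)) [in X in _ + X]big_mkcond /=.
  rewrite -big_split /=; apply: eq_bigr => j _; rewrite /w' mulrDr mulrCA.
  by case: eqP => _; rewrite ?mulr1 ?mulr0.
exists w' => k'; rewrite inE E => /orP[/eqP-> _|k'ks k'0].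
  by rewrite hk0 mulr0 add0r; apply/eqP.
have := IH _ k'ks k'0; set s := \sum_j _ => s0.
have hB : `|k' j0| < B.
  rewrite /B -abszE ltz_nat ltnS.
  exact: (@leq_bigmax_seq _ _ xpredT (fun k' : {ffun J -> int} => `|k' j0|%N)).
clear E IH hk hk0 w'; move: (k' j0) s s0 hB; move: B => b c s s0 hB.
have b0 : 0 <= b by lia.
have [h|h] : (1 <= s) \/ (s <= -1) by lia.
  by have := ler_wpM2l b0 h; lia.
by have := ler_wpM2l b0 h; lia.
Qed.

Definition vcat (V : Type) (I J : Type) (x : I -> V) (y : J -> V) : I + J -> V :=
  fun s => match s with inl i => x i | inr j => y j end.

Record definability (V : zmodType) (pos : V -> Prop)
    (Dfn : forall I : finType, ((I -> V) -> Prop) -> Prop) : Prop := Definability {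
  dfn_bot : forall I : finType, Dfn I (fun=> False);
  dfn_imp : forall (I : finType) P Q, Dfn I P -> Dfn I Q -> Dfn I (fun x => P x -> Q x);
  dfn_all : forall (I J : finType) P, Dfn (I + J)%type P ->
    Dfn I (fun x => forall y, P (vcat x y));
  dfn_map : forall (I J : finType) (g : I -> J) P, Dfn I P ->
    Dfn J (fun y => P (y \o g));
  dfn_pos : forall (I : finType) (k : I -> int), Dfn I (fun x => pos (dot k x));
  dfn_qe : forall (I : finType) P, Dfn I P ->
    exists (ks : seq {ffun I -> int}) (N : nat), (0 < N)%N /\
    forall x x', (forall k, k \in ks -> sgn (pos := pos) (dot k x) = sgn (pos := pos) (dot k x') /\
        (dvdV N (dot k x) <-> dvdV N (dot k x'))) -> (P x <-> P x') }.

Section Definability.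
Context {V : zmodType} {pos : V -> Prop} (ho : regular_oag pos).
Context {Dfn : forall I : finType, ((I -> V) -> Prop) -> Prop}.
Hypothesis hD : definability pos Dfn.
Local Notation sgn := (sgn (pos := pos)).

Lemma dfn_ext (I : finType) (P Q : (I -> V) -> Prop) : (forall x, P x <-> Q x) -> Dfn P -> Dfn Q.
Proof. by move=> h; rewrite (_ : P = Q) //; apply: funext => x; apply: propext. Qed.

Lemma dfn_not (I : finType) (P : (I -> V) -> Prop) : Dfn P -> Dfn (fun x => ~ P x).
Proof. by move=> h; apply: (dfn_imp hD h); apply: (dfn_bot hD). Qed.

Lemma dfn_and (I : finType) (P Q : (I -> V) -> Prop) :
  Dfn P -> Dfn Q -> Dfn (fun x => P x /\ Q x).
Proof.
move=> h h'; apply: (@dfn_ext _ (fun x => ~ (P x -> ~ Q x))).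
  move=> x; split=> [hx|[p q] /(_ p)//].
  by split; apply: contrapT => n; apply: hx => p // q; apply: n.
by apply: dfn_not; apply: (dfn_imp hD) => //; apply: dfn_not.
Qed.

Lemma dfn_iff (I : finType) (P Q : (I -> V) -> Prop) :
  Dfn P -> Dfn Q -> Dfn (fun x => P x <-> Q x).
Proof. by move=> h h'; apply: dfn_and; apply: (dfn_imp hD). Qed.

Lemma dfn_ex (I J : finType) (P : (I + J -> V) -> Prop) : Dfn P ->
  Dfn (fun x => exists y, P (vcat x y)).
Proof.
move=> h; apply: (@dfn_ext _ (fun x => ~ forall y, ~ P (vcat x y))).
  move=> x; split=> [hx|[y hy] /(_ y)//].
  by apply: contrapT => n; apply: hx => y hy; apply: n; exists y.
exact: (dfn_not (dfn_all hD (dfn_not h))).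
Qed.

Lemma dfn_true (I : finType) : Dfn (fun _ : I -> V => True).
Proof.
by apply: (@dfn_ext _ (fun=> False -> False)) => //; exact: (dfn_imp hD (dfn_bot hD I) (dfn_bot hD I)).
Qed.

Lemma dfn_const (I : finType) (A : Prop) : Dfn (fun _ : I -> V => A).
Proof.
have [a|a] := pselect A; [apply: dfn_ext (dfn_true I) | apply: dfn_ext (dfn_bot hD I)];
  by move=> ?; split.
Qed.

Lemma dfn_forall (I J : finType) (P : J -> (I -> V) -> Prop) : (forall j, Dfn (P j)) ->
  Dfn (fun x => forall j, P j x).
Proof.
move=> h; apply: (@dfn_ext _ (fun x => forall j, j \in enum J -> P j x)).
  by move=> x; split=> hx j //; apply: hx; rewrite mem_enum.
elim: (enum J) => [|j s IH]; first by apply: dfn_ext (dfn_true I).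
apply: dfn_ext (dfn_and (h j) IH) => x; split=> [[h1 h2] i|hx].
  by rewrite inE => /orP[/eqP->|/h2].
by split=> [|i si]; apply: hx; rewrite inE ?eqxx ?si ?orbT.
Qed.

Lemma dfn_ex1 (I : finType) (P : V -> (I -> V) -> Prop) :
  Dfn (fun x : I + unit -> V => P (x (inr tt)) (x \o inl)) ->
  Dfn (fun x => exists y, P y x).
Proof.
move=> h; apply: dfn_ext (dfn_ex h) => x; split=> -[y hy]; last by exists (fun=> y).
by exists (y tt).
Qed.

Lemma sgn_eqE (k : int) (x : V) : sgn x = k <->
  ((k = 1 /\ pos x) \/ (k = -1 /\ pos (- x)) \/ (k = 0 /\ ~ pos x /\ ~ pos (- x))).
Proof.
case: (sgnP ho x) => [p|->|p]; split.
- by left.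
- by case=> [[]|[[_ /(pos_asym ho p)]|[_ []]]].
- by move=> <-; right; right; rewrite oppr0; split=> //; split; exact: pos_irr ho.
- by case=> [[_ /(pos_irr ho)]|[[_]|[->]]] //; rewrite oppr0 => /(pos_irr ho).
- by right; left.
- by case=> [[_ /(pos_asym ho) /(_ p)]|[[->]|[_ [_ /(_ p)]]]].
Qed.

Lemma dfn_or (I : finType) (P Q : (I -> V) -> Prop) :
  Dfn P -> Dfn Q -> Dfn (fun x => P x \/ Q x).
Proof.
move=> h h'; apply: (@dfn_ext _ (fun x => ~ P x -> Q x)).
  move=> x; split=> [hx|[p|q] //].
  by have [p|p] := pselect (P x); [left | right; apply: hx].
by apply: (dfn_imp hD) => //; apply: dfn_not.
Qed.

Lemma dotN (I : finType) (k : I -> int) (x : I -> V) : dot (fun i => - k i) x = - dot k x.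
Proof. by rewrite /dot -sumrN; apply: eq_bigr => i _; rewrite mulrNz. Qed.

Lemma dfn_sgn (I : finType) (k : I -> int) s : Dfn (fun x => sgn (dot k x) = s).
Proof.
have hp := dfn_pos hD k.
have hn : Dfn (fun x => pos (- dot k x)).
  by apply: dfn_ext (dfn_pos hD (fun i => - k i)) => x; rewrite dotN.
apply: (@dfn_ext _ _ _ (fun x => iff_sym (sgn_eqE s (dot k x)))).
by do ![apply: dfn_or | apply: dfn_and | apply: dfn_not | exact: dfn_const].
Qed.

Lemma dfn_eq0 (I : finType) (k : I -> int) : Dfn (fun x => dot k x = 0).
Proof. by apply: dfn_ext (dfn_sgn k 0) => x; exact: (sgn_eq0 ho). Qed.

Lemma dot_vcat (I J : finType) (k : I + J -> int) (x : I -> V) (y : J -> V) :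
  dot k (vcat x y) = dot (k \o inl) x + dot (k \o inr) y.
Proof. by rewrite /dot big_sumType. Qed.

Lemma dot_unit (k : unit -> int) (y : unit -> V) : dot k y = y tt *~ k tt.
Proof. by rewrite /dot (big_pred1 tt) //; case. Qed.

Lemma dfn_dvd (I : finType) N (k : I -> int) : Dfn (fun x => dvdV N (dot k x)).
Proof.
apply: dfn_ext (dfn_ex (dfn_eq0 (vcat k (fun _ : unit => - N%:Z)))) => x.
split=> [[y]|[z hz]].
  rewrite dot_vcat dot_unit /= => /eqP; rewrite mulrNz subr_eq0 => /eqP h.
  by exists (y tt); rewrite pmulrn -h.
by exists (fun=> z); rewrite dot_vcat dot_unit /= (_ : dot _ x = dot k x) // hz; zmod.
Qed.

(* Shifting [d] by a large multiple of [N] in a generic direction fixes the signs of all forms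
   that involve [d], so only congruences of such forms matter. *)
Lemma dfn_qe_res (I J : finType) (P : (I + J -> V) -> Prop) N0 : Dfn P -> (0 < N0)%N ->
  (forall x d d', (forall j, dvdV N0 (d j - d' j)) -> P (vcat x d) -> P (vcat x d')) ->
  exists (ls : seq {ffun I -> int}) (ks : seq {ffun I + J -> int}) (N : nat),
    [/\ (0 < N)%N, (N0 %| N)%N & forall x d x' d',
      (forall l, l \in ls -> sgn (dot l x) = sgn (dot l x')) ->
      (forall k, k \in ks -> dvdV N (dot k (vcat x d)) <-> dvdV N (dot k (vcat x' d'))) ->
      (P (vcat x d) <-> P (vcat x' d'))].
Proof.
move=> dP N00 inv; have [ks [N1 [N10 qe]]] := dfn_qe hD dP.
pose res (k : {ffun I + J -> int}) : {ffun J -> int} := [ffun j => k (inr j)].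
have [w hw] := int_generic [seq res k | k <- ks].
exists [seq [ffun i => k (inl i)] | k : {ffun I + J -> int} <- ks].
exists [seq [ffun i => k i * N0%:Z] | k : {ffun I + J -> int} <- ks], (N0 * N1)%N.
split=> [||x d x' d' hl hk]; rewrite ?dvdn_mulr // ?muln_gt0 ?N00 //.
have hcong k (y : I + J -> V) : k \in ks -> dvdV (N0 * N1) (dot [ffun i => k i * N0%:Z] y) <->
  dvdV N1 (dot k y).
  move=> kks; have -> : dot [ffun i => k i * N0%:Z] y = dot k y *+ N0.
    by rewrite /dot -sumrMnl; apply: eq_bigr => i _; rewrite ffunE; zmod.
  split=> -[z e]; exists z; last by rewrite e -mulrnA mulnC.
  apply/eqP; rewrite -subr_eq0; apply/eqP; apply: (torsion_freen ho (n := N0)) => //.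
  by rewrite mulrnBl e -mulrnA mulnC subrr.
have {}hk k : k \in ks -> dvdV N1 (dot k (vcat x d)) <-> dvdV N1 (dot k (vcat x' d')).
  by move=> kks; rewrite -!hcong //; apply: hk; apply: map_f.
have [h [_ hh]] := huge_ex ho ([seq dot k (vcat x d) | k : {ffun _ -> _} <- ks] ++
                            [seq dot k (vcat x' d') | k : {ffun _ -> _} <- ks]).
pose N := (N0 * N1)%N; have N_gt0 : (0 < N)%N by rewrite muln_gt0 N00.
pose sh (e : J -> V) j := e j + (h *+ N) *~ w j.
have dotsh (k : {ffun I + J -> int}) (y : I -> V) e :
  dot k (vcat y (sh e)) = dot k (vcat y e) + (h *+ N) *~ (\sum_j res k j * w j).
  rewrite !dot_vcat /sh dotDr dotZr addrA; congr (_ + _ *~ _).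
  by apply: eq_bigr => j _; rewrite ffunE.
have invsh (y : I -> V) e : P (vcat y e) <-> P (vcat y (sh e)).
  split; apply: inv => j; rewrite /sh.
    apply/dvdVC; rewrite addrC addKr; apply: dvdVMz; exists (h *+ N1).
    by rewrite -mulrnA mulnC.
  rewrite addrC addKr; apply: dvdVMz; exists (h *+ N1).
  by rewrite -mulrnA mulnC.
rewrite (invsh x d) (invsh x' d'); apply: qe => k kks; split; last first.
  have hdv (y : I -> V) e : dvdV N1 (dot k (vcat y (sh e))) <-> dvdV N1 (dot k (vcat y e)).
    apply: dvdV_eqr; rewrite dotsh addrC addKr; apply: dvdVMz; exists (h *+ N0).
    by rewrite -mulrnA.
  by rewrite !hdv; apply: hk.
rewrite !dotsh.
have [hr|hr] := pselect (res k = [ffun=> 0]).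
  rewrite (_ : \sum_j _ = 0) ?mulr0z ?addr0; last first.
    by rewrite big1 // => j _; rewrite hr ffunE mul0r.
  have hk0 (y : I -> V) (e : J -> V) : dot k (vcat y e) = dot [ffun i => k (inl i)] y.
    rewrite dot_vcat [X in _ + X]big1 ?addr0 => [|j _]; last first.
      by have /ffunP/(_ j) := hr; rewrite !ffunE /= => ->; rewrite mulr0z.
    by apply: eq_bigr => i _; rewrite ffunE.
  by rewrite !hk0; apply: hl; apply: map_f.
have ws : \sum_j res k j * w j != 0 by apply/eqP/hw => //; apply: map_f.
have W y : within (pos := pos) y h -> within (pos := pos) y (h *+ N).
  by move=> hy; rewrite -[y]mulr1n; apply: (withinMn ho).
rewrite !(sgn_dominated ho) //; apply/W/hh; rewrite mem_cat.
  by apply/orP; right; apply: (map_f (fun k : {ffun _ -> _} => dot k _)).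
by apply/orP; left; apply: (map_f (fun k : {ffun _ -> _} => dot k _)).
Qed.
End Definability.

Local Open Scope classical_set_scope.

Lemma finite_key (A K B : Type) (key : A -> K) (g : A -> B) (S : set A) :
  finite_set [set key x | x in S] ->
  (forall x y, S x -> S y -> key x = key y -> g x = g y) ->
  finite_set [set g x | x in S].
Proof.
move=> hk hg; have [[x0 Sx0]|h0] := pselect (exists x, S x); last first.
  rewrite (_ : [set _ | _ in _]%classic = set0); first exact: finite_set0.
  by apply/seteqP; split => // b [x Sx _]; case: h0; exists x.
have /choice[h hh] k : exists b, forall x, S x -> key x = k -> g x = b.
  have [[x [Sx <-]]|hn] := pselect (exists x, S x /\ key x = k).
    by exists (g x) => y Sy e; apply: hg.
  by exists (g x0) => x Sx e; case: hn; exists x.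
apply: sub_finite_set (finite_image h hk) => b [x Sx <-].
by exists (key x); [exists x | rewrite (hh (key x) x)].
Qed.

Section Linear_definability.
Context {V : zmodType} {pos : V -> Prop} (ho : regular_oag pos).
Context {Dfn : forall I : finType, ((I -> V) -> Prop) -> Prop}.
Hypothesis hD : definability pos Dfn.
Local Notation sgn := (sgn (pos := pos)).

Definition linear_form (I : finType) (F : (I -> V) -> V) :=
  exists k : I -> int, forall z, F z = dot k z.

Lemma lin_var (I : finType) (i : I) : linear_form (fun z => z i).
Proof.
exists (fun j => (j == i)%:R) => z; rewrite /dot (bigD1 i) //= eqxx mulr1z.
by rewrite big1 ?addr0 // => j /negPf->; rewrite mulr0z.
Qed.

Lemma lin_opp (I : finType) (F : (I -> V) -> V) : linear_form F -> linear_form (fun z => - F z).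
Proof. by case=> k h; exists (fun i => - k i) => z; rewrite h dotN. Qed.

Lemma lin_add (I : finType) (F G : (I -> V) -> V) : linear_form F -> linear_form G ->
  linear_form (fun z => F z + G z).
Proof.
move=> [k h] [l h']; exists (fun i => k i + l i) => z; rewrite h h' /dot -big_split.
by apply: eq_bigr => i _; rewrite mulrzDr.
Qed.

Lemma lin_mulz (I : finType) (F : (I -> V) -> V) (m : int) : linear_form F ->
  linear_form (fun z => F z *~ m).
Proof.
move=> [k h]; exists (fun i => k i * m) => z; rewrite h /dot mulrz_suml.
by apply: eq_bigr => i _; rewrite mulrzA.
Qed.

Lemma lin_muln (I : finType) (F : (I -> V) -> V) (m : nat) : linear_form F ->
  linear_form (fun z => F z *+ m).
Proof. exact: (@lin_mulz I F m). Qed.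

Lemma lin_dot (I J : finType) (f : J -> I) (k : J -> int) :
  linear_form (fun z : I -> V => dot k (z \o f)).
Proof.
rewrite /dot; elim: (index_enum J) => [|j s [l IH]].
  by exists (fun=> 0) => z; rewrite big_nil /dot big1 // => i _; rewrite mulr0z.
have [l' h] := lin_add (lin_mulz (k j) (lin_var (f j))) (ex_intro _ l IH).
by exists l' => z; rewrite -h big_cons.
Qed.

Lemma dfn_linsgn (I : finType) (F : (I -> V) -> V) s : linear_form F -> Dfn (fun z => sgn (F z) = s).
Proof. by case=> k h; apply: dfn_ext (dfn_sgn ho hD k s) => z; rewrite h. Qed.

Lemma dfn_lindvd (I : finType) (F : (I -> V) -> V) n : linear_form F -> Dfn (fun z => dvdV n (F z)).
Proof. by case=> k h; apply: dfn_ext (dfn_dvd ho hD n k) => z; rewrite h. Qed.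

Lemma dfn_lineq (I : finType) (F G : (I -> V) -> V) : linear_form F -> linear_form G ->
  Dfn (fun z => F z = G z).
Proof.
move=> hF /lin_opp hG; have [k h] := lin_add hF hG.
apply: dfn_ext (dfn_eq0 ho hD k) => z; rewrite -h.
by split=> [/eqP|->]; rewrite ?subrr // subr_eq0 => /eqP.
Qed.

Lemma dfn_seq (I : finType) (T : eqType) (s : seq T) (P : T -> (I -> V) -> Prop) :
  (forall l, Dfn (P l)) -> Dfn (fun z => forall l, l \in s -> P l z).
Proof.
move=> h; elim: s => [|j s IH]; first by apply: dfn_ext (dfn_true hD I).
apply: dfn_ext (dfn_and hD (h j) IH) => z; split=> [[h1 h2] i|hz].
  by rewrite inE => /orP[/eqP->|/h2].
by split=> [|i si]; apply: hz; rewrite inE ?eqxx ?si ?orbT.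
Qed.
End Linear_definability.

Ltac linear_forms :=
  do ?[apply: lin_add | apply: lin_opp | apply: lin_mulz | apply: lin_muln
      | exact: lin_var | exact: lin_dot].

Section Elimination.
Context {V : zmodType} {pos : V -> Prop} (ho : regular_oag pos).
Context {Dfn : forall I : finType, ((I -> V) -> Prop) -> Prop}.
Hypothesis hD : definability pos Dfn.
Context (X : finType) (E : (X -> V) -> (X -> V) -> Prop).
Hypothesis E_refl : forall x, E x x.
Hypothesis E_sym : forall x y, E x y -> E y x.
Hypothesis E_trans : forall x y z, E x y -> E y z -> E x z.
Hypothesis dE : Dfn (fun z : X + X -> V => E (z \o inl) (z \o inr)).
Context (a : X -> V).
Local Notation sgn := (sgn (pos := pos)).
Local Notation within := (within (pos := pos)).
Local Notation between := (between (pos := pos)).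

(* [R _ c d] defines the class of [a] from the elements [c] and the residues of [d] modulo [N]. *)
Definition codes (C D : finType) (R : (X -> V) -> (C -> V) -> (D -> V) -> Prop)
    (c : C -> V) (d : D -> V) : Prop :=
  forall x, R x c d <-> E a x.

Record coding (C D : finType) (N : nat) (R : (X -> V) -> (C -> V) -> (D -> V) -> Prop)
    : Prop := Coding {
  coding_dfn : Dfn (fun z : (X + C) + D -> V => R (z \o inl \o inl) (z \o inl \o inr) (z \o inr));
  coding_gt0 : (0 < N)%N;
  coding_inv : forall x c d d', (forall j, dvdV N (d j - d' j)) -> R x c d -> R x c d' }.

Definition class_of (C D : finType) (R : (X -> V) -> (C -> V) -> (D -> V) -> Prop) x c d : Prop :=
  forall x', R x' c d <-> E x x'.

Lemma class_of_coding (C D : finType) N (R : (X -> V) -> (C -> V) -> (D -> V) -> Prop) :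
  coding N R -> coding N (class_of R).
Proof.
case=> dR N0 inv; split=> //.
  pose g (s : (X + C) + D) : ((X + C) + D) + X :=
    match s with inl (inl i) => inr i | inl (inr i) => inl (inl (inr i)) | inr i => inl (inr i) end.
  pose g' (s : X + X) : ((X + C) + D) + X :=
    match s with inl i => inl (inl (inl i)) | inr i => inr i end.
  exact: (dfn_all hD (dfn_iff hD (dfn_map hD g dR) (dfn_map hD g' dE))).
move=> x c d d' h H x'; rewrite -H; split; apply: inv => // j.
by apply/dvdVC.
Qed.

Lemma key_sgn (x y : V) : (`[<pos x>], `[<pos (- x)>]) = (`[<pos y>], `[<pos (- y)>]) ->
  sgn x = sgn y.
Proof. by rewrite /sgn => -[-> ->]. Qed.

Lemma infinite_codes_shift (C D : finType) N (R : (X -> V) -> (C -> V) -> (D -> V) -> Prop) :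
  coding N R -> ~ finite_set [set c | exists d, codes R c d] ->
  exists c d (w : C -> int) i0 N1 e, [/\ w i0 != 0, (0 < N1)%N, pos e &
    forall t, within (t *+ N1) e -> codes R (fun i => c i + t *+ N1 *~ w i) d].
Proof.
move=> hR inf; have [dR' N0 inv'] := class_of_coding hR.
have [ls [ks [N1 [N10 NN1 qe]]]] := dfn_qe_res ho hD dR' N0 (fun x => inv' (x \o inl) (x \o inr)).
pose S := [set cd : (C -> V) * (D -> V) | codes R cd.1 cd.2].
pose key (cd : (C -> V) * (D -> V)) :
    {ffun 'I_(size ls) -> bool * bool} * {ffun 'I_(size ks) -> bool} :=
  ([ffun i : 'I_(size ls) => let v := dot (nth [ffun=>
    0] ls i) (vcat a cd.1) in (`[<pos v>], `[<pos (- v)>])],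
   [ffun i : 'I_(size ks) => `[<dvdV N1 (dot (nth [ffun=> 0] ks i) (vcat (vcat a cd.1) cd.2))>]]).
have [[[c1 d1] [[c2 d2] [h1 h2 hkey hne]]]|hn] :=
  pselect (exists cd cd', [/\ S cd, S cd', key cd = key cd' & cd.1 <> cd'.1]); last first.
  case: inf; apply: sub_finite_set (finite_key (key := key) (g := fst) (S := S) _ _).
  - by move=> c [d h]; exists (c, d).
  - exact: finite_finset.
  - by move=> x y Sx Sy e; apply: contrapT => ne; apply: hn; exists x, y.
have hsgn l : l \in ls -> sgn (dot l (vcat a c1)) = sgn (dot l (vcat a c2)).
  move=> lls; have il : (index l ls < size ls)%N by rewrite index_mem.
  by case: hkey => /ffunP/(_ (Ordinal il)); rewrite !ffunE /= nth_index // => /key_sgn.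
pose zs := [seq [ffun j => l (inr j)] | l : {ffun X + C -> int} <- ls & `[<dot l (vcat a c1) = 0>]].
have [||w [hw [i0 wi0]]] := @int_solution V (torsion_free ho) C zs 0 0 (fun j => c1 j - c2 j).
- move=> k /mapP[l]; rewrite mem_filter => /andP[/asboolP l0 lls ->].
  exists 0; rewrite mul0rn.
  have l0' : dot l (vcat a c2) = 0 by apply/(sgn_eq0 ho); rewrite -hsgn // l0; apply/(sgn_eq0 ho).
  have : dot l (vcat a c1) - dot l (vcat a c2) = 0 by rewrite l0 l0' subrr.
  rewrite !dot_vcat (_ : _ \o inr = [ffun j => l (inr j)]); last first.
    by apply: funext => j; rewrite ffunE.
  have -> : (fun j => c1 j - c2 j) = (fun j => c1 j + (fun j => c2 j *~ -1) j).
    by apply: funext => j; rewrite mulrN1z.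
  rewrite dotDr (_ : dot _ (fun j => c2 j *~ -1) = - dot [ffun j => l (inr j)] c2); last first.
    by rewrite /dot -sumrN; apply: eq_bigr => j _; zmod.
  by move=> <-; rewrite opprD addrACA subrr add0r.
- move=> h; apply: hne => /=; apply: funext => j.
  by have [z] := h j; rewrite mulr0n => /eqP; rewrite subr_eq0 => /eqP.
pose wt (l : {ffun X + C -> int}) : int := \sum_j l (inr j) * w j.
have [e [he hs]] := small_ex ho [seq dot l (vcat a c1) | l : {ffun X + C -> int} <- ls]
   (ltn0Sn (\max_(l <- ls) `|wt l|%N)).
exists c1, d1, w, i0, N1, e; split=> //; first by rewrite dvd0z in wi0.
move=> t ht; have : class_of R a c1 d1 by [].
suff : class_of R a c1 d1 <-> class_of R a (fun i => c1 i + t *+ N1 *~ w i) d1 by case.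
pose x := vcat a c1; pose x' := vcat a (fun i => c1 i + t *+ N1 *~ w i).
have dotE (l : {ffun X + C -> int}) : dot l x' = dot l x + t *+ N1 *~ (\sum_j l (inr j) * w j).
  by rewrite !dot_vcat dotDr dotZr addrA.
apply: (qe x d1 x' d1) => [l lls|k kks]; last first.
  apply: dvdV_eqr; rewrite !dot_vcat opprD addrACA subrr addr0 dotDr dotZr addrA opprD addNKr.
  by apply/dvdVN; apply: dvdVMz; exists t.
rewrite dotE; have [l0|l0] := pselect (dot l x = 0).
  have := hw [ffun j => l (inr j)]; rewrite (_ : \sum_j _ = \sum_j l (inr j) * w j); last first.
    by apply: eq_bigr => j _; rewrite ffunE.
  rewrite dvd0z => /(_ _)/eqP->; first by rewrite mulr0z addr0.
  by apply/map_f; rewrite mem_filter lls andbT; apply/asboolP.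
rewrite hs //; first exact: (map_f (fun l : {ffun X + C -> int} => dot l (vcat a c1))).
apply: (withinMz ho) => //; apply: leqW.
exact: (@leq_bigmax_seq _ _ xpredT (fun l : {ffun X + C -> int} => `|wt l|%N)).
Qed.

(** * Moving along a line *)

Lemma within_div (t : V) q e : q != 0 -> within (t *~ q) e -> within t e.
Proof.
have H n (x : V) : within (x *+ n.+1) e -> within x e.
  move=> h; have he := within_pos ho h; case: h => h1 h2.
  case: (sgnP ho x) => [p|->|p]; last 2 first.
  - exact: within0.
  - apply/withinN; split; last exact: (posD ho).
    rewrite opprK; move: h2; have [->|n0] := posnP n; first by rewrite mulr1n.
    move=> h2.
    rewrite (_ : _ + _ = e + x *+ n.+1 + (- x) *+ n); last by zmod.
    by apply: (posD ho) => //; apply: (posMn ho).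
  split; last exact: (posD ho).
  case: n h1 {h2} => [|n] h1; first by rewrite mulr1n in h1.
  rewrite (_ : _ - _ = e - x *+ n.+2 + x *+ n.+1); last by zmod.
  by apply: (posD ho) => //; apply: (posMn ho).
case: (intP q) => // n _; first by rewrite -pmulrn; apply: H.
by rewrite mulrNz => /withinN; rewrite -pmulrn; apply: H.
Qed.

Section Line_elimination.
Context (C D : finType) (N : nat) (R : (X -> V) -> (C -> V) -> (D -> V) -> Prop).
Hypothesis hR : coding N R.
Context (i0 : C) (w : C -> int).
Hypothesis w0 : w i0 != 0.

Local Notation C' := {i : C | i != i0}.

(* The line in direction [w] that is determined by [c'], at the point with coordinate [s] at [i0]. *)
Definition line_class (x : X -> V) (s : V) (c' : C' -> V) (d : D -> V) : Prop :=
  exists y : C -> V, [/\ y i0 = s, forall i, y (val i) *~ w i0 = c' i + s *~ w (val i)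
    & class_of R x y d].

Lemma dfn_line_class :
  Dfn (fun z : ((X + C') + D) + unit -> V =>
    line_class (z \o inl \o inl \o inl) (z (inr tt)) (z \o inl \o inl \o inr) (z \o inl \o inr)).
Proof.
pose Q (x : X -> V) (s : V) (c' : C' -> V) (d : D -> V) (y : C -> V) :=
  y i0 = s /\ (forall i, y (val i) *~ w i0 = c' i + s *~ w (val i)) /\ class_of R x y d.
apply: (@dfn_ext _ _ _ (fun z => exists y, Q (z \o inl \o inl \o inl) (z (inr tt))
   (z \o inl \o inl \o inr) (z \o inl \o inr) y)).
  by move=> z; split=> -[y]; [case=> h1 [h2 h3]; exists y | case=> h1 h2 h3; exists y].
apply: (dfn_ex hD (P := fun z : (((X + C') + D) + unit) + C -> V =>
   Q (z \o inl \o inl \o inl \o inl) (z (inl (inr tt)))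
     (z \o inl \o inl \o inl \o inr) (z \o inl \o inl \o inr) (z \o inr))).
apply: (dfn_and hD); first by apply: (dfn_lineq ho hD); linear_forms.
apply: (dfn_and hD).
  apply: (dfn_forall hD) => i; apply: (dfn_lineq ho hD); first by linear_forms.
  by apply: lin_add; [exact: (lin_var (inl (inl (inl (inr i))))) | linear_forms].
pose g (s : (X + C) + D) : (((X + C') + D) + unit) + C :=
  match s with inl (inl i) => inl (inl (inl (inl i))) | inl (inr i) => inr i
  | inr i => inl (inl (inr i)) end.
exact: (dfn_map hD g (coding_dfn (class_of_coding hR))).
Qed.

Lemma line_class_inv x s c' d d' : (forall j, dvdV N (d j - d' j)) ->
  line_class x s c' d -> line_class x s c' d'.
Proof.
move=> h [y [y1 y2 y3]]; exists y; split=> //.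
exact: (coding_inv (class_of_coding hR)) y3.
Qed.

Lemma line_class_fun x x' s c' d : line_class x s c' d -> line_class x' s c' d -> E x x'.
Proof.
move=> [y [y1 y2 y3]] [z [z1 z2 z3]]; rewrite (_ : z = y) in z3.
  by apply/y3/z3.
apply: funext => i; have [->|ii0] := eqVneq i i0; first by rewrite y1 z1.
apply/eqP; rewrite -subr_eq0; apply/eqP; apply: (torsion_free ho (k := w i0)) => //.
by rewrite mulrzBl (z2 (exist _ i ii0)) (y2 (exist _ i ii0)) subrr.
Qed.

Lemma line_class_E x x' s c' d : E x x' -> line_class x s c' d -> line_class x' s c' d.
Proof.
move=> e [y [y1 y2 y3]]; exists y; split=> // z; rewrite y3; split=> h.
  exact: E_trans (E_sym e) h.
exact: E_trans e h.
Qed.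

Lemma line_classP c d t : codes R (fun i => c i + t *~ w i) d ->
  line_class a (c i0 + t *~ w i0) (fun i : C' => c (val i) *~ w i0 - c i0 *~ w (val i)) d.
Proof. by move=> h; exists (fun i => c i + t *~ w i); split=> // i; zmod. Qed.

Definition line_match (s s' : V) (c' : C' -> V) (d : D -> V) : Prop :=
  exists x, line_class x s c' d /\ line_class x s' c' d.

Lemma dfn_line_match :
  Dfn (fun z : (C' + (unit + unit)) + D -> V =>
    line_match (z (inl (inr (inl tt)))) (z (inl (inr (inr tt)))) (z \o inl \o inl) (z \o inr)).
Proof.
apply: (dfn_ex hD (P := fun z : ((C' + (unit + unit)) + D) + X -> V =>
   line_class (z \o inr) (z (inl (inl (inr (inl tt))))) (z \o inl \o inl \o inl) (z \o inl \o inr) /\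
   line_class (z \o inr) (z (inl (inl (inr (inr tt))))) (z \o inl \o inl \o inl) (z \o inl \o inr))).
pose g (b : bool) (s : ((X + C') + D) + unit) : ((C' + (unit + unit)) + D) + X :=
  match s with inl (inl (inl i)) => inr i | inl (inl (inr i)) => inl (inl (inl i))
  | inl (inr i) => inl (inr i) | inr _ => inl (inl (inr (if b then inl tt else inr tt))) end.
exact: (dfn_and hD (dfn_map hD (g true) dfn_line_class) (dfn_map hD (g false) dfn_line_class)).
Qed.

Lemma line_match_inv s s' c' d d' : (forall j, dvdV N (d j - d' j)) ->
  line_match s s' c' d -> line_match s s' c' d'.
Proof. by move=> h [x [h1 h2]]; exists x; split; apply: line_class_inv h _. Qed.

Lemma line_matchP s s' c' d : line_match s s' c' d ->
  (line_class a s c' d <-> line_class a s' c' d).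
Proof.
move=> [x [h1 h2]]; split=> h.
  by apply: line_class_E h2; apply: E_sym; apply: line_class_fun h h1.
by apply: line_class_E h1; apply: E_sym; apply: line_class_fun h h2.
Qed.

Lemma within_lin2 (x y e : V) k l B : within x e -> within y e -> (0 < B)%N ->
  (`|k| <= B)%N -> (`|l| <= B)%N -> within (x *~ k + y *~ l) (e *+ (B * 2)).
Proof.
move=> hx hy B0 hk hl; rewrite mulnC mulrnA mulr2n mulrnDl.
by apply: (withinD ho); apply: (withinMz ho).
Qed.

Section Interval.
Context (c : C -> V) (d : D -> V).
Local Notation c' := (fun i : C' => c (val i) *~ w i0 - c i0 *~ w (val i)).
Context (ls : seq {ffun C' + (unit + unit) -> int}) (ks : seq {ffun (C' + (unit + unit)) + D -> int}).
Context (N' N2 : nat).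
Hypotheses (N'0 : (0 < N')%N) (N2N' : (N2 %| N')%N).
Hypothesis qe2 : forall x x',
  (forall l, l \in ls -> sgn (dot l x) = sgn (dot l x')) ->
  (forall k, k \in ks -> dvdV N2 (dot k (vcat x d)) <-> dvdV N2 (dot k (vcat x' d))) ->
  (line_match (x (inr (inl tt))) (x (inr (inr tt))) (x \o inl) d <->
   line_match (x' (inr (inl tt))) (x' (inr (inr tt))) (x' \o inl) d).

Local Notation pt z := (c i0 + z *+ N').
Local Notation l1 l := (l (inr (inl tt))).
Local Notation l2 l := (l (inr (inr tt))).

Definition wall_const (l : C' + (unit + unit) -> int) : V := dot (l \o inl) c'.
Definition diag (l : C' + (unit + unit) -> int) (s : V) : V := s *~ (l1 l + l2 l) + wall_const l.

Context (zs z0 z1 : V) (e : V).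
Hypothesis hz01 : pos (pt z1 - pt z0).
Hypothesis hm : line_match (pt z0) (pt z1) c' d.
Hypothesis hs0 : forall l, l \in ls -> l1 l + l2 l != 0 -> diag l (pt zs) <> 0.
Hypothesis hnear : forall l, l \in ls -> diag l (pt zs) <> 0 ->
  forall z z', z \in [:: z0; z1] -> z' \in [:: z0; z1] ->
  sgn (wall_const l + pt z *~ l1 l + pt z' *~ l2 l) = sgn (diag l (pt zs)).

Definition interval (s : V) : Prop :=
  forall l, l \in ls -> sgn (diag l s) = sgn (diag l (pt zs)).

Lemma match_sgn s s' z z' : dvdV N2 (s - pt z) -> dvdV N2 (s' - pt z') ->
  z \in [:: z0; z1] -> z' \in [:: z0; z1] -> sgn (s - s') = sgn (pt z - pt z') ->
  (forall l, l \in ls -> diag l (pt zs) <> 0 ->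
     sgn (wall_const l + s *~ l1 l + s' *~ l2 l) = sgn (diag l (pt zs))) ->
  line_match (pt z) (pt z') c' d -> line_match s s' c' d.
Proof.
move=> hs hs' hz hz' hord hl hzz.
pose x (r r' : V) : C' + (unit + unit) -> V := vcat c' (vcat (fun=> r) (fun=> r')).
have dotx (l : C' + (unit + unit) -> int) r r' :
    dot l (x r r') = wall_const l + r *~ l1 l + r' *~ l2 l.
  by rewrite /x !dot_vcat !dot_unit addrA.
apply: (iffRL (qe2 (x := x s s') (x' := x (pt z) (pt z')) _ _) hzz) => [l lls|k kks]; last first.
  apply: dvdV_eqr; rewrite !(dot_vcat k) opprD addrACA subrr addr0 !dotx.
  rewrite (_ : _ - _ = (s - pt z) *~ l1 (k \o inl) + (s' - pt z') *~ l2 (k \o inl)); last by zmod.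
  by apply: dvdVD; apply: dvdVMz.
rewrite !dotx; have [l0|l0] := pselect (diag l (pt zs) = 0); last first.
  by rewrite hl // hnear.
have ll : l2 l = - l1 l.
  apply/eqP; rewrite -addr_eq0 addrC; apply: contraT => h.
  by case: (hs0 lls h).
have u0 : wall_const l = 0 by move: l0; rewrite /diag ll subrr mulr0z add0r.
rewrite u0 !add0r ll !mulrNz -!mulrzBl !sgnMz //.
by rewrite hord.
Qed.

Lemma interval_locally_constant k u s1 s2 : interval s1 -> interval s2 ->
  sgn (s1 *~ k + u) <> sgn (s2 *~ k + u) ->
  exists e, pos e /\ forall x y,
    within (pt x *~ k + u) e -> within (pt y *~ k + u) e ->
    (line_class a (pt x) c' d <-> line_class a (pt y) c' d).
Proof.
move=> h1 h2 hne.
have k0 : k != 0 by apply/eqP => k0; apply: hne; rewrite k0 !mulr0z.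
have sk0 : sgz k != 0 by rewrite sgz_eq0.
pose W (l : C' + (unit + unit) -> int) := wall_const l *~ k - u *~ (l1 l + l2 l).
have sgnW l : l \in ls -> sgn (W l) = sgn (diag l (pt zs)) * sgz k.
  move=> lls; have [ll|ll] := eqVneq (l1 l + l2 l) 0.
    by rewrite /W /diag ll !mulr0z subr0 add0r sgnMz.
  have E' s : diag l s *~ k - W l = (s *~ k + u) *~ (l1 l + l2 l) by rewrite /W /diag; zmod.
  have hb : between (diag l s1 *~ k) (W l) (diag l s2 *~ k).
    apply: (between0 ho); rewrite !E' !(sgnMz ho) => /(mulIf _) h; apply: hne; apply: h.
    by rewrite sgz_eq0.
  have := sgn_between ho (k := 1) (u := 0) hb; rewrite !mulr1z !addr0 !(sgnMz ho) => ->.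
    by rewrite h1.
  by rewrite h1 // h2.
pose B := (\max_(l <- ls) maxn `|l1 l| `|l2 l|).+1.
have lB (l : {ffun C' + (unit + unit) -> int}) : l \in ls -> (`|l1 l| <= B)%N /\ (`|l2 l| <= B)%N.
  move=> lls; have : (maxn `|l1 l| `|l2 l| <= B)%N.
    apply: leqW.
    exact: (@leq_bigmax_seq _ _ xpredT (fun l : {ffun C' + (unit + unit) -> int} => maxn `|l1 l| `|l2 l|)).
  by rewrite geq_max => /andP.
have B2 : (0 < B * 2)%N by [].
have [e1 [he1 hs]] := small_ex ho [seq W l | l : {ffun C' + (unit + unit) -> int} <- ls] B2.
exists e1; split=> // x y hx hy.
have hv x' y' : within (pt x' *~ k + u) e1 -> within (pt y' *~ k + u) e1 ->
    forall l, l \in ls -> diag l (pt zs) <> 0 ->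
    sgn (wall_const l + pt x' *~ l1 l + pt y' *~ l2 l) = sgn (diag l (pt zs)).
  move=> hx' hy' l lls l0; apply: (mulIf sk0); rewrite -sgnW // -(sgnMz ho).
  rewrite (_ : _ *~ k = W l + ((pt x' *~ k + u) *~ l1 l + (pt y' *~ k + u) *~ l2 l));
    last by rewrite /W; zmod.
  have [b1 b2] := lB l lls.
  apply: hs; [exact: (map_f (fun l : {ffun C' + (unit + unit) -> int} => W l)) | | exact: within_lin2].
  move/(sgn_eq0 ho); rewrite sgnW // => /eqP; rewrite mulf_eq0 (negPf sk0) orbF => /eqP/(sgn_eq0 ho).
  exact: l0.
have dv z z' : dvdV N2 (pt z - pt z').
  by apply: (dvdV_trans N2N'); exists (z - z'); zmod.
have main x' y' : pos (pt y' - pt x') -> within (pt x' *~ k + u) e1 -> within (pt y' *~ k + u) e1 ->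
    line_match (pt x') (pt y') c' d.
  move=> hp hx' hy'; apply: (@match_sgn _ _ z0 z1) => //; rewrite ?inE ?eqxx ?orbT //.
    rewrite -(opprB (pt y')) -(opprB (pt z1)) !(sgnN ho).
    by have /(sgn_pos ho)-> := hp; have /(sgn_pos ho)-> := hz01.
  exact: hv.
case: (sgnP ho (pt x - pt y)) => [h|/eqP|]; last first.
- by rewrite opprB => h; apply: line_matchP; apply: main.
- by rewrite subr_eq0 => /eqP->.
- by apply: iff_sym; apply: line_matchP; apply: main.
Qed.
End Interval.

(* Along an interval whose end points lie in the span of [c'], the class does not change. *)
Lemma line_elimination c d N1 e : (0 < N1)%N -> pos e ->
  (forall t, within (t *+ N1) e -> codes R (fun i => c i + t *+ N1 *~ w i) d) ->
  exists (N' : nat) (R' : (X -> V) -> (C' -> V) -> (D + unit -> V) -> Prop) c' d',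
    coding N' R' /\ codes R' c' d'.
Proof.
move=> N10 he hc; have N0 := coding_gt0 hR; pose q := w i0.
pose c' : C' -> V := fun i => c (val i) *~ q - c i0 *~ w (val i).
have [ls [ks [N2 [N20 _ qe2]]]] := dfn_qe_res ho hD dfn_line_match N0
  (fun x => @line_match_inv _ _ _).
pose g (s : ((X + C') + D) + unit) : ((X + C') + unit) + D :=
  match s with inl (inl i) => inl (inl i) | inl (inr i) => inr i | inr i => inl (inr i) end.
have [ls3 [ks3 [N3 [N30 _ qe3]]]] := dfn_qe_res ho hD (dfn_map hD g dfn_line_class) N0
  (fun x => @line_class_inv (x \o inl \o inl) (x (inr tt)) (x \o inl \o inr)).
pose N' := (N1 * N2 * N3 * `|q|)%N.
have N'0 : (0 < N')%N by rewrite !muln_gt0 N10 N20 N30 absz_gt0.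
have N2N' : (N2 %| N')%N by rewrite /N' -mulnA dvdn_mulr // dvdn_mull.
have N3N' : (N3 %| N')%N by rewrite /N' dvdn_mulr // dvdn_mull.
pose pt z := c i0 + z *+ N'.
have hT z : within (z *+ N') e -> line_class a (pt z) c' d.
  pose t0 := z *+ (N2 * N3) *~ sgz q.
  have E' : z *+ N' = t0 *+ N1 *~ q.
    rewrite /t0 /N' pmulrn !PoszM (_ : (`|q|%N : int) = sgz q * q); last by case: sgzP; lia.
    rewrite (pmulrn z) PoszM; zmod.
  rewrite /pt E' => hw; apply: line_classP; apply: hc.
  exact: within_div hw.
have hgap0 : pos (c i0 + e - c i0) by rewrite addrC addKr.
have [zs [s1 s2 havoid]] := coset_avoid ho (c i0)
  [seq (l (inr (inl tt)) + l (inr (inr tt)), wall_const c l) | l : {ffun C' + (unit + unit) ->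
    int} <- ls] N'0 hgap0.
rewrite -/(pt zs) in s1 s2 havoid.
have hs0 (l : {ffun C' + (unit + unit) -> int}) : l \in ls ->
    l (inr (inl tt)) + l (inr (inr tt)) != 0 -> diag c l (pt zs) <> 0.
  move=> lls ll; apply: (havoid (l (inr (inl tt)) + l (inr (inr tt)), wall_const c l)) => //.
  exact: (map_f (fun l : {ffun C' + (unit + unit) -> int} =>
    (l (inr (inl tt)) + l (inr (inr tt)), wall_const c l))).
pose B := (\max_(l <- ls) maxn `|l (inr (inl tt))| `|l (inr (inr tt))|).+1.
have lB (l : {ffun C' + (unit + unit) -> int}) : l \in ls ->
    (`|l (inr (inl tt))| <= B)%N /\ (`|l (inr (inr tt))| <= B)%N.
  move=> lls; have : (maxn `|l (inr (inl tt))| `|l (inr (inr tt))| <= B)%N.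
    apply: leqW.
    exact: (@leq_bigmax_seq _ _ xpredT
      (fun l : {ffun C' + (unit + unit) -> int} => maxn `|l (inr (inl tt))| `|l (inr (inr tt))|)).
  by rewrite geq_max => /andP.
have [e1 [he1 hsm]] := small_ex ho [seq diag c l (pt zs) | l : {ffun C' + (unit + unit) -> int} <- ls]
  (isT : (0 < B * 2)%N).
have [e2 [he2 he12 he2']] := pos_min ho he1 s2.
have hgap : pos (pt zs + e2 - pt zs) by rewrite addrC addKr.
have [z0 [z01 z02]] := coset_dense ho (c i0) N'0 hgap.
have [z1 [z11 z12]] := coset_dense ho (c i0) N'0 z02.
rewrite -/(pt z0) -/(pt z1) in z01 z02 z11 z12.
have zs1 : pos (pt z1 - pt zs).
  by rewrite (_ : _ - _ = (pt z1 - pt z0) + (pt z0 - pt zs)); [apply: (posD ho) | zmod].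
have wz z : pos (pt z - pt zs) -> pos (pt zs + e2 - pt z) ->
    within (pt z - pt zs) e1 /\ line_class a (pt z) c' d.
  move=> p1 p2; split.
    split; last exact: (posD ho).
    by rewrite (_ : _ - _ = (pt zs + e2 - pt z) + (e1 - e2)); [apply: (posD ho) | zmod].
  apply: hT; split.
    rewrite (_ : _ - _ = (pt zs + e2 - pt z) + (c i0 + e - pt zs - e2)); first exact: (posD ho).
    by rewrite /pt; zmod.
  rewrite (_ : _ + _ = e + ((pt z - pt zs) + (pt zs - c i0))); last by rewrite /pt; zmod.
  by apply: (posD ho) => //; apply: (posD ho).
have [w0' L0] := wz z0 z01 z02; have [w1' L1] := wz z1 zs1 z12.
have hm : line_match (pt z0) (pt z1) c' d by exists a.
have hnear (l : {ffun C' + (unit + unit) -> int}) : l \in ls -> diag c l (pt zs) <> 0 ->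
    forall z z', z \in [:: z0; z1] -> z' \in [:: z0; z1] ->
    sgn (wall_const c l + pt z *~ l (inr (inl tt)) + pt z' *~ l (inr (inr tt))) = sgn (diag c l (pt zs)).
  move=> lls l0 z z' hz hz'.
  have hw r : r \in [:: z0; z1] -> within (pt r - pt zs) e1.
    by rewrite !inE => /orP[/eqP->|/eqP->].
  rewrite (_ : _ + _ = diag c l (pt zs) + ((pt z - pt zs) *~ l (inr (inl tt)) + (pt z' - pt zs) *~ l
    (inr (inr tt)))); last first.
    by rewrite /diag; zmod.
  have [b1 b2] := lB l lls.
  apply: hsm => //; last by apply: within_lin2 => //; apply: hw.
  exact: (map_f (fun l : {ffun C' + (unit + unit) -> int} => diag c l (pt zs))).
have qe2' x x' : (forall l, l \in ls -> sgn (dot l x) = sgn (dot l x')) ->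
    (forall k, k \in ks -> dvdV N2 (dot k (vcat x d)) <-> dvdV N2 (dot k (vcat x' d))) ->
    (line_match (x (inr (inl tt))) (x (inr (inr tt))) (x \o inl) d <->
     line_match (x' (inr (inl tt))) (x' (inr (inr tt))) (x' \o inl) d).
  exact: qe2.
pose I := interval c ls N' zs.
have Izs : I (pt zs) by [].
have hconst z : I (pt z) -> line_class a (pt z) c' d.
  move=> hz; pose P s := line_class a s c' d.
  have hTs : P (pt zs).
    apply: hT; split; last first.
      by rewrite (_ : _ + _ = e + (pt zs - c i0)); [apply: (posD ho) | rewrite /pt; zmod].
    by rewrite (_ : _ - _ = c i0 + e - pt zs) // /pt; zmod.
  apply: (iffLR _ hTs).
  apply: (@wall_path _ _ ho N' (c i0) I P
    [seq (l (inr tt), dot (l \o inl) (vcat a c')) | l : {ffun (X + C') + unit -> int} <- ls3]) => //.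
  - move=> x y z' hx hz' hb l lls; rewrite /diag -(hx l lls).
    by apply: (sgn_between ho hb); rewrite -/(diag c l _) -/(diag c l _) hx // hz'.
  - move=> [k u] /mapP[l3 l3ls [-> ->]] p1 p2 h1 h2 hne.
    have [e3 [he3 hh]] := interval_locally_constant N2N' qe2' z11 hm hs0 hnear h1 h2 hne.
    by exists e3; split=> // x y _ _; apply: hh.
  - move=> r r' _ _ hrr.
    pose x s := vcat (vcat a c') (fun _ : unit => s).
    apply: (qe3 (x (pt r)) d (x (pt r')) d) => [l lls|k kks].
      rewrite /x !(dot_vcat l) !dot_unit !(addrC (dot (l \o inl) _)).
      exact: (hrr (l (inr tt), dot (l \o inl) (vcat a c')) (map_f _ lls)).
    apply: dvdV_eqr; rewrite !(dot_vcat k) opprD addrACA subrr addr0 /x !(dot_vcat (k \o inl)).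
    rewrite opprD addrACA subrr add0r !dot_unit -mulrzBl; apply: dvdVMz.
    by apply: (dvdV_trans N3N'); exists (r - r'); rewrite /pt; zmod.
pose R' (x : X -> V) (c2 : C' -> V) (d2 : D + unit -> V) := exists s,
  dvdV N' (s - d2 (inr tt)) /\
  ((forall l, l \in ls -> sgn (s *~ (l (inr (inl tt)) + l (inr (inr tt))) + dot (l \o inl) c2)
      = sgn (diag c l (pt zs))) /\
   line_class x s c2 (d2 \o inl)).
exists (N * N')%N, R', c', (vcat d (fun=> c i0)); split.
  split; last first.
  - move=> x c2 d2 d2' hd [s [h1 [h2 h3]]]; exists s; split; last split=> //.
      rewrite (_ : _ - _ = (s - d2 (inr tt)) + (d2 (inr tt) - d2' (inr tt))); last by zmod.
      apply: dvdVD => //; apply: dvdV_trans (hd (inr tt)); exact: dvdn_mull.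
    apply: line_class_inv h3 => j; apply: dvdV_trans (hd (inl j)); exact: dvdn_mulr.
  - by rewrite muln_gt0 N0 N'0.
  apply: (dfn_ex1 hD (P := fun s (z : (X + C') + (D + unit) -> V) =>
    dvdV N' (s - z (inr (inr tt))) /\
    ((forall l, l \in ls -> sgn (s *~ (l (inr (inl tt)) + l (inr (inr tt))) + dot (l \o inl) (z \o
      inl \o inr))
      = sgn (diag c l (pt zs))) /\
     line_class (z \o inl \o inl) s (z \o inl \o inr) (z \o inr \o inl)))).
  apply: (dfn_and hD).
    by apply: (dfn_lindvd ho hD); apply: lin_add; [linear_forms | apply: lin_opp; exact:
      (lin_var (inl (inr (inr tt))))].
  apply: (dfn_and hD).
    apply: (dfn_seq hD) => l; apply: (dfn_linsgn ho hD); apply: lin_add; first by linear_forms.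
    exact: (lin_dot (fun i => inl (inl (inr i)))).
  pose g' (s : ((X + C') + D) + unit) : ((X + C') + (D + unit)) + unit :=
    match s with inl (inl i) => inl (inl i) | inl (inr i) => inl (inr (inl i)) | inr i => inr i end.
  exact: (dfn_map hD g' dfn_line_class).
move=> x; split=> [[s [[z hz] [h2 h3]]]|hx].
  have sE : s = pt z by rewrite /pt -hz /=; zmod.
  rewrite sE in h2 h3.
  exact: line_class_fun (hconst z h2) h3.
exists (pt zs); split; first by exists zs; rewrite /pt /=; zmod.
split; first by move=> l lls.
apply: line_class_E hx _; exact: hconst Izs.
Qed.
End Line_elimination.

(** * Residues *)

Section Residues.

Definition residue (n : nat) (x : V) : V := xget 0 [set y | dvdV n (x - y)].

Lemma residueP n x : dvdV n (x - residue n x).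
Proof. by apply: (@xgetPex _ 0 [set y | dvdV n (x - y)]); exists x; rewrite /= subrr; exact: dvdV0. Qed.

Lemma residue_eq n x y : residue n x = residue n y <-> dvdV n (x - y).
Proof.
split=> [h|h].
  have := dvdVB (residueP n x) (residueP n y).
  by rewrite h (_ : x - _ - _ = x - y) //; zmod.
rewrite /residue; congr (xget _ _); apply/seteqP; split=> z /= hz.
  by rewrite (_ : _ - _ = (x - z) - (x - y)); [apply: dvdVB | zmod].
by rewrite (_ : _ - _ = (y - z) + (x - y)); [apply: dvdVD | zmod].
Qed.

Definition finite_index (n : nat) : Prop :=
  exists rs : seq V, forall v, exists2 u, u \in rs & dvdV n (v - u).

Lemma finite_indexM m n : finite_index m -> finite_index n -> finite_index (m * n).
Proof.
move=> [rs hr] [ss hs]; exists [seq u + u' *+ m | u <- rs, u' <- ss] => v.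
have [u ur [w hw]] := hr v; have [u' us [w' hw']] := hs w.
exists (u + u' *+ m); first exact: allpairs_f.
exists w'; have -> : v = u + w *+ m by rewrite -hw; zmod.
have -> : w = u' + w' *+ n by rewrite -hw'; zmod.
by rewrite (pmulrn _ (m * n)) PoszM; zmod.
Qed.

Lemma finite_index_primes n : (0 < n)%N ->
  (forall p, prime p -> (p %| n)%N -> finite_index p) -> finite_index n.
Proof.
elim/ltn_ind: n => n IH n0 h.
have [n1|n1] := leqP n 1.
  have -> : n = 1%N by lia.
  by exists [:: 0] => v; exists 0; rewrite ?inE //; exists v; rewrite subr0 mulr1n.
have pp := pdiv_prime n1; have pd := pdiv_dvd n; set p := pdiv n in pp pd.
have p1 := prime_gt1 pp.
rewrite -(divnK pd); apply: finite_indexM; last exact: h.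
apply: IH; first by rewrite ltn_Pdiv.
  by rewrite divn_gt0 ?prime_gt0 // dvdn_leq.
by move=> r pr rd; apply: h => //; apply: dvdn_trans rd (dvdn_div pd).
Qed.

Lemma prime_torsion (D : finType) (N M : nat) (z : D -> V) : (0 < M)%N ->
  (forall j, dvdV N (z j *+ M)) -> ~ (forall j, dvdV N (z j)) ->
  exists p M', [/\ prime p, (p %| M)%N, forall j, dvdV N (z j *+ M' *+ p) &
    ~ (forall j, dvdV N (z j *+ M'))].
Proof.
elim/ltn_ind: M => M IH M0 h hz.
have [M1|M1] := leqP M 1.
  by case: hz => j; have := h j; have -> : M = 1%N by lia.
have pp := pdiv_prime M1; have pd := pdiv_dvd M; set p := pdiv M in pp pd.
have [h'|h'] := pselect (forall j, dvdV N (z j *+ (M %/ p))); last first.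
  by exists p, (M %/ p)%N; split=> // j; rewrite -mulrnA divnK.
have M'0 : (0 < M %/ p)%N by rewrite divn_gt0 ?prime_gt0 // dvdn_leq.
have [|r [M' [h1 h2 h3 h4]]] := IH _ _ M'0 h' hz; first by rewrite ltn_Pdiv ?prime_gt1.
by exists r, M'; split=> //; apply: dvdn_trans h2 (dvdn_div pd).
Qed.

(* The cardinality of the subgroup of [V / N] generated by the residues of [d]. *)
Definition span_size (D : finType) (N : nat) (d : D -> V) : nat :=
  size (undup [seq residue N (dot (fun j => (k j : nat)%:Z) d) | k : {ffun D -> 'I_N}]).

Definition in_span (D : finType) (N : nat) (d : D -> V) (v : V) : Prop :=
  exists k : D -> int, dvdV N (v - dot k d).

Lemma dvdV_lift (n m : nat) (x : V) : (0 < n)%N -> dvdV (n * m) (x *+ n) -> dvdV m x.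
Proof.
move=> n0 [z hz]; exists z; apply/eqP; rewrite -subr_eq0; apply/eqP.
by apply: (torsion_freen ho (n := n)) => //; rewrite mulrnBl hz -mulrnA mulnC subrr.
Qed.

Lemma reduce_form (D : finType) N (k : D -> int) : (0 < N)%N ->
  exists k' : {ffun D -> 'I_N}, (forall j, (N %| k j - (k' j : nat)%:Z)%Z) /\
  forall d : D -> V, dvdV N (dot k d - dot (fun j => (k' j : nat)%:Z) d).
Proof.
move=> N0.
have hk j : exists r : 'I_N, (N %| k j - (r : nat)%:Z)%Z.
  have rN : (`|(k j %% N)%Z| < N)%N.
    by have := ltz_pmod (k j) (_ : 0 < N%:Z); lia.
  exists (Ordinal rN) => /=.
  have -> : (`|(k j %% N)%Z|%N : int) = (k j %% N)%Z by lia.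
  by rewrite {1}(divz_eq (k j) N) addrK dvdz_mull.
have [k' hk'] := choice hk.
have hf j : (N %| k j - ([ffun j => k' j] j : nat)%:Z)%Z by rewrite ffunE.
exists [ffun j => k' j]; split=> // d.
rewrite /dot -sumrB; apply: dvdV_sum => j.
by rewrite -mulrzBr; apply: dvdV_dvdz.
Qed.

Lemma mem_span (D : finType) N (d : D -> V) v : (0 < N)%N ->
  residue N v \in [seq residue N (dot (fun j => (k j : nat)%:Z) d) | k : {ffun D -> 'I_N}] <->
  in_span N d v.
Proof.
move=> N0; split=> [/mapP[k _ /residue_eq h]|[k h]]; first by exists (fun j => (k j : nat)%:Z).
have [k' [_ hk']] := reduce_form k N0.
apply/mapP; exists k'; first by rewrite mem_enum.
apply/residue_eq; rewrite (_ : _ - _ = (v - dot k d) + (dot k d - dot (fun j => (k' j : nat)%:Z) d)).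
  exact: dvdVD.
zmod.
Qed.

Lemma span_size_lt (D : finType) N (d d' : D -> V) v : (0 < N)%N ->
  (forall u, in_span N d u -> in_span N d' u) -> in_span N d' v -> ~ in_span N d v ->
  (span_size N d < span_size N d')%N.
Proof.
move=> N0 hs hv hnv; rewrite /span_size.
set L := [seq _ | _ : _]; set L' := [seq _ | _ : _].
have -> : (size (undup L)).+1 = size (residue N v :: undup L) by [].
apply: uniq_leq_size => [|x] /=.
  by rewrite undup_uniq andbT mem_undup; apply/negP => /(mem_span _ _ N0).
rewrite inE !mem_undup => /orP[/eqP->|/mapP[k _ ->]]; first exact/(mem_span _ _ N0).
by apply/(mem_span _ _ N0)/hs; exists (fun j => (k j : nat)%:Z); rewrite subrr; exact: dvdV0.
Qed.

Definition same_relations (D : finType) N (d d' : D -> V) : Prop :=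
  forall k : {ffun D -> 'I_N},
    dvdV N (dot (fun j => (k j : nat)%:Z) d) <-> dvdV N (dot (fun j => (k j : nat)%:Z) d').

Lemma same_relations_int (D : finType) N (d d' : D -> V) : (0 < N)%N -> same_relations N d d' ->
  forall k : D -> int, dvdV N (dot k d) <-> dvdV N (dot k d').
Proof.
move=> N0 h k; have [k' [_ hk']] := reduce_form k N0.
by rewrite (dvdV_eqr (hk' d)) (dvdV_eqr (hk' d')).
Qed.

Lemma span_size_eq (D : finType) N (d d' : D -> V) : (0 < N)%N -> same_relations N d d' ->
  span_size N d = span_size N d'.
Proof.
move=> N0 /(same_relations_int N0) h; rewrite /span_size /image_mem.
elim: (enum _) => //= k s IH.
have E1 (e : D -> V) : (residue N (dot (fun j => (k j : nat)%:Z) e) \in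
    [seq residue N (dot (fun j => (k0 j : nat)%:Z) e) | k0 : {ffun D -> 'I_N} <- s]) =
    `[<exists2 k0 : {ffun D -> 'I_N}, k0 \in s & dvdV N (dot (fun j => (k j : nat)%:Z - (k0 j :
      nat)%:Z) e)>].
  apply/mapP/asboolP => -[k0 ks hk]; exists k0 => //; move: hk; rewrite residue_eq;
    rewrite (_ : dot (fun j => (k j : nat)%:Z - (k0 j : nat)%:Z) e = dot (fun j => (k j :
      nat)%:Z) e - dot (fun j => (k0 j : nat)%:Z) e) //;
    by rewrite /dot -sumrB; apply: eq_bigr => j _; zmod.
rewrite !E1 (_ : `[<_>] = `[<exists2 k0 : {ffun D -> 'I_N}, k0 \in s & dvdV N (dot (fun j => (k j :
  nat)%:Z - (k0 j : nat)%:Z) d')>]).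
  by case: ifP => _ //=; rewrite IH.
by apply/asboolP/asboolP => -[k0 ks /h hk]; exists k0.
Qed.
End Residues.

Lemma infinite_index_sequence p (bs : seq V) : ~ finite_index p ->
  exists t : nat -> V, (forall n u, u \in bs -> ~ dvdV p (t n - u)) /\
    forall m n, m <> n -> ~ dvdV p (t m - t n).
Proof.
move=> hp.
have /choice[next hnext] (rs : seq V) : exists v, forall u, u \in rs -> ~ dvdV p (v - u).
  apply: contrapT => h; apply: hp; exists rs => v; apply: contrapT => hv; apply: h.
  by exists v => u us hu; apply: hv; exists u.
pose L := fix L n := match n with 0 => bs | n'.+1 => next (L n') :: L n' end.
have Lbs n u : u \in bs -> u \in L n by elim: n => //= n IH /IH h; rewrite inE h orbT.
have Llt m n : (m < n)%N -> next (L m) \in L n.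
  elim: n => //= n IH; rewrite ltnS leq_eqVlt => /orP[/eqP->|/IH h]; rewrite inE ?eqxx //.
  by rewrite h orbT.
exists (fun n => next (L n)); split=> [n u /(Lbs n)|m n]; first exact: hnext.
have H m' n' : (m' < n')%N -> ~ dvdV p (next (L n') - next (L m')).
  by move=> h; apply: hnext; apply: Llt.
move=> mn; have [h|h|//] := ltngtP m n; last exact: H.
by move/dvdVC; apply: H.
Qed.

Section Shear.
Context (C D : finType) (N : nat) (R : (X -> V) -> (C -> V) -> (D -> V) -> Prop).
Hypothesis hR : coding N R.

Definition with_relations (d0 : D -> V) x c d : Prop := R x c d /\ same_relations N d d0.

Lemma with_relations_coding d0 : coding N (with_relations d0).
Proof.
case: hR => dR N0 inv; split=> //.
  apply: (dfn_and hD dR); apply: (dfn_forall hD) => k.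
  by apply: (dfn_iff hD); [apply: (dfn_lindvd ho hD); exact: lin_dot | exact: (dfn_const hD)].
move=> x c d d' h [h1 h2]; split=> [|k]; first exact: inv h1.
rewrite -h2; apply: dvdV_eqr.
rewrite /dot -sumrB; apply: dvdV_sum => j; rewrite -mulrzBl; apply: dvdVMz.
by apply/dvdVC.
Qed.

Context (i : D) (p : nat) (z : D -> int) (Q : nat).

Definition shear (d : D -> V) (j : D) : V := if j == i then d i *+ p else d j - d i *~ z j.

(* The class that is common to [Q] points of the line of direction [z] that are pairwise distinct
   modulo [N]; the line itself is determined by the sheared residues [d]. *)
Definition sheared (x : X -> V) (c : C -> V) (d : D -> V) : Prop :=
  exists ds : 'I_Q * D -> V,
    (forall lj : 'I_Q * D, dvdV N (shear (fun j => ds (lj.1, j)) lj.2 - d lj.2)) /\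
    ((forall ll : 'I_Q * 'I_Q, ll.1 <> ll.2 -> ~ dvdV N (ds (ll.1, i) - ds (ll.2, i))) /\
    (forall l, class_of R x c (fun j => ds (l, j)))).

Lemma sheared_coding : coding N sheared.
Proof.
have [dR' N0 _] := class_of_coding hR; split=> //.
  apply: (dfn_ex hD (P := fun y : ((X + C) + D) + ('I_Q * D) -> V =>
    (forall lj : 'I_Q * D, dvdV N (shear (fun j => y (inr (lj.1, j))) lj.2 - y (inl (inr lj.2)))) /\
    ((forall ll : 'I_Q * 'I_Q, ll.1 <> ll.2 -> ~ dvdV N (y (inr (ll.1, i)) - y (inr (ll.2, i)))) /\
    (forall l, class_of R (y \o inl \o inl \o inl) (y \o inl \o inl \o inr) (fun j => y (inr (l, j))))))).
  apply: (dfn_and hD); last apply: (dfn_and hD).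
  - apply: (dfn_forall hD) => -[l j]; apply: (dfn_lindvd ho hD); rewrite /shear.
    by case: (j == i); linear_forms.
  - apply: (dfn_forall hD) => -[l l']; apply: (dfn_imp hD); first exact: (dfn_const hD).
    by apply: (dfn_not hD); apply: (dfn_lindvd ho hD); linear_forms.
  - apply: (dfn_forall hD) => l.
    pose g (s : (X + C) + D) : ((X + C) + D) + ('I_Q * D) :=
      match s with inl s => inl (inl s) | inr j => inr (l, j) end.
    exact: (dfn_map hD g dR').
move=> x c d d' h [ds [h1 [h2 h3]]]; exists ds; split; last by split.
move=> lj; rewrite (_ : _ - _ = (shear (fun j => ds (lj.1, j)) lj.2 - d lj.2) + (d lj.2 - d' lj.2)).
  exact: dvdVD.
zmod.
Qed.
End Shear.

Lemma shear_span (D : finType) N (d : D -> V) i p (z : D -> int) : (0 < N)%N -> prime p ->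
  (p %| z i - 1)%Z ->
  (forall k : D -> int, dvdV N (dot k d) -> (p %| \sum_j k j * z j)%Z) ->
  (span_size N (shear i p z d) < span_size N d)%N.
Proof.
move=> N0 pp zi hrel.
pose W v := exists k : D -> int, v = dot k d /\ (p %| \sum_j k j * z j)%Z.
have W0 : W 0.
  exists (fun=> 0); split; first by rewrite /dot big1 // => j _; rewrite mulr0z.
  by rewrite big1 ?dvdz0 // => j _; rewrite mul0r.
have WD u v : W u -> W v -> W (u + v).
  move=> [k [-> hk]] [l [-> hl]]; exists (fun j => k j + l j); split.
    by rewrite /dot -big_split; apply: eq_bigr => j _; rewrite mulrzDr.
  by rewrite (eq_bigr (fun j => k j * z j + l j * z j)) ?big_split ?rpredD // => j _; rewrite mulrDl.
have WM u (m : int) : W u -> W (u *~ m).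
  move=> [k [-> hk]]; exists (fun j => k j * m); split.
    by rewrite /dot mulrz_suml; apply: eq_bigr => j _; rewrite mulrzA.
  rewrite (eq_bigr (fun j => m * (k j * z j))) -?mulr_sumr ?dvdz_mull // => j _.
  by rewrite mulrAC mulrC mulrA.
pose e (l j : D) : int := (j == l)%:R.
have dote l : dot (e l) d = d l.
  by rewrite /dot (bigD1 l) //= /e eqxx mulr1z big1 ?addr0 // => j /negPf->; rewrite mulr0z.
have sume l : \sum_j e l j * z j = z l.
  by rewrite (bigD1 l) //= /e eqxx mul1r big1 ?addr0 // => j /negPf->; rewrite mul0r.
have hW j : W (shear i p z d j).
  rewrite /shear; case: eqP => _.
    exists (fun j => e i j * p); split; first by rewrite -{1}(dote i) /dot pmulrn mulrz_suml; apply: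
      eq_bigr => l _; rewrite mulrzA.
    rewrite (eq_bigr (fun l => p%:Z * (e i l * z l))) -?mulr_sumr ?dvdz_mulr // => l _.
    by rewrite mulrAC mulrC.
  exists (fun l => e j l - e i l * z j); split.
    rewrite -{1}(dote j) -{1}(dote i) /dot mulrz_suml -sumrB; apply: eq_bigr => l _; zmod.
  rewrite (eq_bigr (fun l => e j l * z l - z j * (e i l * z l))).
    rewrite sumrB -mulr_sumr !sume (_ : _ - _ = - (z j * (z i - 1))); last by ring.
    by rewrite rpredN dvdz_mull.
  by move=> l _; ring.
have hWdot (k : D -> int) : W (dot k (shear i p z d)).
  by rewrite /dot; apply: (big_ind W) => // j _; apply: WM.
apply: (@span_size_lt _ _ _ _ (d i)) => //.
- move=> u [k hk]; have [l [hl _]] := hWdot k; exists l.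
  by rewrite -hl.
- by exists (e i); rewrite dote subrr; exact: dvdV0.
move=> [k hk]; have [l [hl pl]] := hWdot k.
have : dvdV N (dot (fun j => e i j - l j) d).
  rewrite (_ : dot _ d = d i - dot k (shear i p z d)) // hl -{1}(dote i) /dot -sumrB.
  by apply: eq_bigr => j _; zmod.
move/hrel; rewrite (eq_bigr (fun j => e i j * z j - l j * z j)); last by move=> j _; ring.
rewrite sumrB sume => h.
have : (p %| 1)%Z.
  rewrite (_ : 1%Z = (z i - \sum_j l j * z j) + \sum_j l j * z j - (z i - 1)); last by ring.
  by apply: rpredB => //; apply: rpredD.
by rewrite dvdzE /= dvdn1 => /eqP p1; move: pp; rewrite p1.
Qed.

Lemma prime_cofactor p (N1 : nat) (m : int) (t : V) : prime p -> (0 < N1)%N ->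
  (((N1`_p^')%N)%:Z %| m)%Z -> ~~ (N1%:Z %| m)%Z -> dvdV N1 (t *~ m) -> dvdV p t.
Proof.
move=> pp N10 hF hm ht; pose P := (N1`_p)%N.
have NP : N1 = (P * N1`_p^')%N by rewrite partnC.
have cop : coprime P N1`_p^' by rewrite coprime_partC.
have [g hg hmg] := dvdV_cofactor (torsion_free ho) (dvdV_trans (dvdn_part p N1) ht).
have [pg|pg] := boolP (p %| g)%N; first exact: dvdV_trans hg.
case/negP: hm; have hP : (P%:Z %| m)%Z.
  move: hmg; rewrite !dvdzE abszM /= Gauss_dvdl //.
  by rewrite coprime_sym /P p_part coprimeXr // coprime_sym prime_coprime.
by rewrite NP dvdzE /= Gauss_dvd //; apply/andP; split; [move: hP | move: hF]; rewrite dvdzE.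
Qed.

(* The points [d + t M z] with [M = N / p] have the same sheared residues as [d]. Every form of [ks]
   excludes at most one class of [t] modulo [p], so infinitely many of them code the class of [a],
   and among [size ks + 1] incongruent ones there is always one that does. *)
Lemma residue_shift (C D : finType) N N1 f (R : (X -> V) -> (C -> V) -> (D -> V) -> Prop)
    (c : C -> V) (d : D -> V) (ks : seq {ffun (X + C) + D -> int}) p (z : D -> int) i :
  coding N R -> codes R c d -> prime p -> (p %| N)%N -> ~ finite_index p ->
  (0 < N1)%N -> N1 = (N * f)%N -> (p %| z i - 1)%Z ->
  (forall j, ((N1`_p^')%N%:Z %| z j)%Z) ->
  (forall k, k \in ks -> dvdV N1 (dot k (vcat (vcat a c) d)) ->
     ((p * f)%N%:Z %| \sum_j k (inr j) * z j)%Z) ->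
  (forall d', (forall k, k \in ks -> dvdV N1 (dot k (vcat (vcat a c) d)) <->
     dvdV N1 (dot k (vcat (vcat a c) d'))) -> codes R c d') ->
  codes (sheared N R i p z (size ks).+1) c (shear i p z d).
Proof.
move=> hR hcd pp pN pinf N10 N1E zi zF hpos hqe; have N0 := coding_gt0 hR.
pose M := (N %/ p)%N; have NM : N = (M * p)%N by rewrite divnK.
have M0 : (0 < M)%N by rewrite divn_gt0 ?prime_gt0 // dvdn_leq.
pose sh t j := d j + t *+ M *~ z j.
pose bad (k : {ffun (X + C) + D -> int}) t :=
  ~ dvdV N1 (dot k (vcat (vcat a c) d)) /\ dvdV N1 (dot k (vcat (vcat a c) (sh t))).
have dotsh (k : {ffun (X + C) + D -> int}) t : dot k (vcat (vcat a c) (sh t)) =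
    dot k (vcat (vcat a c) d) + t *~ (M%:Z * \sum_j k (inr j) * z j).
  rewrite !(dot_vcat k) /sh dotDr dotZr addrA; congr (_ + _).
  by rewrite mulrzA -pmulrn.
have bad1 k t t' : bad k t -> bad k t' -> dvdV p (t - t').
  move=> [h1 h2] [_ h3]; have := dvdVB h2 h3.
  rewrite !dotsh opprD addrACA subrr add0r -mulrzBl; set m := _ * _ => h.
  apply: (@prime_cofactor p N1 m) => //.
    apply: dvdz_mull; apply: (big_ind (fun s => (_ %| s)%Z)) => [||j _]; first exact: dvdz0.
      by move=> *; apply: rpredD.
    exact: dvdz_mull.
  apply/negP => hm; apply: h1; move: h2; rewrite dotsh => h2.
  by apply/(dvdV_eqr _)/h2; rewrite opprD addNKr; apply/dvdVN/dvdV_dvdz.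
have good t : (forall k, k \in ks -> ~ bad k t) -> codes R c (sh t).
  move=> h; apply: hqe => k kks; split=> h'.
    rewrite dotsh; apply: dvdVD => //; apply: dvdV_dvdz.
    have /dvdzP[q ->] := hpos k kks h'; apply/dvdzP; exists q.
    by rewrite N1E NM !PoszM; ring.
  by apply: contrapT => h2; apply: (h k kks); split.
have shE t j : dvdV N (shear i p z (sh t) j - shear i p z d j).
  rewrite /shear; case: eqP => _.
    by rewrite /sh; exists (t *~ z i); rewrite NM (pmulrn _ (M * p)) PoszM; zmod.
  have /dvdzP[q hq] := zi.
  rewrite (_ : _ - _ = t *+ M *~ (- (z i - 1) * z j)); last by rewrite /sh; zmod.
  by rewrite hq; exists (t *~ (- q * z j)); rewrite NM (pmulrn _ (M * p)) PoszM; zmod.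
move=> x; split=> [[ds [h1 [h2 h3]]]|hx].
  have /choice[t ht] (l : 'I_(size ks).+1) : exists u, ds (l, i) - d i = u *+ M.
    have [u hu] := h1 (l, i); move: hu; rewrite /shear eqxx => hu; exists u.
    apply/eqP; rewrite -subr_eq0; apply/eqP; apply: (torsion_freen ho (n := p)); last exact: prime_gt0.
    by rewrite !mulrnBl hu NM -mulrnA subrr.
  have dsh l j : dvdV N (ds (l, j) - sh (t l) j).
    have [ji|ji] := eqVneq j i.
      rewrite ji (_ : _ - _ = t l *+ M *~ (- (z i - 1))); last first.
        by rewrite (_ : ds (l, i) = d i + t l *+ M) /sh; [zmod | rewrite -ht; zmod].
      have /dvdzP[q ->] := zi; exists (t l *~ (- q)); rewrite NM (pmulrn _ (M * p)) PoszM; zmod.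
    have := h1 (l, j); rewrite /shear /= (negPf ji).
    rewrite (_ : _ - _ = ds (l, j) - sh (t l) j) //.
    by rewrite /sh -ht; zmod.
  have tp l l' : l <> l' -> ~ dvdV p (t l - t l').
    move=> ll [u hu]; apply: (h2 (l, l')) => //=; exists u.
    rewrite (_ : _ - _ = (ds (l, i) - d i) - (ds (l', i) - d i)); last by zmod.
    by rewrite !ht -mulrnBl hu NM (mulnC M) mulrnA.
  have [l hl] : exists l, forall k, k \in ks -> ~ bad k (t l).
    apply: contrapT => hn.
    have /choice[b hb] (l : 'I_(size ks).+1) : exists s : 'I_(size ks), bad (nth [ffun=> 0] ks s) (t l).
      apply: contrapT => hs; apply: hn; exists l => k kks hk; apply: hs.
      have kl : (index k ks < size ks)%N by rewrite index_mem.
      by exists (Ordinal kl); rewrite /= nth_index.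
    have binj : injective b.
      move=> l l' hll; apply: contrapT => ll; apply: (tp l l' ll).
      by apply: bad1 (hb l) _; rewrite hll; exact: hb.
    by have := leq_card b binj; rewrite !card_ord ltnn.
  have hRl : forall y, R y c (fun j => ds (l, j)) <-> E a y.
    move=> y; rewrite -(good _ hl y); split; apply: (coding_inv hR) => // j.
    by apply/dvdVC; exact: dsh.
  by apply/hRl/h3.
have /choice[b hb] (k : {ffun (X + C) + D -> int}) : exists u, forall t, bad k t -> dvdV p (t - u).
  have [[u hu]|h] := pselect (exists u, bad k u); first by exists u => t ht; apply: bad1 ht hu.
  by exists 0 => t ht; case: h; exists t.
have [t [t1 t2]] := infinite_index_sequence [seq b k | k <- ks] pinf.
have hgood n : codes R c (sh (t n)).
  apply: good => k kks hk; apply: (t1 n (b k)); first exact: map_f.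
  exact: hb.
exists (fun lj : 'I_(size ks).+1 * D => sh (t (lj.1 : nat)) lj.2); split; first by move=> lj; exact: shE.
split=> [[l l'] /= ll|l y]; last first.
  by rewrite (hgood l y); split=> h; [exact: E_trans (E_sym hx) h | exact: E_trans hx h].
rewrite (_ : _ - _ = (t l - t l') *+ M *~ z i); last by rewrite /sh; zmod.
move=> h; apply: (t2 l l'); first by move/val_inj.
have /dvdzP[q hq] := zi.
have h' : dvdV N ((t l - t l') *+ M).
  rewrite (_ : _ *+ M = (t l - t l') *+ M *~ z i - (t l - t l') *+ M *~ (z i - 1)); last by zmod.
  apply: dvdVB => //; rewrite hq; exists ((t l - t l') *~ q).
  by rewrite NM (pmulrn _ (M * p)) PoszM; zmod.
by apply: (dvdV_lift M0); rewrite -NM.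
Qed.

Lemma inverse_mod_prime p (m : int) : prime p -> ~~ (p %| m)%Z -> exists v, (p %| m * v - 1)%Z.
Proof.
move=> pp pm; have [u [v uv]] := Bezoutz m p; exists u.
have g1 : gcdz m p = 1.
  apply/eqP; rewrite -[_ == _]/(coprimez m p) coprimezE coprime_sym prime_coprime //.
rewrite g1 in uv; rewrite (_ : _ - _ = - v * p%:Z) ?dvdz_mull //.
by rewrite -uv; ring.
Qed.

Lemma residue_step (C D : finType) N (R : (X -> V) -> (C -> V) -> (D -> V) -> Prop) c0 d0 :
  coding N R -> codes R c0 d0 -> finite_set [set c | exists d, codes R c d] ->
  ~ finite_set [set (fun j => residue N (d j)) |
      d in [set d | exists c, codes (with_relations N R d0) c d]] ->
  exists (R' : (X -> V) -> (C -> V) -> (D -> V) -> Prop) c d',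
    [/\ coding N R', codes R' c d' & (span_size N d' < span_size N d0)%N].
Proof.
move=> hR hcd0 fin inf; have N0 := coding_gt0 hR.
set R2 := with_relations N R d0 in inf; have hR2 : coding N R2 by apply: with_relations_coding.
have rel c d : codes R2 c d -> same_relations N d d0 by move=> h; have [] := iffRL (h a) (E_refl a).
have codes2 c d : codes R2 c d -> codes R c d.
  move=> h x; rewrite -h; split=> [hx|[]//]; split=> //; exact: rel h.
have [dR' _ inv'] := class_of_coding hR2.
have [ls [ks [N1 [N10 NN1 qe]]]] := dfn_qe_res ho hD dR' N0 (fun x => inv' (x \o inl) (x \o inr)).
pose pi : nat_pred := [pred q | `[<finite_index q>]].
pose Nf := (N`_pi)%N; pose M := (N`_pi^')%N; have NE : N = (Nf * M)%N by rewrite partnC.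
have [rs hrs] : finite_index Nf.
  apply: finite_index_primes => [|q qp qN]; first exact: part_gt0.
  by have /pnatP/(_ q qp qN)/asboolP := part_pnat pi N; apply; rewrite part_gt0.
have /choice[ridx hridx] v : exists r : 'I_(size rs), dvdV Nf (v - nth 0 rs r).
  have [u urs hu] := hrs v; have ur : (index u rs < size rs)%N by rewrite index_mem.
  by exists (Ordinal ur); rewrite /= nth_index.
pose S := [set cd : (C -> V) * (D -> V) | codes R2 cd.1 cd.2].
pose key (cd : (C -> V) * (D -> V)) : (C -> V) * ({ffun 'I_(size ks) -> bool} * {ffun D -> 'I_(size rs)}) :=
  (cd.1, ([ffun i : 'I_(size ks) => `[<dvdV N1 (dot (nth [ffun=> 0] ks i) (vcat (vcat a cd.1) cd.2))>]],
   [ffun j => ridx (cd.2 j)])).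
pose g (cd : (C -> V) * (D -> V)) := fun j => residue N (cd.2 j).
have [[[c d1] [[c' d2] [h1 h2 hkey hne]]]|hn] :=
    pselect (exists cd cd', [/\ S cd, S cd', key cd = key cd' & g cd <> g cd']); last first.
  case: inf; apply: sub_finite_set (finite_key (key := key) (g := g) (S := S) _ _).
  - by move=> r [d [c h] <-]; exists (c, d).
  - apply: (@sub_finite_set _ _ ([set c | exists d, codes R c d] `*` setT)).
      move=> k [[c d] h <-]; split=> //; exists d; exact: codes2.
    by apply: finite_setX => //; exact: finite_finset.
  - by move=> x y Sx Sy e; apply: contrapT => ne; apply: hn; exists x, y.
case: hkey => /= ecc /ffunP ktrue /ffunP kres; subst c'; move: h1 h2 hne; rewrite /S /g /= => h1 h2 hne.
have hks k : k \in ks -> dvdV N1 (dot k (vcat (vcat a c) d1)) -> dvdV N1 (dot k (vcat (vcat a c) d2)).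
  move=> kks; have il : (index k ks < size ks)%N by rewrite index_mem.
  by have := ktrue (Ordinal il); rewrite !ffunE /= nth_index // => e; have [e1 _] := asbool_eq_equiv e.
pose z j := d1 j - d2 j.
have zNf j : dvdV Nf (z j).
  have := kres j; rewrite !ffunE => e.
  have := dvdVB (hridx (d1 j)) (hridx (d2 j)); rewrite e.
  by rewrite (_ : d1 j - _ - _ = z j) // /z; zmod.
have zN : ~ forall j, dvdV N (z j).
  by move=> h; apply: hne; apply: funext => j; apply/residue_eq; exact: h.
have [||p [M' [pp pM hz1 hz2]]] := @prime_torsion D N M z _ _ zN; first exact: part_gt0.
  by move=> j; have [u ->] := zNf j; exists u; rewrite -mulrnA -NE.
have pinf : ~ finite_index p.
  have /pnatP := part_pnat pi^' N; rewrite part_gt0 => /(_ isT p pp pM).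
  by rewrite !inE => /asboolP.
have pN : (p %| N)%N by rewrite NE dvdn_mull.
have p0 := prime_gt0 pp.
have M0 : (0 < N %/ p)%N by rewrite divn_gt0 // dvdn_leq.
have /choice[u hu] j : exists u, z j *+ M' = u *+ (N %/ p).
  by apply: (@dvdV_lift p) => //; rewrite mulnC divnK.
have uN : ~ forall j, dvdV p (u j).
  move=> h; apply: hz2 => j; rewrite hu; have [v ->] := h j; exists v.
  by rewrite -mulrnA mulnC divnK.
pose f := (N1 %/ N)%N; have N1E : N1 = (N * f)%N by rewrite mulnC divnK.
have f0 : (0 < f)%N by move: N10; rewrite N1E muln_gt0 => /andP[].
pose K1 := [seq [ffun j => k (inr j)] | k : {ffun (X + C) + D -> int} <- ks &
   `[<dvdV N1 (dot k (vcat (vcat a c) d1))>]].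
pose K2 := [seq [ffun j => (k j : nat)%:Z * f%:Z] | k : {ffun D -> 'I_N} <-
   enum {ffun D -> 'I_N} & `[<dvdV N (dot (fun j => (k j : nat)%:Z) d1)>]].
have dotz (k : D -> int) : dot k z = dot k d1 - dot k d2.
  by rewrite /dot -sumrB; apply: eq_bigr => j _; rewrite mulrzBl.
have hK k : k \in K1 ++ K2 -> dvdV N1 (dot k z).
  rewrite mem_cat => /orP[/mapP[l]|/mapP[l]]; rewrite mem_filter => /andP[/asboolP hl lks] ->.
    have := dvdVB hl (hks l lks hl); rewrite !(dot_vcat l) opprD addrACA subrr add0r -dotz.
    by rewrite (_ : dot [ffun j => l (inr j)] z = dot (l \o inr) z) //; apply: eq_bigr => j _;
      rewrite ffunE.
  rewrite (_ : dot _ z = dot (fun j => (l j : nat)%:Z) z *~ f); last first.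
    by rewrite /dot mulrz_suml; apply: eq_bigr => j _; rewrite ffunE mulrzA.
  have [v ->] : dvdV N (dot (fun j => (l j : nat)%:Z) z).
    by rewrite dotz; apply: dvdVB => //; apply/(rel _ _ h2)/(rel _ _ h1).
  by exists v; rewrite N1E -pmulrn -mulrnA.
have hKu k : k \in K1 ++ K2 -> dvdV (p * f) (dot k u).
  move=> /hK hk; apply: (dvdV_lift M0); rewrite mulnA divnK // -N1E -dotMnr.
  rewrite (_ : (fun _ => _) = fun j => z j *+ M'); last by apply: funext => j.
  by rewrite dotMnr; apply: dvdVMn.
have [z0 [hz0 [i zi0]]] := int_solution (torsion_free ho) hKu uN.
pose F := (N1`_p^')%N.
have [|v hv] := @inverse_mod_prime p (z0 i * F%:Z) pp.
  rewrite dvdzE abszM Euclid_dvdM // negb_or; apply/andP; split; first by move: zi0; rewrite dvdzE.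
  by rewrite /= -prime_coprime // (@pnat_coprime p) ?pnat_id ?part_pnat.
pose z1 j := z0 j * (F%:Z * v).
have hz1' (n : nat) (k : D -> int) : (n %| \sum_j k j * z0 j)%Z -> (n %| \sum_j k j * z1 j)%Z.
  move=> h; rewrite (eq_bigr (fun j => F%:Z * v * (k j * z0 j))) -?mulr_sumr ?dvdz_mull //.
  by move=> j _; rewrite /z1; ring.
have zi1 : (p %| z1 i - 1)%Z by rewrite /z1 mulrA.
exists (sheared N R2 i p z1 (size ks).+1), c, (shear i p z1 d1).
have hc1 : codes R2 c d1 by [].
split; first exact: sheared_coding.
  apply: (residue_shift (f := f) (ks := ks) (N1 := N1)) => //.
  - by move=> j; rewrite /z1 dvdz_mull // dvdz_mulr.
  - move=> k kks hk; apply: hz1'.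
    have := hz0 [ffun j => k (inr j)]; rewrite (eq_bigr (fun j => k (inr j) * z0 j)); last first.
      by move=> j _; rewrite ffunE.
    apply; rewrite mem_cat; apply/orP; left.
    by apply/mapP; exists k => //; rewrite mem_filter kks andbT; apply/asboolP.
  - move=> d' hd'; have : class_of R2 a c d1 by [].
    suff : class_of R2 a c d1 <-> class_of R2 a c d' by case.
    exact: (qe (vcat a c) d1 (vcat a c) d').
rewrite -(span_size_eq N0 (rel _ _ h1)); apply: shear_span => // k hk.
have [k' [hk' hkd]] := reduce_form k N0.
have pk' : (p %| \sum_j (k' j : nat)%:Z * z1 j)%Z.
  apply: hz1'; have := hz0 [ffun j => (k' j : nat)%:Z * f%:Z].
  rewrite (eq_bigr (fun j => f%:Z * ((k' j : nat)%:Z * z0 j))); last first.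
    by move=> j _; rewrite ffunE; ring.
  rewrite -mulr_sumr mulnC PoszM dvdz_mul2l; last by rewrite eqz_nat -lt0n.
  apply.
  rewrite mem_cat; apply/orP; right; apply/mapP; exists k' => //.
  by rewrite mem_filter mem_enum andbT; apply/asboolP/(dvdV_eqr (hkd d1)).
rewrite (_ : \sum_j _ = \sum_j (k j - (k' j : nat)%:Z) * z1 j + \sum_j (k' j : nat)%:Z * z1 j).
  apply: rpredD => //; apply: (big_ind (fun s => (p %| s)%Z)) => [||j _]; first exact: dvdz0.
    by move=> *; apply: rpredD.
  by apply: dvdz_mulr; apply: dvdz_trans (hk' j); rewrite dvdzE.
by rewrite -big_split; apply: eq_bigr => j _; rewrite /= -mulrDl subrK.
Qed.

Lemma rank_step (C D : finType) N (R : (X -> V) -> (C -> V) -> (D -> V) -> Prop) :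
  coding N R -> ~ finite_set [set c | exists d, codes R c d] ->
  exists (C' D' : finType) N' (R' : (X -> V) -> (C' -> V) -> (D' -> V) -> Prop) c' d',
    [/\ coding N' R', codes R' c' d' & (#|C'| < #|C|)%N].
Proof.
move=> hR /(infinite_codes_shift hR)[c [d [w [i0 [N1 [e [w0 N10 he hc]]]]]]].
have [N' [R' [c' [d' [h1 h2]]]]] := line_elimination hR w0 N10 he hc.
exists {i : C | i != i0}, (D + unit)%type, N', R', c', d'; split=> //.
rewrite card_sig; apply: (@leq_ltn_trans #|predC1 i0|).
  by rewrite leq_eqVlt; apply/orP; left; apply/eqP/eq_card => i; rewrite !inE.
by rewrite cardC1 ltn_predL; apply/card_gt0P; exists i0.
Qed.

(* Minimize first the number of elements, then the group generated by the residues. *)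
Theorem finite_coding : exists (C D : finType) N (R : (X -> V) -> (C -> V) -> (D -> V) -> Prop) c d,
  [/\ coding N R, codes R c d, finite_set [set c | exists d, codes R c d] &
    finite_set [set (fun j => residue N (d j)) | d in [set d | exists c, codes R c d]]].
Proof.
pose P n := `[<exists (C D : finType) N (R : (X -> V) -> (C -> V) -> (D -> V) -> Prop) c d,
  [/\ coding N R, codes R c d & #|C| = n]>].
have exP : exists n, P n.
  exists #|X|; apply/asboolP; exists X, void, 1%N, (fun x c _ => E c x), a, (fun v : void =>
    match v with end).
  split=> //; split=> //.
  pose g (s : X + X) : (X + X) + void := match s with inl i => inl (inr i) | inr i => inl (inl i) end.
  exact: (dfn_map hD g dE).
pose n := ex_minn exP.
have [Pn nmin] : P n /\ forall m, P m -> (n <= m)%N by rewrite /n; case: ex_minnP.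
have fin (C D : finType) N (R : (X -> V) -> (C -> V) -> (D -> V) -> Prop) :
    coding N R -> #|C| = n -> finite_set [set c | exists d, codes R c d].
  move=> hR hn; apply: contrapT => /(rank_step hR)[C' [D' [N' [R' [c' [d' [h1 h2 h3]]]]]]].
  have : P #|C'| by apply/asboolP; exists C', D', N', R', c', d'.
  by move/nmin; rewrite leqNgt -hn h3.
pose Q m := `[<exists (C D : finType) N (R : (X -> V) -> (C -> V) -> (D -> V) -> Prop) c d,
  [/\ coding N R, codes R c d, #|C| = n & span_size N d = m]>].
have exQ : exists m, Q m.
  have /asboolP[C [D [N [R [c [d [h1 h2 h3]]]]]]] := Pn.
  by exists (span_size N d); apply/asboolP; exists C, D, N, R, c, d.
have [m /asboolP[C [D [N [R [c [d [hR hcd hn hm]]]]]]] mmin] := ex_minnP exQ.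
have hR2 := with_relations_coding hR d.
exists C, D, N, (with_relations N R d), c, d; split=> //; last 2 first.
- exact: fin hR2 hn.
- apply: contrapT => /(residue_step hR hcd (fin _ _ _ _ hR hn))[R' [c' [d' [h1 h2 h3]]]].
  have : Q (span_size N d') by apply/asboolP; exists C, D, N, R', c', d'.
  by move/mmin; rewrite leqNgt -hm h3.
- move=> x; rewrite -(hcd x); split=> [[]//|h]; split=> //; exact: (fun _ => iff_refl _).
Qed.
End Elimination.

Local Open Scope quotient_scope.

(** * Formulas in the language of quotients *)

Section Substitution.
Context {L : signature}.

Lemma var_cons_ind (S : Type) (s : S) G (P : forall t, var (s :: G) t -> Prop) :
  P s V0 -> (forall t (v : var G t), P t (VS v)) -> forall t v, P t v.
Proof.
move=> h0 hS t v.
exact: (match v in var H t return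
  (match H return var H t -> Prop with
   | [::] => fun _ => True
   | s' :: G' => fun v => forall P : (forall t, var (s' :: G') t -> Prop),
        P s' V0 -> (forall t (v : var G' t), P t (VS v)) -> P t v
   end v) with
  | V0 _ _ => fun P h _ => h
  | VS _ _ _ w => fun P _ h => h _ w
  end P h0 hS).
Qed.

Lemma var_nil_ind (S : Type) (P : forall t : S, var [::] t -> Prop) t v : P t v.
Proof.
exact: (match v in var H t return
  (match H return var H t -> Prop with
   | [::] => fun v => P t v
   | s' :: G' => fun _ => True
   end v) with
  | V0 _ _ => I
  | VS _ _ _ w => I
  end).
Qed.

Lemma env_eq (S : Type) (D : S -> Type) G (e e' : env D G) :
  (forall s v, e s v = e' s v) -> e = e'.
Proof. by move=> h; apply: functional_extensionality_dep => s; apply: funext => v. Qed.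

Lemma env_cons_eq (S : Type) (D : S -> Type) s G (e e' : env D (s :: G)) :
  e s V0 = e' s V0 -> (forall t (v : var G t), e t (VS v) = e' t (VS v)) -> e = e'.
Proof. by move=> h0 hS; apply: env_eq; apply: var_cons_ind. Qed.

Lemma env_nil_eq (S : Type) (D : S -> Type) (e e' : env D [::]) : e = e'.
Proof. by apply: env_eq; exact: var_nil_ind. Qed.

Fixpoint tsubst G H s (t : term L G s) (f : env (term L H) G) : term L H s :=
  match t with
  | Var _ v => f _ v
  | App g args => App g (fun s v => tsubst (args s v) f)
  end.

Definition lift_subst G H s (f : env (term L H) G) : env (term L (s :: H)) (s :: G) :=
  econs (Var V0) (fun t v => tsubst (f t v) (fun r w => Var (VS w))).

Fixpoint fsubst G (phi : formula L G) : forall H, env (term L H) G -> formula L H :=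
  match phi in formula _ G return forall H, env (term L H) G -> formula L H with
  | FEq _ _ t u => fun H f => FEq (tsubst t f) (tsubst u f)
  | FPred _ r args => fun H f => FPred r (fun s v => tsubst (args s v) f)
  | FBot _ => fun H _ => FBot H
  | FImp _ phi psi => fun H f => FImp (fsubst phi f) (fsubst psi f)
  | FAll _ s phi => fun H f => FAll (fsubst phi (lift_subst f))
  end.

Lemma eval_subst (N : structure L) G H s (t : term L G s) (f : env (term L H) G) (e : env N H) :
  eval e (tsubst t f) = eval (fun s v => eval e (f s v)) t.
Proof.
elim: t => //= g args IH; congr finterp; apply: env_eq => s' v; exact: IH.
Qed.

Lemma sat_subst (N : structure L) G (phi : formula L G) H (f : env (term L H) G) (e : env N H) :
  sat (fsubst phi f) e <-> sat phi (fun s v => eval e (f s v)).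
Proof.
elim: phi H f e => {G} /=.
- by move=> G s t u H f e; rewrite !eval_subst.
- move=> G r args H f e.
  by rewrite (_ : (fun s v => eval e _) = (fun s v => eval (fun s v => eval e (f s v)) (args s v))) //;
    apply: env_eq => s v; exact: eval_subst.
- by [].
- by move=> G phi IH psi IH' H f e; rewrite IH IH'.
- move=> G s phi IH H f e; split=> h x; have := h x; rewrite IH;
    by rewrite (_ : (fun _ _ => _) = econs x (fun s v => eval e (f s v))) //;
      apply: env_cons_eq => //= t v; rewrite eval_subst.
Qed.

Fixpoint vleft (S : Type) (G H : seq S) (s : S) (v : var G s) : var (G ++ H) s :=
  match v in var G s return var (G ++ H) s with
  | V0 _ _ => V0
  | VS _ _ _ w => VS (vleft H w)
  end.

Fixpoint vright (S : Type) (G H : seq S) (s : S) (v : var H s) : var (G ++ H) s :=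
  match G return var (G ++ H) s with
  | [::] => v
  | _ :: G' => VS (vright G' v)
  end.

Lemma ecat_left (D : Defs.sort L -> Type) G H (a : env D G) (b : env D H) s (v : var G s) :
  ecat a b (vleft H v) = a s v.
Proof. by elim: v a => [t G' a|t r G' w IH a] //=; rewrite IH. Qed.

Lemma ecat_right (D : Defs.sort L -> Type) G H (a : env D G) (b : env D H) s (v : var H s) :
  ecat a b (vright G v) = b s v.
Proof. by elim: G a => //= t G IH a; rewrite IH. Qed.

Lemma ecat_map (D D' : Defs.sort L -> Type) (f : forall s, D s -> D' s) G H (a : env D G) (b : env D H) :
  (fun s v => f s (ecat a b v)) =
  ecat (fun s v => f s (a s v)) (fun s v => f s (b s v)) :> env D' (G ++ H).
Proof.
elim: G a => //= t G IH a.
by apply: env_cons_eq => //= r v; have /(congr1 (fun e => e r v)) := IH (fun t v => a t (VS v)).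
Qed.
End Substitution.

Section Map_env.
Context (S S' : Type) (g : S -> S').

Fixpoint menv (D : S' -> Type) G : (forall s, var G s -> D (g s)) -> env D (map g G) :=
  match G return (forall s, var G s -> D (g s)) -> env D (map g G) with
  | [::] => fun _ => enil
  | s :: G' => fun f => econs (f s V0) (menv (fun t v => f t (VS v)))
  end.

Lemma menvE (D : S' -> Type) G (f : forall s, var G s -> D (g s)) s (v : var G s) :
  menv f (vmap g v) = f s v.
Proof. by elim: v f => [t G' f|t r G' w IH f] //=; rewrite IH. Qed.
End Map_env.

Section Definable_families.
Context {L : signature} {J : Type} (N : J -> structure L).

Definition definable G (P : forall j, env (N j) G -> Prop) : Prop :=
  exists phi : formula L G, forall j e, sat phi e <-> P j e.

Lemma def_ext G (P Q : forall j, env (N j) G -> Prop) :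
  (forall j e, P j e <-> Q j e) -> definable P -> definable Q.
Proof. by move=> h [phi hp]; exists phi => j e; rewrite hp. Qed.

Lemma def_imp G (P Q : forall j, env (N j) G -> Prop) :
  definable P -> definable Q -> definable (fun j e => P j e -> Q j e).
Proof. by move=> [phi h] [psi h']; exists (FImp phi psi) => j e /=; rewrite h h'. Qed.

Lemma def_bot G : definable (fun j (e : env (N j) G) => False).
Proof. by exists (FBot G). Qed.

Lemma def_all G s (P : forall j, env (N j) (s :: G) -> Prop) : definable P ->
  definable (fun j e => forall x, P j (econs x e)).
Proof. by move=> [phi h]; exists (FAll phi) => j e /=; split=> H x; apply/h/H. Qed.

Lemma def_eq G s (t u : term L G s) : definable (fun j e => eval e t = eval e u).
Proof. by exists (FEq t u). Qed.

Lemma def_and G (P Q : forall j, env (N j) G -> Prop) :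
  definable P -> definable Q -> definable (fun j e => P j e /\ Q j e).
Proof.
move=> [phi h] [psi h']; exists (FImp (FImp phi (FImp psi (FBot G))) (FBot G)) => j e /=.
rewrite h h'; split=> [H|[p q] /(_ p q)//].
by split; apply: contrapT => n; apply: H => p q; apply: n.
Qed.

Lemma def_all_ctx G H (P : forall j, env (N j) (G ++ H) -> Prop) : definable P ->
  definable (fun j e => forall a : env (N j) G, P j (ecat a e)).
Proof.
elim: G H P => [|s G IH] H P /= hP.
  by apply: def_ext hP => j e; split=> // h; exact: (h enil).
have {}hP := def_all hP; have {}hP := IH _ _ hP; apply: def_ext hP => j e; split=> h a.
  by have := h (fun t v => a t (VS v)) (a s V0).
by move=> x; exact: (h (econs x a)).
Qed.

Lemma def_ex_ctx G H (P : forall j, env (N j) (G ++ H) -> Prop) : definable P ->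
  definable (fun j e => exists a : env (N j) G, P j (ecat a e)).
Proof.
move=> hP.
have h := def_imp (def_all_ctx (def_imp hP (def_bot _))) (def_bot _).
apply: def_ext h => j e; split=> [h|[a ha] /(_ a)//].
by apply: contrapT => n; apply: h => a ha; apply: n; exists a.
Qed.
End Definable_families.

Section Home_terms.
Implicit Type N : structure quo_sig.

Definition zero_term G : term quo_sig G Home := App (L := quo_sig) (Zero Home) enil.
Definition add_term G (t u : term quo_sig G Home) : term quo_sig G Home :=
  App (L := quo_sig) (Add Home) (econs t (econs u enil)).
Definition opp_term G (t : term quo_sig G Home) : term quo_sig G Home :=
  App (L := quo_sig) (Opp Home) (econs t enil).
Definition pi_term G s : term quo_sig G Home -> term quo_sig G s :=
  match s with
  | Home => id
  | Quo p k => fun t => App (L := quo_sig) (Pi p k) (econs t enil)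
  end.

Definition hzero N : N Home := finterp (f := Zero Home : func quo_sig) enil.
Definition hadd N (x y : N Home) : N Home :=
  finterp (f := Add Home : func quo_sig) (econs x (econs y enil)).
Definition hopp N (x : N Home) : N Home :=
  finterp (f := Opp Home : func quo_sig) (econs x enil).
Definition hlt N (x y : N Home) : Prop :=
  pinterp (r := tt : pred_symb quo_sig) (econs x (econs y enil)).
Definition hpi N s : N Home -> N s :=
  match s return N Home -> N s with
  | Home => id
  | Quo p k => fun x => finterp (f := Pi p k : func quo_sig) (econs x enil)
  end.

Lemma eval_zero N G (e : env N G) : eval e (zero_term G) = hzero N.
Proof. by apply: (congr1 (@finterp quo_sig N (Zero Home))); exact: env_nil_eq. Qed.

Lemma eval_add N G (e : env N G) t u : eval e (add_term t u) = hadd (eval e t) (eval e u).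
Proof.
apply: (congr1 (@finterp quo_sig N (Add Home))).
by apply: env_cons_eq => //; apply: var_cons_ind => //; exact: var_nil_ind.
Qed.

Lemma eval_opp N G (e : env N G) t : eval e (opp_term t) = hopp (eval e t).
Proof.
apply: (congr1 (@finterp quo_sig N (Opp Home))).
by apply: env_cons_eq => //; exact: var_nil_ind.
Qed.

Lemma eval_pi N G (e : env N G) s t : eval e (pi_term s t) = hpi s (eval e t).
Proof.
case: s => //= p k; apply: (congr1 (@finterp quo_sig N (Pi p k))).
by apply: env_cons_eq => //; exact: var_nil_ind.
Qed.

(* Variables outside [I] are read as zero. *)
Definition henv N (I : Type) (x : I -> N Home) G (i : forall s, var G s -> option I) : env N G :=
  fun s v => hpi s (oapp x (hzero N) (i s v)).
End Home_terms.

Section Home_definability.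
Context {J : Type} (N : J -> structure quo_sig).

Definition hdef (I : Type) (P : forall j, (I -> N j Home) -> Prop) : Prop :=
  exists G (phi : formula quo_sig G) (i : forall s, var G s -> option I),
  forall j (x : I -> N j Home), sat phi (henv x i) <-> P j x.

Definition hterm (I : Type) (F : forall j, (I -> N j Home) -> N j Home) : Prop :=
  exists G (t : term quo_sig G Home) (i : forall s, var G s -> option I),
  forall j (x : I -> N j Home), eval (henv x i) t = F j x.

Definition icat (I : Type) G H (i : forall s, var G s -> option I)
    (k : forall s, var H s -> option I) : forall s, var (G ++ H) s -> option I :=
  @ecat _ (fun _ : quo_sort => option I) G H i k.

Lemma henv_cat (I : Type) G H (i : forall s, var G s -> option I) (k : forall s, var H s -> option I)
    j (x : I -> N j Home) : henv x (icat i k) = ecat (henv x i) (henv x k).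
Proof.
exact: (@ecat_map quo_sig (fun _ => option I) (N j) (fun s o => hpi s (oapp x (hzero (N j)) o))).
Qed.

Lemma hdef_ext (I : Type) (P Q : forall j, (I -> N j Home) -> Prop) :
  (forall j x, P j x <-> Q j x) -> hdef P -> hdef Q.
Proof. by move=> h [G [phi [i hp]]]; exists G, phi, i => j x; rewrite hp. Qed.

Lemma hdef_bot (I : Type) : hdef (fun j (x : I -> N j Home) => False).
Proof. by exists [::], (FBot [::] : formula quo_sig [::]), (fun _ _ => None). Qed.

Definition left_ren (G H : seq quo_sort) : env (term quo_sig (G ++ H)) G := fun s v =>
  @Var quo_sig (G ++ H) s (vleft H v).
Definition right_ren (G H : seq quo_sort) : env (term quo_sig (G ++ H)) H := fun s v =>
  @Var quo_sig (G ++ H) s (vright G v).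

Lemma hdef_imp (I : Type) (P Q : forall j, (I -> N j Home) -> Prop) :
  hdef P -> hdef Q -> hdef (fun j x => P j x -> Q j x).
Proof.
move=> [G [phi [i hp]]] [H [psi [k hq]]].
exists (G ++ H), (FImp (fsubst phi (@left_ren G H)) (fsubst psi (@right_ren G H))), (icat i k) => j x /=.
rewrite !sat_subst henv_cat -hp -hq.
rewrite (_ : (fun s v => _) = henv x i); last by apply: env_eq => s v; exact: (@ecat_left quo_sig).
rewrite (_ : (fun s v => _) = henv x k) //.
by apply: env_eq => s v; exact: (@ecat_right quo_sig).
Qed.

Lemma hdef_map (I I' : Type) (g : I -> I') (P : forall j, (I -> N j Home) -> Prop) :
  hdef P -> hdef (fun j (x : I' -> N j Home) => P j (x \o g)).
Proof.
move=> [G [phi [i hp]]]; exists G, phi, (fun s v => omap g (i s v)) => j x; rewrite -hp.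
rewrite (_ : henv x _ = henv (x \o g) i) //.
by apply: env_eq => s v; rewrite /henv; case: (i s v).
Qed.

Lemma hdef_formula G (I : Type) (phi : formula quo_sig G) (i : forall s, var G s -> option I) :
  hdef (fun j x => sat phi (henv x i)).
Proof. by exists G, phi, i. Qed.

Lemma hdef_all1 (I : Type) (P : forall j, N j Home -> (I -> N j Home) -> Prop) :
  hdef (fun j (x : option I -> N j Home) => P j (x None) (x \o Some)) ->
  hdef (fun j x => forall y, P j y x).
Proof.
move=> [G [phi [i hp]]].
pose f : env (term quo_sig (Home :: G)) G := fun s v =>
  if i s v is Some None then pi_term s (@Var quo_sig (Home :: G) Home V0) else @Var quo_sig (Home ::
    G) s (VS v).
exists G, (FAll (s := Home : Defs.sort quo_sig) (fsubst phi f)), (fun s v => obind id (i s v)) => j x /=.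
have E y : (sat (fsubst phi f) (econs y (henv x (fun s v => obind id (i s v))))) <-> P j y x.
  pose xy o := oapp x y o.
  have -> : P j y x = P j (xy None) (xy \o Some) by [].
  rewrite -hp sat_subst (_ : (fun s v => _) = henv xy i) //.
  by apply: env_eq => s v; rewrite /f /henv; case e: (i s v) => [[z|]|] /=; [rewrite e | exact:
    eval_pi | rewrite e].
by split=> h y; apply/E/h.
Qed.

Lemma hdef_not (I : Type) (P : forall j, (I -> N j Home) -> Prop) :
  hdef P -> hdef (fun j x => ~ P j x).
Proof. by move=> h; apply: hdef_imp h (hdef_bot I). Qed.

Lemma hdef_and (I : Type) (P Q : forall j, (I -> N j Home) -> Prop) :
  hdef P -> hdef Q -> hdef (fun j x => P j x /\ Q j x).
Proof.
move=> h h'; apply: (@hdef_ext _ (fun j x => ~ (P j x -> ~ Q j x))); last first.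
  by apply: hdef_not; apply: hdef_imp h (hdef_not h').
move=> j x; split=> [hx|[p q] /(_ p)//].
by split; apply: contrapT => n; apply: hx => p // q; apply: n.
Qed.

Lemma hdef_iff (I : Type) (P Q : forall j, (I -> N j Home) -> Prop) :
  hdef P -> hdef Q -> hdef (fun j x => P j x <-> Q j x).
Proof. by move=> h h'; apply: hdef_and; apply: hdef_imp. Qed.

Lemma hdef_true (I : Type) : hdef (fun j (x : I -> N j Home) => True).
Proof. by apply: hdef_ext (hdef_imp (hdef_bot I) (hdef_bot I)). Qed.

Lemma hdef_ex1 (I : Type) (P : forall j, N j Home -> (I -> N j Home) -> Prop) :
  hdef (fun j (x : option I -> N j Home) => P j (x None) (x \o Some)) ->
  hdef (fun j x => exists y, P j y x).
Proof.
move=> h; apply: (@hdef_ext _ (fun j x => ~ forall y, ~ P j y x)); last first.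
  exact: hdef_not (hdef_all1 (P := fun j y x => ~ P j y x) (hdef_not h)).
move=> j x; split=> [hx|[y hy] /(_ y)//].
by apply: contrapT => n; apply: hx => y hy; apply: n; exists y.
Qed.

Lemma hdef_all_ord (n : nat) (I : Type) (P : forall j, (I + 'I_n -> N j Home) -> Prop) :
  hdef P -> hdef (fun j x => forall y, P j (vcat x y)).
Proof.
elim: n I P => [|n IH] I P h.
  pose g (s : I + 'I_0) : I := match s with inl i => i | inr (Ordinal m h) =>
    match Bool.diff_false_true h with end end.
  apply: hdef_ext (hdef_map g h) => j x.
  have e y : x \o g = vcat x y by apply: funext => -[i|[]].
  by split=> [hx y|hx]; [rewrite -e | rewrite (e (fun=> hzero _)); apply: hx].
pose g (s : I + 'I_n.+1) : option I + 'I_n := match s with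
  | inl i => inl (Some i)
  | inr o => if unlift ord0 o is Some o' then inr o' else inl None
  end.
pose P' j (x0 : N j Home) (x : I -> N j Home) := forall y : 'I_n -> N j Home,
  P j (vcat x (fun o => if unlift ord0 o is Some o' then y o' else x0)).
apply: (@hdef_ext _ (fun j x => forall x0, P' j x0 x)).
  move=> j x; rewrite /P'; split=> [hx y|hx x0 y]; last exact: hx.
  have := hx (y ord0) (y \o lift ord0); congr (P j (vcat x _)).
  by apply: funext => o; case: unliftP => [o' ->|->].
apply: hdef_all1; apply: hdef_ext (IH _ _ (hdef_map g h)) => j x.
have e y : vcat x y \o g =
   vcat (x \o Some) (fun o => if unlift ord0 o is Some o' then y o' else x None).
  by apply: funext => -[i|o] //=; case: (unlift ord0 o).
by split=> hx y; have := hx y; rewrite e.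
Qed.

Lemma hdef_all (I : Type) (K : finType) (P : forall j, (I + K -> N j Home) -> Prop) :
  hdef P -> hdef (fun j x => forall y, P j (vcat x y)).
Proof.
pose g (s : I + K) : I + 'I_#|K| := match s with inl i => inl i | inr k => inr (enum_rank k) end.
move=> h; apply: hdef_ext (hdef_all_ord (hdef_map g h)) => j x.
have e y : vcat x y \o g = vcat x (y \o enum_rank) by apply: funext => -[].
split=> hx y; last by rewrite e; exact: hx.
rewrite (_ : y = (y \o enum_val) \o enum_rank) -?e //.
by apply: funext => k /=; rewrite enum_rankK.
Qed.

Lemma hterm_var (I : Type) (i : I) : hterm (fun j x => x i).
Proof. by exists [:: Home], (@Var quo_sig [:: Home] Home V0), (fun _ _ => Some i). Qed.

Lemma hterm_zero (I : Type) : hterm (fun j (x : I -> N j Home) => hzero (N j)).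
Proof. by exists [::], (zero_term _), (fun _ _ => None) => j x; exact: eval_zero. Qed.

Lemma hterm_opp (I : Type) (F : forall j, (I -> N j Home) -> N j Home) :
  hterm F -> hterm (fun j x => hopp (F j x)).
Proof. by move=> [G [t [i h]]]; exists G, (opp_term t), i => j x; rewrite eval_opp h. Qed.

Lemma hterm_join (I : Type) (F F' : forall j, (I -> N j Home) -> N j Home) :
  hterm F -> hterm F' -> exists G (t t' : term quo_sig G Home) i,
  forall j (x : I -> N j Home), eval (henv x i) t = F j x /\ eval (henv x i) t' = F' j x.
Proof.
move=> [G [t [i h]]] [H [u [k h']]].
exists (G ++ H), (tsubst t (@left_ren G H)), (tsubst u (@right_ren G H)), (icat i k) => j x.
rewrite -h -h' !eval_subst henv_cat.
split.
  by apply: (congr1 (fun e : env (N j) G => eval e t)); apply: env_eq => s v; exact: (@ecat_left quo_sig).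
by apply: (congr1 (fun e : env (N j) H => eval e u)); apply: env_eq => s v; exact: (@ecat_right quo_sig).
Qed.

Lemma hterm_add (I : Type) (F F' : forall j, (I -> N j Home) -> N j Home) :
  hterm F -> hterm F' -> hterm (fun j x => hadd (F j x) (F' j x)).
Proof.
move=> h h'; have [G [t [t' [i ht]]]] := hterm_join h h'.
by exists G, (add_term t t'), i => j x; rewrite eval_add; have [-> ->] := ht j x.
Qed.

Lemma hdef_eq (I : Type) (F F' : forall j, (I -> N j Home) -> N j Home) :
  hterm F -> hterm F' -> hdef (fun j x => F j x = F' j x).
Proof.
move=> h h'; have [G [t [t' [i ht]]]] := hterm_join h h'.
by exists G, (FEq t t'), i => j x /=; have [-> ->] := ht j x.
Qed.

Lemma hdef_lt (I : Type) (F F' : forall j, (I -> N j Home) -> N j Home) :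
  hterm F -> hterm F' -> hdef (fun j x => hlt (F j x) (F' j x)).
Proof.
move=> h h'; have [G [t [t' [i ht]]]] := hterm_join h h'.
exists G, (FPred (L := quo_sig) tt (econs t (econs t' enil))), i => j x.
have [<- <-] := ht j x; rewrite /= /hlt.
rewrite (_ : (fun s v => _) = econs (eval (henv x i) t) (econs (eval (henv x i) t') enil)) //.
by apply: env_cons_eq => //; apply: var_cons_ind => //; exact: var_nil_ind.
Qed.

Lemma hdef_seq (I : Type) (T : eqType) (s : seq T) (P : T -> forall j, (I -> N j Home) -> Prop) :
  (forall l, hdef (P l)) -> hdef (fun j x => forall l, l \in s -> P l j x).
Proof.
move=> h; elim: s => [|l s IH]; first by apply: hdef_ext (hdef_true I).
apply: hdef_ext (hdef_and (h l) IH) => j x; split=> [[h1 h2] k|hx].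
  by rewrite inE => /orP[/eqP->|/h2].
by split=> [|k sk]; apply: hx; rewrite inE ?eqxx ?sk ?orbT.
Qed.
End Home_definability.

Definition void_elim (T : Type) (v : void) : T := match v with end.

(* A home tuple quantified universally in front of a definable predicate gives a sentence. *)
Lemma hdef_transfer (J : Type) (N : J -> structure quo_sig) (j j' : J) (I : finType)
    (P : forall j, (I -> N j Home) -> Prop) :
  Th (N j) `<=` Th (N j') -> hdef P -> (forall x, P j x) -> forall x, P j' x.
Proof.
move=> hT /(hdef_map (@inr void I)) /hdef_all [G [phi [i hp]]] hj x.
pose psi : formula quo_sig [::] := fsubst phi (fun s _ => pi_term s (zero_term [::])).
have E k (y : void -> N k Home) : sat psi (enil : env (N k) [::]) <-> forall x, P k x.
  rewrite -(hp k y) /psi sat_subst.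
  set e := (fun s => _); rewrite (_ : e = henv y i) //.
  by apply: env_eq => s v; rewrite /e eval_pi eval_zero /henv; case: (i s v) => // -[].
apply: (iffLR (E j' (fun=> hzero _))); apply: (hT psi).
exact: (iffRL (E j (fun=> hzero _))).
Qed.

Section Words.
Context {I : finType}.

(* Integral linear forms, written so that they make sense before the group laws are known. *)
Definition word := seq (bool * I).

Definition word_neg (w : word) : word := [seq (~~ b.1, b.2) | b <- w].

Definition wval (N : structure quo_sig) (w : word) (x : I -> N Home) : N Home :=
  foldr (fun b acc => hadd (if b.1 then hopp (x b.2) else x b.2) acc) (hzero N) w.

Definition zval (V : zmodType) (w : word) (x : I -> V) : V :=
  foldr (fun b acc => (if b.1 then - x b.2 else x b.2) + acc) 0 w.

Lemma zval_cat (V : zmodType) w w' (x : I -> V) : zval (w ++ w') x = zval w x + zval w' x.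
Proof. by elim: w => [|b w IH] /=; rewrite ?add0r // IH addrA. Qed.

Lemma zval_neg (V : zmodType) w (x : I -> V) : zval (word_neg w) x = - zval w x.
Proof.
elim: w => [|[b i] w IH] /=; first by rewrite oppr0.
by rewrite IH opprD; case: b => //=; rewrite opprK.
Qed.

Lemma zval_dot (w : word) : exists k : {ffun I -> int}, forall (V : zmodType) (x : I -> V),
  zval w x = dot k x.
Proof.
elim: w => [|[b i] w [k IH]].
  by exists [ffun=> 0] => V x; rewrite /dot big1 // => i _; rewrite ffunE.
exists [ffun j => (if b then -1 else 1) * (j == i)%:R + k j] => V x /=.
rewrite IH /dot [RHS](eq_bigr (fun j => x j *~ ((if b then -1 else 1) * (j == i)%:R) + x j *~ k j)).
  rewrite big_split /=; congr (_ + _); rewrite (bigD1 i) //= eqxx mulr1 big1 ?addr0 => [|j /negPf->];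
    last by rewrite mulr0.
  by case: b; rewrite ?mulrN1z ?mulr1z.
by move=> j _; rewrite ffunE mulrzDr.
Qed.
End Words.

Section Hom_family.
Context {J : Type} (N : J -> structure quo_sig) (I : finType).

Definition hpos (M : structure quo_sig) (x : M Home) : Prop := hlt (hzero M) x.
Definition hmuln (M : structure quo_sig) (n : nat) (x : M Home) : M Home :=
  iter n (hadd x) (hzero M).
Definition hdvd (M : structure quo_sig) (n : nat) (x : M Home) : Prop := exists z, x = hmuln n z.

Lemma hterm_wval (w : @word I) : hterm (N := N) (fun j x => wval w x).
Proof.
elim: w => [|[b i] w IH] /=; first exact: hterm_zero.
apply: hterm_add => //; case: b => /=; last exact: hterm_var.
by apply: hterm_opp; exact: hterm_var.
Qed.

Lemma hterm_muln (K : Type) (F : forall j, (K -> N j Home) -> N j Home) n : hterm F ->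
  hterm (fun j x => hmuln n (F j x)).
Proof. by move=> h; elim: n => [|n IH]; [exact: hterm_zero | exact: hterm_add]. Qed.

Lemma hterm_map (K K' : Type) (g : K -> K') (F : forall j, (K -> N j Home) -> N j Home) : hterm F ->
  hterm (fun j x => F j (x \o g)).
Proof.
move=> [G [t [i h]]]; exists G, t, (fun s v => omap g (i s v)) => j x; rewrite -h.
apply: (congr1 (fun e : env (N j) G => eval e t)).
by apply: env_eq => s v; rewrite /henv; case: (i s v).
Qed.

Lemma hdef_pos (K : Type) (F : forall j, (K -> N j Home) -> N j Home) : hterm F ->
  hdef (fun j x => hpos (F j x)).
Proof. by move=> h; apply: hdef_lt => //; exact: hterm_zero. Qed.

Lemma hdef_dvd (K : Type) (F : forall j, (K -> N j Home) -> N j Home) n : hterm F ->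
  hdef (fun j x => hdvd n (F j x)).
Proof.
move=> h; apply: (hdef_ex1 (P := fun j z x => F j x = hmuln n z)).
by apply: hdef_eq; [exact: (hterm_map Some h) | apply: hterm_muln; exact: hterm_var].
Qed.

Definition word_agree (M : structure quo_sig) (s : seq (@word I * nat)) (x x' : I -> M Home) : Prop :=
  forall l, l \in s -> [/\ hpos (wval l.1 x) <-> hpos (wval l.1 x'),
    hpos (hopp (wval l.1 x)) <-> hpos (hopp (wval l.1 x')) &
    hdvd l.2 (wval l.1 x) <-> hdvd l.2 (wval l.1 x')].

Lemma hdef_word_agree s :
  hdef (N := N) (fun j (y : I + I -> N j Home) => word_agree s (y \o inl) (y \o inr)).
Proof.
apply: hdef_seq => l.
have h b := hterm_map (if b then @inl I I else @inr I I) (hterm_wval l.1).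
have h1 := hdef_iff (hdef_pos (h true)) (hdef_pos (h false)).
have h2 := hdef_iff (hdef_pos (hterm_opp (h true))) (hdef_pos (hterm_opp (h false))).
have h3 := hdef_iff (hdef_dvd l.2 (h true)) (hdef_dvd l.2 (h false)).
by apply: hdef_ext (hdef_and h1 (hdef_and h2 h3)) => j x; split=> [[? [? ?]]|[]].
Qed.
End Hom_family.

Section Quotients.
Variable M : porderZmodType.

Lemma quo_pi_eq m (x y : M) : quo_pi m x = quo_pi m y <-> exists z, x - y = z *+ m.
Proof.
have E := Quotient.idealrBE (multiples m) x y.
split=> [/eqP h|h]; first by apply/asboolP; move: E; rewrite [in X in _ = X](_ : _ == _ = true).
apply/eqP; rewrite -[_ == _]E; exact/asboolP.
Qed.

Lemma quo_piD m (x y : M) : quo_pi m (x + y) = quo_pi m x + quo_pi m y.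
Proof. exact: (Quotient.pi_add (multiples m)). Qed.

Lemma quo_piN m (x : M) : quo_pi m (- x) = - quo_pi m x.
Proof. exact: (Quotient.pi_opp (multiples m)). Qed.

Lemma quo_pi0 m : quo_pi m (0 : M) = 0.
Proof. by apply: (addrI (quo_pi m 0)); rewrite addr0 -quo_piD addr0. Qed.

Lemma quo_pi_repr m (y : quo M m) : quo_pi m (repr (y : Quotient.quot (multiples m))) = y.
Proof. exact: reprK. Qed.

Lemma quo_rho_pi m n (x : M) : (n %| m)%N -> quo_rho n (quo_pi m x) = quo_pi n x.
Proof.
move=> /dvdnP[q ->]; rewrite /quo_rho; apply/quo_pi_eq.
have /quo_pi_eq[z hz] := quo_pi_repr (quo_pi (q * n) x).
by exists (z *+ q); rewrite hz mulrnA.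
Qed.

Local Notation N := (quo_structure M).

Lemma hpi_surj s (y : N s) : exists x : N Home, y = hpi s x.
Proof.
case: s y => [|p k] y; first by exists y.
by exists (repr (y : Quotient.quot (multiples (val p ^ k.+1)))); rewrite /hpi /= quo_pi_repr.
Qed.

Lemma hpi0 s : hpi s (0 : N Home) = (0 : quo_carrier M s).
Proof. by case: s => //= p k; exact: quo_pi0. Qed.

Lemma hpiD s (x y : M) : hpi s (x + y : N Home) = (hpi s (x : N Home) : quo_carrier M s) + hpi s (y :
  N Home).
Proof. by case: s => //= p k; exact: quo_piD. Qed.

Lemma hpiN s (x : M) : hpi s (- x : N Home) = - (hpi s (x : N Home) : quo_carrier M s).
Proof. by case: s => //= p k; exact: quo_piN. Qed.

Local Notation ctx := (map (fun _ : quo_sort => tt)).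

Definition lift_env G (e : env (pres_structure M) (ctx G)) : env N G :=
  fun s v => hpi s (e tt (vmap (fun _ => tt) v) : N Home).

Lemma pres_term G s (t : term quo_sig G s) : exists u : term pres_sig (ctx G) tt,
  forall e, eval (lift_env e) t = hpi s (eval e u : N Home).
Proof.
elim: t => {s} [s v|f args IH]; first by exists (@Var pres_sig _ tt (vmap (fun _ => tt) v)).
case: f args IH => [s|s|s|p k|p k] /= args IH.
- by exists (App (L := pres_sig) PZero enil) => e; exact: esym (hpi0 s).
- have [u hu] := IH _ V0; have [u' hu'] := IH _ (VS V0).
  exists (App (L := pres_sig) PAdd (econs (u : term pres_sig (ctx G) tt) (econs u' enil))) => e.
  by rewrite /= hu hu'; exact: esym (hpiD s _ _).
- have [u hu] := IH _ V0.
  exists (App (L := pres_sig) POpp (econs (u : term pres_sig (ctx G) tt) enil)) => e.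
  by rewrite /= hu; exact: esym (hpiN s _).
- by have [u hu] := IH _ V0; exists u => e; rewrite /= hu.
- have [u hu] := IH _ V0; exists u => e; rewrite /= hu /=.
  by apply: quo_rho_pi; apply: dvdn_exp2l.
Qed.

Lemma pres_formula G (phi : formula quo_sig G) : exists psi : formula pres_sig (ctx G),
  forall e, sat phi (lift_env e) <-> sat psi e.
Proof.
elim: phi => {G} [G s t u|G r args|G|G phi [f hf] psi [g hg]|G s phi [f hf]].
- have [t' ht] := pres_term t; have [u' hu] := pres_term u.
  case: s t u ht hu => [|p k] t u ht hu.
    by exists (FEq t' u') => e; rewrite /= ht hu.
  exists (FPred (L := pres_sig) (PCong (val p ^ k.+1)) (econs t' (econs u' enil))) => e.
  by rewrite /= ht hu; exact: quo_pi_eq.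
- case: r args => args.
  have [t' ht] := pres_term (args _ V0); have [u' hu] := pres_term (args _ (VS V0)).
  exists (FPred (L := pres_sig) PLt (econs (t' : term pres_sig (ctx G) tt) (econs u' enil))) => e.
  by rewrite /= ht hu.
- by exists (FBot _).
- by exists (FImp f g) => e /=; rewrite hf hg.
- exists (FAll (s := tt : Defs.sort pres_sig) f) => e /=.
  have E x : sat phi (econs (hpi s x) (lift_env e)) <-> sat f (econs (x : pres_structure M tt) e).
    rewrite -hf (_ : lift_env _ = econs (hpi s x) (lift_env e)) //.
    exact: env_cons_eq.
  split=> h x; first exact/E/h.
  by have [y ->] := hpi_surj x; apply/E/h.
Qed.
End Quotients.

(** * Regular groups *)

Section Regular_group.
Context (M : porderZmodType) (hM : ordered_abelian_group M) (hdense : dense_oag M) (hreg : regular M).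
Local Notation N := (quo_structure M).
Implicit Types x y z : M.

Lemma oag_subr_gt0 x y : (x < y) = (0 < y - x).
Proof.
have H (u v w : M) : u <= v -> u + w <= v + w := proj2 hM u v w.
have L (u v w : M) : (u <= v) = (u + w <= v + w).
  by apply/idP/idP => [|/(H _ _ (- w))]; [exact: H | rewrite !addrK].
by rewrite !lt_neqAle (L x y (- x)) subrr [0 == _]eq_sym subr_eq0 [y == x]eq_sym.
Qed.

Lemma oag_posD x y : 0 < x -> 0 < y -> 0 < x + y.
Proof. by move=> h1 h2; apply: lt_trans h1 _; rewrite oag_subr_gt0 addrC addKr. Qed.

Lemma oag_pos_total x : x <> 0 -> 0 < x \/ 0 < - x.
Proof.
move=> /eqP x0; have [tot _] := hM; case/orP: (tot 0 x) => h.
  by left; rewrite lt_neqAle eq_sym x0.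
by right; rewrite -sub0r -oag_subr_gt0 lt_neqAle x0.
Qed.

Lemma oag_posMn x n : (0 < n)%N -> 0 < x -> 0 < x *+ n.
Proof.
case: n => // n _ p; elim: n => [|n IH]; first by rewrite mulr1n.
by rewrite mulrS; apply: oag_posD.
Qed.

Lemma oag_small n x : (0 < n)%N -> 0 < x -> exists z, 0 < z /\ z *+ n < x.
Proof.
have [_ nleast] := hdense.
have half y : 0 < y -> exists z, 0 < z /\ z *+ 2 <= y.
  move=> y0; have [z [z0 zy]] : exists z, 0 < z /\ z < y.
    apply: contrapT => h; apply: nleast; exists y; split=> // z z0.
    have [tot _] := hM; case/orP: (tot y z) => // zy.
    have [->//|ne] := eqVneq y z; case: h; exists z; split=> //.
    by rewrite lt_neqAle eq_sym ne.
  have yz0 : 0 < y - z by rewrite -oag_subr_gt0.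
  have [tot _] := hM; case/orP: (tot z (y - z)) => h.
    exists z; split=> //; have [_ mono] := hM.
    by have := mono _ _ z h; rewrite subrK mulr2n.
  exists (y - z); split=> //; have [_ mono] := hM.
  by have := mono _ _ (y - z) h; rewrite mulr2n [z + _]addrC subrK.
have pow k : 0 < x -> exists z, 0 < z /\ z *+ (2 ^ k) <= x.
  move=> x0; elim: k => [|k [z [z0 zx]]]; first by exists x; rewrite expn0 mulr1n.
  have [u [u0 uz]] := half z z0; exists u; split=> //.
  apply: le_trans zx; rewrite expnS mulrnA; have [_ mono] := hM.
  elim: (2 ^ k)%N => [|j IH]; first by rewrite !mulr0n.
  rewrite (mulrS (u *+ 2)) (mulrS z); apply: (le_trans (mono _ _ (u *+ 2 *+ j) uz)).
  by rewrite ![z + _]addrC; exact: mono.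
move=> n0 x0; have [z [z0 zx]] := pow n x0; exists z; split=> //.
apply: lt_le_trans zx; rewrite oag_subr_gt0 -mulrnBr; last by rewrite ltnW // ltn_expl.
by apply: oag_posMn => //; rewrite subn_gt0 ltn_expl.
Qed.

Lemma oag_dominated (a e : M) (p q : int) (K : nat) : 0 < a -> 0 < e -> e *+ K < a ->
  (`|q| <= K)%N -> p != 0 -> (0 < a *~ p + e *~ q <-> 0 < p) /\ (0 < - (a *~ p + e *~ q) <-> p < 0).
Proof.
move=> a0 e0 eK qK p0.
have H (p' q' : int) : 0 < p' -> (`|q'| <= K)%N -> 0 < a *~ p' + e *~ q'.
  move=> p'0 q'K; have nn (y : M) n : 0 < y -> 0 <= y *+ n.
    by case: n => [|n] y0; [rewrite mulr0n | apply/ltW/oag_posMn].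
  have addnn y z : 0 < y -> 0 <= z -> 0 < y + z.
    by move=> y0; rewrite le_eqVlt => /orP[/eqP<-|]; [rewrite addr0 | apply: oag_posD].
  rewrite (_ : _ + _ = (a - e *+ K) + a *+ `|(p' - 1)%R|%N + e *+ `|(q' + K%:Z)%R|%N).
    by apply: (addnn); last exact: nn; apply: (addnn); last exact: nn; rewrite -oag_subr_gt0.
  rewrite !(pmulrn _ `|_|%N) (_ : (`|(p' - 1)%R|%N : int) = p' - 1); last by lia.
  rewrite (_ : (`|(q' + K%:Z)%R|%N : int) = q' + K%:Z); last by lia.
  zmod.
have asym y : 0 < y -> 0 < - y -> False.
  by move=> h1 h2; have := oag_posD h1 h2; rewrite subrr ltxx.
have [pp|pn] : 0 < p \/ p < 0 by lia.
  have h := H _ _ pp qK; split; split=> // h'; last by lia.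
  by case: (asym _ h h').
have h : 0 < - (a *~ p + e *~ q) by rewrite opprD -!mulrNz; apply: H; rewrite ?abszN //; lia.
by split; split=> // h'; [case: (asym _ h' h) | lia].
Qed.

Lemma pres_one0 : pres_one M = 0.
Proof.
rewrite /pres_one; apply: xgetPN => x; have [_ h] := hdense.
by move=> hx; apply: h; exists x.
Qed.

Definition penv (I : Type) (x : I -> M) G (i : forall s, var G s -> option I) : env (pres_structure M) G :=
  fun s v => oapp x 0 (i s v).

Lemma hmuln_mulrn n x : hmuln (M := N) n x = x *+ n.
Proof. by elim: n => [|n IH] //; rewrite /hmuln iterS -/(hmuln n _) IH mulrS. Qed.

Lemma hdvd_dvdV n x : hdvd (M := N) n x <-> dvdV n x.
Proof. by split=> -[z ->]; exists z; rewrite hmuln_mulrn. Qed.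

Lemma wval_zval (I : finType) (w : @word I) (x : I -> M) : wval (N := N) w x = zval w x.
Proof. by []. Qed.

Lemma pres_word (I : finType) G s (t : term pres_sig G s) (i : forall s, var G s -> option I) :
  exists w : @word I, forall x : I -> M, eval (penv x i) t = zval w x.
Proof.
elim: t => {s} [s v|f args IH].
  case e: (i s v) => [j|]; last by exists [::] => x; rewrite /= /penv e.
  by exists [:: (false, j)] => x; rewrite /= /penv e /= addr0.
case: f args IH => args IH.
- by exists [::].
- have [w hw] := IH _ V0; have [w' hw'] := IH _ (VS V0).
  by exists (w ++ w') => x; rewrite zval_cat -hw -hw'.
- by have [w hw] := IH _ V0; exists (word_neg w) => x; rewrite zval_neg -hw.
- by exists [::] => x; exact: pres_one0.
Qed.

Lemma pres_qf (I : finType) G (psi : formula pres_sig G) (i : forall s, var G s -> option I) :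
  quantifier_free psi -> exists s : seq (@word I * nat), (forall l, l \in s -> (0 < l.2)%N) /\
  forall x x' : I -> M, word_agree (M := N) s x x' ->
  (sat psi (penv x i) <-> sat psi (penv x' i)).
Proof.
elim: psi i => {G} [G s t u|G r args|G|G phi IH psi IH'|G s phi IH] i //=.
- move=> _; have [w hw] := pres_word t i; have [w' hw'] := pres_word u i.
  exists [:: (w ++ word_neg w', 1%N)]; split=> [l|x x' /(_ _ (mem_head _ _))[h1 h2 _]].
    by rewrite inE => /eqP->.
  rewrite !hw !hw'; move: h1 h2; rewrite !wval_zval !zval_cat !zval_neg.
  have E (y y' : M) : y = y' <-> ~ 0 < y - y' /\ ~ 0 < - (y - y').
    split=> [->|[h1 h2]]; first by rewrite subrr oppr0 ltxx.
    by apply/eqP; rewrite -subr_eq0; apply/eqP; apply: contrapT => /oag_pos_total[].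
  by move=> h1 h2; rewrite !E; split=> -[a b]; split; rewrite ?(h1, h2) //;
    [move/h1 | move/h2 | move/h1 | move/h2].
- have [w hw] := pres_word (args _ V0) i; have [w' hw'] := pres_word (args _ (VS V0)) i.
  move=> _; case: r args hw hw' => [|n] args hw hw'.
    exists [:: (w' ++ word_neg w, 1%N)]; split=> [l|x x' /(_ _ (mem_head _ _))[h1 _ _]].
      by rewrite inE => /eqP->.
    by rewrite /= !hw !hw' !(oag_subr_gt0 (zval w _)); move: h1; rewrite !wval_zval !zval_cat !zval_neg.
  have [n0|n0] := posnP n.
    exists [:: (w ++ word_neg w', 1%N)]; split=> [l|x x' /(_ _ (mem_head _ _))[h1 h2 _]].
      by rewrite inE => /eqP->.
    rewrite /= n0 !hw !hw'; move: h1 h2; rewrite !wval_zval !zval_cat !zval_neg.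
    have E (y : M) : (exists z, y = z *+ 0) <-> ~ 0 < y /\ ~ 0 < - y.
      split=> [[z ->]|[h1 h2]]; first by rewrite mulr0n oppr0 ltxx.
      by exists 0; apply: contrapT; rewrite mulr0n => /oag_pos_total[].
    by move=> h1 h2; rewrite !E; split=> -[a b]; split; [move/h1 | move/h2 | move/h1 | move/h2].
  exists [:: (w ++ word_neg w', n)]; split=> [l|x x' /(_ _ (mem_head _ _))[_ _ h3]].
    by rewrite inE => /eqP->.
  rewrite /= !hw !hw'; move: h3; rewrite !hdvd_dvdV !wval_zval !zval_cat !zval_neg.
  exact.
- by exists [::].
- case/andP => q1 q2; have [s [s0 hs]] := IH i q1; have [s' [s0' hs']] := IH' i q2.
  exists (s ++ s'); split=> [l|x x' h].
    by rewrite mem_cat => /orP[/s0|/s0'].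
  rewrite (hs x x') => [|l hl]; last by apply: h; rewrite mem_cat hl.
  by rewrite (hs' x x') => [|l hl]; last by apply: h; rewrite mem_cat hl orbT.
Qed.

Lemma formula_qe (I : finType) G (phi : formula quo_sig G) (i : forall s, var G s -> option I) :
  exists s : seq (@word I * nat), (forall l, l \in s -> (0 < l.2)%N) /\
  forall x x' : I -> M, word_agree (M := N) s x x' ->
  (sat phi (henv (N := N) x i) <-> sat phi (henv (N := N) x' i)).
Proof.
have [psi hpsi] := pres_formula M phi; have [chi [qf hchi]] := hreg psi.
pose i' := menv (g := fun _ : quo_sort => tt) (D := fun _ : unit => option I) (fun s v => i s v).
have [s [s0 hs]] := pres_qf i' qf; exists s; split=> // x x' h.
have E (y : I -> M) : sat phi (henv (N := N) y i) <-> sat chi (penv y i').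
  rewrite -hchi -hpsi (_ : lift_env _ = henv (N := N) y i) //.
  by apply: env_eq => r v; rewrite /lift_env /penv /i' (menvE (fun s v => i s v)).
by rewrite !E; exact: hs.
Qed.

(* The existence of a multiple of [n] in the interval from [c] to [c + e] depends only on signs and
   congruences of linear forms in [c] and [e]. If [e] is small compared to [c], these do not change
   when [e] and [c] are enlarged by suitable multiples of [m], and a long interval contains a
   multiple of [n]. *)
Lemma oag_coset_dense n (a b : M) : (0 < n)%N -> a < b -> exists z, a < z *+ n /\ z *+ n < b.
Proof.
move=> n0.
pose P (x : bool -> M) := exists z : M, x true < z *+ n /\ z *+ n < x true + x false.
have [G [phi [i hphi]]] : hdef (N := fun _ : unit => N) (fun _ (x : bool -> M) => P x).
  apply: (@hdef_ext _ _ _ (fun (_ : unit) (x : bool -> N Home) => exists z : N Home,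
    hlt (x true) (hmuln n z) /\ hlt (hmuln n z) (hadd (x true) (x false)))).
    by move=> _ x; rewrite /P; split=> -[z hz]; exists z; move: hz; rewrite hmuln_mulrn.
  apply: (hdef_ex1 (N := fun _ : unit => N) (P := fun (_ : unit) (z : N Home) (x : bool -> N Home) =>
    hlt (x true) (hmuln n z) /\ hlt (hmuln n z) (hadd (x true) (x false)))).
  have hz := hterm_muln n (hterm_var (fun _ : unit => N) (None : option bool)).
  have hx b' := hterm_var (fun _ : unit => N) (Some b' : option bool).
  exact: hdef_and (hdef_lt (hx true) hz) (hdef_lt hz (hterm_add (hx true) (hx false))).
have [s [s0 hs]] := formula_qe phi i.
have {hphi}hs (x x' : bool -> M) : word_agree (M := N) s x x' -> P x <-> P x'.
  by move=> h; rewrite -!(hphi tt); exact: hs.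
have /choice[k hk] (w : @word bool) := zval_dot w.
pose m := (n * \prod_(l <- s) l.2)%N.
have m0 : (0 < m)%N.
  rewrite muln_gt0 n0 big_seq; apply: (big_ind (fun t => (0 < t)%N)) => [//|x y hx hy|l /s0 //].
  by rewrite muln_gt0 hx.
have ml l : l \in s -> (l.2 %| m)%N.
  by move=> ls; rewrite dvdn_mull // (big_rem l) //= dvdn_mulr.
pose K := (\max_(l <- s) `|k l.1 false|)%N.
have Kl l : l \in s -> (`|k l.1 false| <= K)%N.
  by move=> ls; exact: (@leq_bigmax_seq _ _ xpredT (fun l : @word bool * nat => `|k l.1 false|%N)).
pose v (a e : M) (c : bool) := if c then a else e.
have zE w (a' e' : M) : zval w (v a' e') = a' *~ k w true + e' *~ k w false.
  by rewrite hk /dot big_bool.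
have posN (x y : M) : (x < y) = (0 < y - x) by exact: oag_subr_gt0.
have ge0Mn (x : M) j : 0 < x -> 0 <= x *+ j.
  by case: j => [|j] x0; [rewrite mulr0n | apply/ltW/oag_posMn].
have addge0 (x y : M) : 0 < x -> 0 <= y -> 0 < x + y.
  by move=> x0; rewrite le_eqVlt => /orP[/eqP<-|]; [rewrite addr0 | apply: oag_posD].
have main (c e : M) : 0 < c -> 0 < e -> e *+ K < c -> P (v c e).
  move=> c0 e0 eK; pose g := (c + e) *+ n - c.
  have g0 : 0 < g.
    rewrite /g (_ : _ - _ = e *+ n + c *+ n.-1); first by apply: addge0; [exact: oag_posMn | exact: ge0Mn].
    by rewrite mulrnDl -[in c *+ n](prednK n0) mulrS; zmod.
  pose e' := e + g *+ m; have e'0 : 0 < e' by apply: addge0 => //; exact: ge0Mn.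
  pose c' := c + e' *+ K *+ m.
  have P1 : P (v c e').
    exists (c + e) => /=; split; first by rewrite posN.
    rewrite posN /e' (_ : _ - _ = e + g *+ m.-1); first by apply: addge0 => //; exact: ge0Mn.
    by rewrite -{1}(prednK m0) mulrS /g; zmod.
  have P2 : P (v c' e').
    have [z [h1 h2]] := P1; exists (z + e' *+ K *+ (m %/ n)) => /=.
    have mE : e' *+ K *+ (m %/ n) *+ n = e' *+ K *+ m.
      by rewrite -(mulrnA (e' *+ K)) divnK // dvdn_mulr.
    rewrite mulrnDl mE /c'; move: h1 h2 => /=; rewrite (posN c) (posN (z *+ n)) => h1 h2; split.
      by rewrite posN (_ : _ - _ = z *+ n - c) //; zmod.
    by rewrite posN (_ : _ - _ = c + e' - z *+ n) //; zmod.
  have c'0 : 0 < c'.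
    by apply: addge0 => //; case: (K) => [|K']; rewrite ?mulr0n ?mul0rn //; apply: ge0Mn; exact: oag_posMn.
  have e'K : e' *+ K < c'.
    rewrite posN /c' (_ : _ - _ = c + e' *+ K *+ m.-1); last by rewrite -{1}(prednK m0) mulrS; zmod.
    by apply: addge0 => //; case: (K) => [|K']; rewrite ?mulr0n ?mul0rn //; apply: ge0Mn; exact: oag_posMn.
  apply: (iffLR (hs _ _ _) P2) => l ls; rewrite !wval_zval !zE; split.
  - have [p0|p0] := eqVneq (k l.1 true) 0; last first.
      exact: (iff_trans (oag_dominated c'0 e'0 e'K (Kl l ls) p0).1
        (iff_sym (oag_dominated c0 e0 eK (Kl l ls) p0).1)).
    rewrite p0 !mulr0z !add0r.
    have [->|q0] := eqVneq (k l.1 false) 0; first by rewrite !mulr0z.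
    have z0 (x : M) : 0 < x -> x *+ 0 < x by rewrite mulr0n.
    have := (@oag_dominated e' e' (k l.1 false) 0 0 e'0 e'0 (z0 _ e'0) isT q0).1;
      rewrite mulr0z addr0 => A1.
    have := (@oag_dominated e e (k l.1 false) 0 0 e0 e0 (z0 _ e0) isT q0).1; rewrite mulr0z addr0 => A2.
    exact: iff_trans A1 (iff_sym A2).
  - have [p0|p0] := eqVneq (k l.1 true) 0; last first.
      exact: (iff_trans (oag_dominated c'0 e'0 e'K (Kl l ls) p0).2
        (iff_sym (oag_dominated c0 e0 eK (Kl l ls) p0).2)).
    rewrite p0 !mulr0z !add0r.
    have [->|q0] := eqVneq (k l.1 false) 0; first by rewrite !mulr0z.
    have z0 (x : M) : 0 < x -> x *+ 0 < x by rewrite mulr0n.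
    have := (@oag_dominated e' e' (k l.1 false) 0 0 e'0 e'0 (z0 _ e'0) isT q0).2;
      rewrite mulr0z addr0 => A1.
    have := (@oag_dominated e e (k l.1 false) 0 0 e0 e0 (z0 _ e0) isT q0).2; rewrite mulr0z addr0 => A2.
    exact: iff_trans A1 (iff_sym A2).
  - rewrite !hdvd_dvdV; apply: dvdV_eqr.
    rewrite (_ : _ - _ = (e' *+ K *~ k l.1 true + g *~ k l.1 false) *+ m); last by rewrite /c' /e'; zmod.
    by apply: dvdV_trans (ml l ls) _; exists (e' *+ K *~ k l.1 true + g *~ k l.1 false).
have H (c b' : M) : 0 <= c -> c < b' -> exists z, c < z *+ n /\ z *+ n < b'.
  rewrite le_eqVlt => /orP[/eqP<- b0|c0 cb].
    by have [z [z0 zb]] := oag_small n0 b0; exists z; split=> //; exact: oag_posMn.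
  have [e [e0 eK]] := oag_small (ltn0Sn K) c0.
  have eK' : e *+ K < c.
    by rewrite posN (_ : c - _ = (c - e *+ K.+1) + e); [apply: oag_posD => //; rewrite -posN |
      rewrite mulrS; zmod].
  have [tot _] := hM; have d0 : 0 < b' - c by rewrite -posN.
  case/orP: (tot e (b' - c)) => h.
    have [z [z1 z2]] := main c e c0 e0 eK'; exists z; split=> //.
    apply: lt_le_trans z2 _; have [_ mono] := hM.
    by have := mono _ _ c h; rewrite subrK addrC.
  have [z [z1 z2]] : P (v c (b' - c)).
    apply: main => //; rewrite posN (_ : _ - _ = (c - e *+ K) + (e - (b' - c)) *+ K); last by zmod.
    apply: addge0; first by rewrite -posN.
    move: h; rewrite le_eqVlt => /orP[/eqP->|]; first by rewrite subrr mul0rn.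
    by rewrite posN; exact: ge0Mn.
  by exists z; split=> //; move: z2 => /=; rewrite addrC subrK.
move=> ab; have [tot _] := hM; case/orP: (tot 0 a) => [a0|a0]; first exact: H.
case/orP: (tot b 0) => b0; last first.
  have [a00|a0'] := eqVneq a 0; first by apply: H => //; rewrite a00.
  move: b0; rewrite le_eqVlt => /orP[/eqP b0|b0]; last first.
    by exists 0; rewrite mul0rn; split=> //; rewrite lt_neqAle a0'.
  have [|z [z1 z2]] := H 0 (- a) (lexx 0); first by rewrite -sub0r -posN b0.
  exists (- z); rewrite mulNrn; split; rewrite posN; first by move: z2; rewrite posN addrC.
  by rewrite -b0 opprK add0r.
have [||z [z1 z2]] := H (- b) (- a).
- have [_ mono] := hM; by have := mono _ _ (- b) b0; rewrite subrr add0r.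
- by rewrite posN opprK addrC -posN.
exists (- z); rewrite mulNrn; split; rewrite posN.
  by move: z2; rewrite posN addrC.
by move: z1; rewrite posN !opprK addrC.
Qed.
End Regular_group.

(** * Closure operators and imaginaries *)

Section Imaginary_sorts.
Context {L : signature} (U : structure L).
Local Notation real := (map (@Real L U)).
Local Notation eqU := (eq_structure U).

Lemma vmap_ind (S S' : Type) (g : S -> S') G (P : forall s, var (map g G) s -> Prop) :
  (forall t (w : var G t), P (g t) (vmap g w)) -> forall s v, P s v.
Proof.
elim: G P => [|t G IH] P h; first exact: var_nil_ind.
apply: var_cons_ind; first exact: (h t V0).
by apply: IH => r w; exact: (h r (VS w)).
Qed.

Fixpoint real_term G s (t : term L G s) : term (eq_sig U) (real G) (Real U s) :=
  match t in term _ _ s return term (eq_sig U) (real G) (Real U s) with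
  | Var s v => @Var (eq_sig U) (real G) (Real U s) (vmap (@Real L U) v)
  | App f args => App (L := eq_sig U) (OldFunc U f)
      (menv (g := @Real L U) (D := term (eq_sig U) (real G)) (fun s v => real_term (args s v)))
  end.

Lemma eval_real_term G s (t : term L G s) (e : env eqU (real G)) :
  eval e (real_term t) = eval (real_env e) t.
Proof.
elim: t => {s} //= f args IH; congr finterp; apply: env_eq => s v.
by rewrite /real_env menvE; exact: IH.
Qed.

Lemma real_formula G (phi : formula L G) : exists psi : formula (eq_sig U) (real G),
  forall e : env eqU (real G), sat psi e <-> sat phi (real_env e).
Proof.
elim: phi => {G} [G s t u|G r args|G|G phi [f hf] psi [g hg]|G s phi [f hf]].
- by exists (FEq (real_term t) (real_term u)) => e /=; rewrite !eval_real_term.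
- exists (FPred (L := eq_sig U) r (menv (g := @Real L U) (D := term (eq_sig U) (real G))
    (fun s v => real_term (args s v)))) => e /=.
  rewrite (_ : real_env _ = (fun s v => eval (real_env e) (args s v))) //.
  by apply: env_eq => s v; rewrite /real_env menvE; exact: eval_real_term.
- by exists (FBot _).
- by exists (FImp f g) => e /=; rewrite hf hg.
- exists (FAll (s := Real U s : Defs.sort (eq_sig U)) f) => e /=.
  have E (x : U s) : sat f (econs (x : eqU (Real U s)) e) <-> sat phi (econs x (real_env e)).
    by rewrite hf (_ : real_env _ = econs x (real_env e)) //; exact: env_cons_eq.
  by split=> h x; apply/E/h.
Qed.

Definition real_of G (b : env U G) : env eqU (real G) :=
  menv (g := @Real L U) (D := eqU) (fun s v => b s v).

Lemma real_ofK G (b : env U G) : real_env (real_of b) = b.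
Proof. by apply: env_eq => s v; rewrite /real_env /real_of menvE. Qed.

(* [chi] is an L-formula in a member of the class and in further variables whose terms are [f]. *)
Lemma imag_formula (E : def_equiv U) K H (chi : formula L (de_ctx E ++ K))
    (c : var H (Imag E : Defs.sort (eq_sig U))) (f : forall s, var K s -> term (eq_sig U) H (Real U s)) :
  exists psi : formula (eq_sig U) H, forall e : env eqU H,
  sat psi e <-> exists b : env U (de_ctx E), e _ c = de_proj b /\
    sat chi (ecat b (fun s v => eval e (f s v))).
Proof.
have [chi' hchi] := real_formula chi.
pose G := de_ctx E; pose H' := real G ++ H.
pose proj : term (eq_sig U) H' (Imag E : Defs.sort (eq_sig U)) :=
  App (L := eq_sig U) (Proj E) (fun s v => @Var (eq_sig U) H' s (vleft H v)).
pose fl s (v : var G s) : term (eq_sig U) H' (Real U s) :=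
  @Var (eq_sig U) H' (Real U s) (vleft H (vmap (@Real L U) v)).
pose fr s (v : var K s) : term (eq_sig U) H' (Real U s) :=
  tsubst (f s v) (fun r w => @Var (eq_sig U) H' r (vright (real G) w)).
pose g : env (term (eq_sig U) H') (real (G ++ K)) := menv (g := @Real L U) (D := term (eq_sig U) H')
  (@ecat (Defs.sort L) (fun s => term (eq_sig U) H' (Real U s)) G K fl fr).
have [psi hpsi] := def_ex_ctx (def_and
  (def_eq (fun _ : unit => eqU) (@Var (eq_sig U) H' _ (vright (real G) c)) proj)
  (ex_intro (fun phi : formula (eq_sig U) H' => forall (j : unit) (e : env eqU H'), sat phi e <->
    sat (fsubst chi' g) e) (fsubst chi' g) (fun _ _ => iff_refl _))).
exists psi => e; rewrite (hpsi tt e).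
have E1 (r : env eqU (real G)) : eval (ecat r e) proj = de_proj (real_env r).
  apply: (congr1 (@de_proj L U E)); apply: env_eq => s v.
  exact: (@ecat_left (eq_sig U) eqU (real G) H r e (Real U s) (vmap (@Real L U) v)).
have E2 (r : env eqU (real G)) : sat (fsubst chi' g) (ecat r e : env eqU H') <->
    sat chi (ecat (real_env r) (fun s v => eval e (f s v))).
  rewrite sat_subst hchi.
  set e1 := real_env _; rewrite (_ : e1 = ecat (real_env r) (fun s v => eval e (f s v))) //.
  have := @ecat_map L (fun s => term (eq_sig U) H' (Real U s)) U
    (fun s t => eval (ecat r e : env eqU H') t) G K fl fr.
  rewrite (_ : (fun s v => eval (ecat r e : env eqU H') (fl s v)) = real_env r); last first.
    apply: env_eq => s v.
    exact: (@ecat_left (eq_sig U) eqU (real G) H r e (Real U s) (vmap (@Real L U) v)).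
  rewrite (_ : (fun s v => eval (ecat r e : env eqU H') (fr s v)) = (fun s v => eval e (f s v)));
    last first.
    apply: env_eq => s v; rewrite /fr eval_subst.
    apply: (congr1 (fun e' : env eqU H => eval e' (f s v))).
    by apply: env_eq => r' w; exact: (@ecat_right (eq_sig U) eqU (real G) H r e r' w).
  move=> <-; apply: env_eq => s v; rewrite /e1 /real_env /g.
  by rewrite menvE.
split=> [[r [h1 h2]]|[b [h1 h2]]].
  exists (real_env r); split; last exact/E2.
  by rewrite -E1 -h1; apply/esym; exact: (@ecat_right (eq_sig U)).
exists (real_of b); split; last by apply/E2; rewrite real_ofK.
rewrite E1 real_ofK -h1; exact: (@ecat_right (eq_sig U)).
Qed.

Lemma de_class_eqP (E : def_equiv U) (a b : env U (de_ctx E)) :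
  de_proj a = de_proj b <-> de_rel a b.
Proof.
split=> [/(congr1 (@sval _ _)) /= h|h].
  by have : de_class a b by rewrite h; exact: de_refl.
apply: eq_exist; apply/seteqP; split=> c /= hc; last exact: de_trans hc.
exact: de_trans (de_sym h) hc.
Qed.

Lemma dcl_imaginary (E : def_equiv U) (b0 : env U (de_ctx E)) K (chi : formula L (de_ctx E ++ K))
    (h : env U K) :
  (forall b, sat chi (ecat b h) <-> de_rel b0 b) ->
  dcl (real_entries h) (Tagged eqU (de_proj b0 : eqU (Imag E))).
Proof.
move=> hchi; pose H := (Imag E : Defs.sort (eq_sig U)) :: real K.
have [psi hpsi] := @imag_formula E K H chi V0
  (fun s v => @Var (eq_sig U) H (Real U s) (VS (vmap (@Real L U) v))).
exists (existT _ (real K) (psi, real_of h)); split.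
  move=> x [s [v ->]]; move: s v; apply: vmap_ind => t w.
  by exists t, w; rewrite /= /real_of menvE.
move=> x; rewrite /realizes /= hpsi /=.
rewrite (_ : (fun s v => _) = h); last first.
  by apply: env_eq => s v; rewrite /real_of menvE.
split=> [[b [-> /hchi hb]]|->]; first by apply/de_class_eqP; exact: de_sym.
by exists b0; split=> //; apply/hchi; exact: de_refl.
Qed.

Lemma acl_imaginary (E : def_equiv U) (b0 : env U (de_ctx E)) s (d : U s)
    (chi : formula L (de_ctx E ++ [:: s])) :
  (exists b, de_rel b0 b /\ sat chi (ecat b (econs d enil))) ->
  finite_set [set d' | exists b, de_rel b0 b /\ sat chi (ecat b (econs d' enil))] ->
  acl [set Tagged eqU (de_proj b0 : eqU (Imag E))] (Tagged eqU (d : eqU (Real U s))).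
Proof.
move=> hd fin.
pose H : seq (Defs.sort (eq_sig U)) := [:: Real U s; Imag E].
have [psi hpsi] := @imag_formula E [:: s] H chi (VS V0)
  (@econs (Defs.sort L) (fun s => term (eq_sig U) H (Real U s)) s [::] (@Var (eq_sig U) H (Real U s)
    V0) enil).
pose f : pformula eqU (Real U s) := existT _ [:: Imag E : Defs.sort (eq_sig U)]
  (psi, @econs (Defs.sort (eq_sig U)) eqU (Imag E) [::] (de_proj b0) enil).
have R x : realizes x f <-> exists b, de_rel b0 b /\ sat chi (ecat b (econs (x : U s) enil)).
  rewrite /realizes /f /= hpsi /=.
  rewrite (_ : (fun r v => _) = econs (x : U s) enil); last first.
    by apply: env_cons_eq => //; exact: var_nil_ind.
  by split=> -[b [h1 h2]]; exists b; split=> //; apply/de_class_eqP.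
exists f; split; last exact/R.
- move=> x [r [v ->]]; move: r v; apply: var_cons_ind => //.
  exact: var_nil_ind.
- by apply: sub_finite_set fin => x /R.
Qed.

Lemma dcl_self s (x : U s) :
  dcl (real_entries (econs x enil : env U [:: s])) (Tagged eqU (x : eqU (Real U s))).
Proof.
pose H : seq (Defs.sort (eq_sig U)) := [:: Real U s; Real U s].
exists (existT _ [:: Real U s : Defs.sort (eq_sig U)]
  (FEq (@Var (eq_sig U) H _ V0) (@Var (eq_sig U) H _ (VS V0)),
   @econs (Defs.sort (eq_sig U)) eqU (Real U s) [::] x enil)); split=> //.
move=> y [r [v ->]]; exists s, V0; move: r v; apply: var_cons_ind => //.
exact: var_nil_ind.
Qed.

Lemma acl_self s (x : U s) :
  real_entries (econs x enil : env U [:: s]) `<=`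
  acl [set Tagged eqU (x : eqU (Real U s))].
Proof.
pose H : seq (Defs.sort (eq_sig U)) := [:: Real U s; Real U s].
move=> _ [r [v ->]].
have -> : Tagged eqU ((econs x enil : env U [:: s]) r v : eqU (Real U r)) =
    Tagged eqU (x : eqU (Real U s)).
  by move: r v; apply: var_cons_ind => //; exact: var_nil_ind.
exists (existT _ [:: Real U s : Defs.sort (eq_sig U)]
  (FEq (@Var (eq_sig U) H _ V0) (@Var (eq_sig U) H _ (VS V0)),
   @econs (Defs.sort (eq_sig U)) eqU (Real U s) [::] x enil)); split=> //.
- move=> y [r' [w ->]]; move: r' w; apply: var_cons_ind => //.
  exact: var_nil_ind.
- by apply: sub_finite_set (finite_set1 x) => y.
Qed.
End Imaginary_sorts.

(** * Models *)

Lemma dot_word (I : finType) (k : I -> int) : exists w : @word I,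
  forall (V : zmodType) (x : I -> V), zval w x = dot k x.
Proof.
rewrite /dot; elim: (index_enum I) => [|i s [w IH]].
  by exists [::] => V x; rewrite big_nil.
exists (nseq `|k i| (k i < 0, i) ++ w) => V x; rewrite zval_cat IH big_cons; congr (_ + _).
have H n b : zval (nseq n (b, i)) x = (if b then - x i else x i) *+ n.
  by elim: n => //= n ->; rewrite mulrS.
rewrite H; case: (ltrP (k i) 0) => h; last by rewrite pmulrn; congr (_ *~ _); lia.
by rewrite mulNrn pmulrn -mulrNz; congr (_ *~ _); lia.
Qed.

Section Model.
Context (M : porderZmodType) (hM : ordered_abelian_group M) (hdense : dense_oag M) (hreg : regular M).
Context (U : structure quo_sig) (hU : models U (Th (quo_structure M))).

Definition fam (b : bool) : structure quo_sig := if b then quo_structure M else U.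

Lemma transfer (I : finType) (P : forall b, (I -> fam b Home) -> Prop) :
  hdef P -> (forall x, P true x) -> forall x, P false x.
Proof. exact: (@hdef_transfer bool fam true false I P hU). Qed.

Local Notation T3 := (option bool).

Lemma home_addA (x y z : U Home) : hadd x (hadd y z) = hadd (hadd x y) z.
Proof.
have h : hdef (N := fam) (fun b (v : T3 -> fam b Home) =>
    hadd (v None) (hadd (v (Some true)) (v (Some false))) = hadd (hadd (v None) (v (Some true))) (v
      (Some false))).
  by apply: hdef_eq; do ![apply: hterm_add | exact: hterm_var].
exact: (transfer h (fun v => addrA _ _ _)
  (fun i : T3 => match i with None => x | Some true => y | Some false => z end)).
Qed.

Lemma home_addC (x y : U Home) : hadd x y = hadd y x.
Proof.
have h : hdef (N := fam) (fun b (v : bool -> fam b Home) =>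
    hadd (v true) (v false) = hadd (v false) (v true)).
  by apply: hdef_eq; do ![apply: hterm_add | exact: hterm_var].
exact: (transfer h (fun v => addrC _ _) (fun i : bool => if i then x else y)).
Qed.

Lemma home_add0 (x : U Home) : hadd (hzero U) x = x.
Proof.
have h : hdef (N := fam) (fun b (v : unit -> fam b Home) => hadd (hzero _) (v tt) = v tt).
  by apply: hdef_eq; do ![apply: hterm_add | exact: hterm_var | exact: hterm_zero].
exact: (transfer h (fun v => add0r _) (fun=> x)).
Qed.

Lemma home_addN (x : U Home) : hadd (hopp x) x = hzero U.
Proof.
have h : hdef (N := fam) (fun b (v : unit -> fam b Home) => hadd (hopp (v tt)) (v tt) = hzero _).
  by apply: hdef_eq; do ![apply: hterm_add | apply: hterm_opp | exact: hterm_var | exact: hterm_zero].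
exact: (transfer h (fun v => addNr _) (fun=> x)).
Qed.

Definition home_group : zmodType :=
  HB.pack {classic U Home}
    (GRing.isZmodule.Build {classic U Home} home_addA home_addC home_add0 home_addN).

Local Notation V := home_group.

Lemma home_muln n (x : V) : hmuln (M := U) n x = x *+ n.
Proof. by elim: n => [|n IH] //; rewrite /hmuln iterS -/(hmuln n _) IH mulrS. Qed.

Lemma home_dvd n (x : V) : hdvd (M := U) n x <-> dvdV n x.
Proof. by split=> -[z ->]; exists z; rewrite home_muln. Qed.

Definition home_pos (x : V) : Prop := hpos (M := U) x.

Lemma home_regular : regular_oag home_pos.
Proof.
have Mlt (x y : M) : (x < y) = (0 < y - x) := oag_subr_gt0 hM x y.
have lt_pos (x y : U Home) : hlt x y <-> hpos (hadd y (hopp x)).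
  have h : hdef (N := fam) (fun b (v : bool -> fam b Home) =>
      hlt (v true) (v false) <-> hpos (hadd (v false) (hopp (v true)))).
    apply: hdef_iff; first by apply: hdef_lt; exact: hterm_var.
    by apply: hdef_pos; apply: hterm_add; [exact: hterm_var | apply: hterm_opp; exact: hterm_var].
  apply: (transfer h _ (fun i : bool => if i then x else y)) => v.
  rewrite /hpos /hlt /= (Mlt (v true)); exact: iff_refl.
split.
- have h : hdef (N := fam) (fun b (v : void -> fam b Home) => ~ hpos (hzero (fam b))).
    by apply: hdef_not; apply: hdef_pos; exact: hterm_zero.
  apply: (transfer h _ (void_elim _)) => v.
  by rewrite /hpos /hlt /= ltxx.
- move=> x y.
  have h : hdef (N := fam) (fun b (v : bool -> fam b Home) =>
      hpos (v true) -> hpos (v false) -> hpos (hadd (v true) (v false))).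
    do ![apply: hdef_imp]; apply: hdef_pos; do ?[apply: hterm_add]; exact: hterm_var.
  by apply: (transfer h _ (fun i : bool => if i then x else y)) => v; exact: oag_posD.
- move=> x x0.
  have h : hdef (N := fam) (fun b (v : unit -> fam b Home) =>
      ~ (v tt = hzero _) -> ~ hpos (v tt) -> hpos (hopp (v tt))).
    have hv := hterm_var fam tt.
    exact: hdef_imp (hdef_not (hdef_eq hv (hterm_zero fam unit)))
      (hdef_imp (hdef_not (hdef_pos hv)) (hdef_pos (hterm_opp hv))).
  have [p|p] := pselect (home_pos x); [by left | right].
  apply: (transfer h _ (fun=> x)) => // v v0 vp.
  by have [] := oag_pos_total hM v0.
- have h : hdef (N := fam) (fun b (v : void -> fam b Home) => exists y : fam b Home, hpos y).
    apply: (hdef_ex1 (N := fam) (P := fun b y (v : void -> fam b Home) => hpos y)).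
    by apply: hdef_pos; exact: hterm_var.
  apply: (transfer h _ (void_elim _)) => _.
  have [[x x0] _] := hdense.
  by have [p|p] := oag_pos_total hM (elimN eqP x0); [exists x | exists (- x)].
- move=> n a b n0 ab.
  have h : hdef (N := fam) (fun c (v : bool -> fam c Home) => hlt (v true) (v false) ->
      exists z, hlt (v true) (hmuln n z) /\ hlt (hmuln n z) (v false)).
    apply: hdef_imp; first by apply: hdef_lt; exact: hterm_var.
    apply: (hdef_ex1 (N := fam) (P := fun c z (v : bool -> fam c Home) =>
      hlt (v true) (hmuln n z) /\ hlt (hmuln n z) (v false))).
    have hz := hterm_muln n (hterm_var fam (None : option bool)).
    have hx b' := hterm_var fam (Some b' : option bool).
    exact: hdef_and (hdef_lt (hx true) hz) (hdef_lt hz (hx false)).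
  have ab' : hlt (a : U Home) b by apply/lt_pos.
  have [|z [/lt_pos h1 /lt_pos h2]] := transfer h _ (fun i : bool => if i then a else b) ab'.
    move=> v hv; have [z [h1 h2]] := oag_coset_dense hM hdense hreg n0 hv.
    by exists z; rewrite (hmuln_mulrn (M := M)).
  by exists z; rewrite home_muln in h1 h2.
Qed.

Definition home_def (I : finType) (P : (I -> V) -> Prop) : Prop :=
  hdef (N := fun _ : unit => U) (fun _ x => P x).

Lemma home_definability : definability home_pos home_def.
Proof.
split.
- by move=> I; exact: hdef_bot.
- by move=> I P Q; exact: hdef_imp.
- by move=> I J P; exact: hdef_all.
- by move=> I J g P; exact: hdef_map.
- move=> I k; have [w hw] := dot_word k.
  apply: hdef_ext (hdef_pos (hterm_wval (fun _ : unit => U) w)) => _ x.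
  by rewrite -hw.
move=> I P [G [phi [i hphi]]].
have [s [s0 hs]] := formula_qe hM hdense hreg phi i.
have h : hdef (N := fam) (fun b (y : I + I -> fam b Home) =>
    word_agree s (y \o inl) (y \o inr) ->
    (sat phi (henv (y \o inl) i) <-> sat phi (henv (y \o inr) i))).
  apply: hdef_imp; first exact: hdef_word_agree.
  have hf := hdef_formula fam phi i.
  exact: hdef_iff (hdef_map inl hf) (hdef_map inr hf).
have qe (x x' : I -> V) : word_agree (M := U) s x x' -> (P x <-> P x').
  move=> hx; rewrite -!(hphi tt).
  by apply: (transfer h (fun y => hs (y \o inl) (y \o inr)) (vcat x x')).
have /choice[k hk] (w : @word I) := zval_dot w.
pose N := (\prod_(l <- s) l.2)%N.
have N0 : (0 < N)%N.
  rewrite /N big_seq; apply: (big_ind (fun t => (0 < t)%N)) => [//|x y hx hy|l /s0 //].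
  by rewrite muln_gt0 hx.
exists ([seq k l.1 | l : @word I * nat <- s] ++
        [seq [ffun j => k l.1 j * (N %/ l.2)%N%:Z] | l : @word I * nat <- s]), N.
split=> // x x' hx; apply: qe => l ls.
have [|h1 _] := hx (k l.1).
  by rewrite mem_cat; apply/orP; left; apply: (map_f (fun l : @word I * nat => k l.1)).
have [|_ h2] := hx [ffun j => k l.1 j * (N %/ l.2)%N%:Z].
  rewrite mem_cat; apply/orP; right.
  exact: (map_f (fun l : @word I * nat => [ffun j => k l.1 j * (N %/ l.2)%N%:Z])).
have lN : (l.2 %| N)%N by rewrite /N (big_rem l) //= dvdn_mulr.
have Nl0 : (0 < N %/ l.2)%N by rewrite divn_gt0 ?s0 // dvdn_leq.
have E (y : I -> V) : dvdV N (dot [ffun j => k l.1 j * (N %/ l.2)%N%:Z] y) <-> dvdV l.2 (dot (k l.1) y).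
  have -> : dot [ffun j => k l.1 j * (N %/ l.2)%N%:Z] y = dot (k l.1) y *+ (N %/ l.2).
    by rewrite /dot -sumrMnl; apply: eq_bigr => j _; rewrite ffunE mulrzA -pmulrn.
  split=> [h'|[z ->]]; last by exists z; rewrite -mulrnA mulnC divnK.
  by apply: (dvdV_lift home_regular Nl0); rewrite divnK.
split.
- have e : home_pos (dot (k l.1) x) <-> home_pos (dot (k l.1) x').
    by rewrite !(sgn_pos home_regular) h1.
  by rewrite -!hk in e.
- have e : home_pos (- dot (k l.1) x) <-> home_pos (- dot (k l.1) x').
    by rewrite !(sgn_pos home_regular) !(sgnN home_regular) h1.
  by rewrite -!hk in e.
- by move: h2; rewrite !E -!hk => e; rewrite (home_dvd l.2 (zval l.1 x)) (home_dvd l.2 (zval l.1 x')).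
Qed.

Lemma home_pi_surj s (y : U s) : exists x : V, y = hpi s x.
Proof.
case: s y => [|p k] y; first by exists y.
pose phi : formula quo_sig [::] := FAll (s := Quo p k : Defs.sort quo_sig)
  (FImp (FAll (s := Home : Defs.sort quo_sig)
    (FImp (FEq (@Var quo_sig [:: Home; Quo p k] (Quo p k) (VS V0))
      (pi_term (Quo p k) (@Var quo_sig [:: Home; Quo p k] Home V0))) (FBot _))) (FBot _)).
have E (N : structure quo_sig) : sat phi (enil : env N [::]) <->
    forall y : N (Quo p k), ~ forall x : N Home, y <> hpi (Quo p k) x.
  have e (y' : N (Quo p k)) (x : N Home) :
      eval (econs x (econs y' enil) : env N [:: Home; Quo p k])
        (pi_term (Quo p k) (@Var quo_sig [:: Home; Quo p k] Home V0)) = hpi (Quo p k) x.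
    exact: eval_pi.
  split=> h y' h'; apply: (h y') => x; first by rewrite /sat -/sat e; exact: h'.
  by have := h' x; rewrite /sat -/sat e.
have /(hU (t := phi))/E/(_ y) h : Th (quo_structure M) phi.
  by apply/E => y' h; have [x hx] := hpi_surj y'; apply: (h x).
by apply: contrapT => n; apply: h => x hx; apply: n; exists x.
Qed.

Lemma home_pi_eq (p : primes_t) k (x y : V) :
  hpi (Quo p k) (x : U Home) = hpi (Quo p k) y <-> dvdV (val p ^ k.+1) (x - y).
Proof.
have h : hdef (N := fam) (fun b (v : bool -> fam b Home) =>
    hpi (Quo p k) (v true) = hpi (Quo p k) (v false) <->
    hdvd (val p ^ k.+1) (hadd (v true) (hopp (v false)))).
  apply: hdef_iff; last first.
    by apply: hdef_dvd; apply: hterm_add; [exact: hterm_var | apply: hterm_opp; exact: hterm_var].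
  pose G : seq quo_sort := [:: Quo p k; Quo p k].
  pose i : forall s, var G s -> option bool := @econs quo_sort (fun=> option bool) (Quo p k) _ (Some true)
    (@econs quo_sort (fun=> option bool) (Quo p k) _ (Some false) enil).
  exact: (hdef_formula fam (FEq (@Var quo_sig G (Quo p k) V0) (@Var quo_sig G (Quo p k) (VS V0))) i).
have := transfer h _ (fun b : bool => if b then x else y); rewrite /= -(home_dvd _ (x - y)); apply => v.
rewrite (hdvd_dvdV (M := M)); exact: (quo_pi_eq (val p ^ k.+1) (v true) (v false)).
Qed.

Lemma home_context (I : finType) : exists (G : seq quo_sort) (iv : I -> var G Home),
  forall x : I -> V, exists e : env U G, forall i, e Home (iv i) = x i.
Proof.
suff [G [iv h]] : exists (G : seq quo_sort) (iv : I -> var G Home),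
    forall x : I -> V, exists e : env U G, forall i, i \in enum I -> e Home (iv i) = x i.
  exists G, iv => x; have [e he] := h x; exists e => i; exact: he (mem_enum _ i).
elim: (enum I) => [|j s [G [iv h]]].
  by exists [:: Home], (fun _ => V0) => x; exists (@econs quo_sort U Home [::] (hzero U) enil).
exists (Home :: G), (fun i => if i == j then V0 else VS (iv i)) => x.
have [e he] := h x; exists (@econs quo_sort U Home G (x j) e) => i.
by rewrite inE; case: eqP => [->|_] //= /he.
Qed.

Lemma def_all_vars (J : Type) (N : J -> structure quo_sig) G (K : seq quo_sort)
    (P : forall s, var K s -> forall j, env (N j) G -> Prop) :
  (forall s v, definable (P s v)) -> definable (fun j e => forall s v, P s v j e).
Proof.
elim: K P => [|t K IH] P h.
  exists (FImp (FBot G) (FBot G)) => j e; split=> [_ s v|_ []].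
  exact: (var_nil_ind (fun s v => P s v j e)).
apply: def_ext (def_and (h t V0) (IH (fun s v => P s (VS v)) (fun s v => h s (VS v)))) => j e.
split=> [[h1 h2]|h']; first exact: var_cons_ind.
by split=> [|s v]; exact: h'.
Qed.

Lemma mixed_formula (I : finType) (P : (I -> V) -> Prop) (K : seq quo_sort)
    (i : forall s, var K s -> I) : home_def P ->
  exists chi : formula quo_sig K, forall e : env U K,
    sat chi e <-> exists x : I -> V, P x /\ forall s v, e s v = hpi s (x (i s v)).
Proof.
move=> [H [phi [k hphi]]]; have [G [iv hG]] := home_context I.
pose hv j : term quo_sig (G ++ K) Home := @Var quo_sig (G ++ K) Home (vleft K (iv j)).
pose f s (w : var H s) : term quo_sig (G ++ K) s :=
  pi_term s (if k s w is Some j then hv j else zero_term _).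
have d1 : definable (fun (_ : unit) (e : env U (G ++ K)) => sat (fsubst phi f) e).
  by exists (fsubst phi f).
have d2 : definable (fun (_ : unit) (e : env U (G ++ K)) => forall s (v : var K s),
    eval e (@Var quo_sig (G ++ K) s (vright G v)) = eval e (pi_term s (hv (i s v)))).
  apply: (def_all_vars (N := fun _ : unit => U)
    (P := fun s (v : var K s) (_ : unit) (e : env U (G ++ K)) =>
     eval e (@Var quo_sig (G ++ K) s (vright G v)) = eval e (pi_term s (hv (i s v))))) => s v.
  exact: (def_eq (fun _ : unit => U)).
have [chi hchi] := def_ex_ctx (def_and d1 d2).
exists chi => e; rewrite (hchi tt e).
have E1 (r : env U G) : sat (fsubst phi f) (ecat r e : env U (G ++ K)) <-> P (fun j => r Home (iv j)).
  rewrite -(hphi tt) sat_subst.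
  set e1 := (fun s => _); rewrite (_ : e1 = henv (fun j => r Home (iv j)) k) //.
  apply: env_eq => s v; rewrite /e1 /f eval_pi /henv; congr (hpi s _).
  case: (k s v) => [j|] /=; last exact: eval_zero.
  exact: (@ecat_left quo_sig U G K r e Home (iv j)).
have E2 (r : env U G) s (v : var K s) :
    eval (ecat r e : env U (G ++ K)) (@Var quo_sig (G ++ K) s (vright G v)) = e s v.
  exact: (@ecat_right quo_sig U G K r e s v).
have E3 (r : env U G) s (v : var K s) :
    eval (ecat r e : env U (G ++ K)) (pi_term s (hv (i s v))) = hpi s (r Home (iv (i s v))).
  rewrite eval_pi; congr (hpi s _); exact: (@ecat_left quo_sig U G K r e Home (iv (i s v))).
split=> [[r [/E1 h1 h2]]|[x [h1 h2]]].
  by exists (fun j => r Home (iv j)); split=> // s v; rewrite -E3 -h2 E2.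
have [r hr] := hG x; exists r; split.
  by apply/E1; rewrite (_ : (fun j => _) = x) //; apply: funext => j.
by move=> s v; rewrite E2 E3 hr.
Qed.

Fixpoint vpos (S : Type) (G : seq S) s (v : var G s) : 'I_(size G) :=
  match v in var G s return 'I_(size G) with
  | V0 _ _ => ord0
  | VS _ _ _ w => lift ord0 (vpos w)
  end.

Definition proj_env G (x : 'I_(size G) -> V) : env U G := fun s v => hpi s (x (vpos v)).

Lemma proj_env_surj G (b : env U G) : exists x, proj_env x = b.
Proof.
elim: G b => [|s G IH] b; first by exists (fun=> 0); exact: env_nil_eq.
have [x hx] := IH (fun t v => b t (VS v)); have [x0 hx0] := home_pi_surj (b s V0).
exists (fun o => if unlift ord0 o is Some o' then x o' else x0).
apply: env_cons_eq; first by rewrite /proj_env /= unlift_none.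
move=> t v; rewrite /proj_env /= liftK.
by have /(congr1 (fun e : env U G => e t v)) := hx.
Qed.

Lemma dvdV_coprime m n (x : V) : coprime m n -> dvdV m x -> dvdV n x -> dvdV (m * n) x.
Proof.
move=> cop [u hu] [v hv].
have [k [l hkl]] := Bezoutz m n.
have g1 : gcdz m n = 1 by apply/eqP; rewrite -[_ == _]/(coprimez m n) coprimezE.
exists (v *~ k + u *~ l).
have -> : x = x *~ (k * m) + x *~ (l * n) by rewrite -mulrzDr hkl g1 mulr1z.
by rewrite {1}hv hu (pmulrn _ (m * n)) PoszM; zmod.
Qed.

Lemma quotient_sorts N : (0 < N)%N -> exists ps : seq (primes_t * nat),
  (forall (p : primes_t) k, (p, k) \in ps -> (val p ^ k.+1 %| N)%N) /\
  forall x : V, (forall (p : primes_t) k, (p, k) \in ps -> dvdV (val p ^ k.+1) x) -> dvdV N x.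
Proof.
elim/ltn_ind: N => N IH N0.
have [N1|N1] := leqP N 1.
  exists [::]; split=> [//|x _].
  have -> : N = 1%N by apply/eqP; rewrite eqn_leq N1.
  by exists x; rewrite mulr1n.
pose p : primes_t := exist _ (pdiv N) (pdiv_prime N1).
have pN : (pdiv N %| N)%N := pdiv_dvd N.
have l0 : (0 < logn (pdiv N) N)%N by rewrite logn_gt0 mem_primes pdiv_prime // N0.
have NE : N = ((pdiv N ^ (logn (pdiv N) N)) * N`_(pdiv N)^')%N by rewrite -p_part partnC.
have [||ps [h1 h2]] := IH (N`_(pdiv N)^')%N; [|exact: part_gt0|].
  rewrite [X in (_ < X)%N]NE -[X in (X < _)%N]mul1n ltn_pmul2r ?part_gt0 //.
  by rewrite -[1%N](expn0 (pdiv N)) ltn_exp2l ?prime_gt1 // pdiv_prime.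
exists ((p, (logn (pdiv N) N).-1) :: ps); split=> [q k|x hx].
  rewrite inE => /orP[/eqP[-> ->]|/h1 h]; first by rewrite prednK // pfactor_dvdn // pdiv_prime.
  exact: dvdn_trans h (dvdn_part _ _).
rewrite NE; apply: dvdV_coprime.
- by rewrite -p_part coprime_partC.
- by have := hx p _ (mem_head _ _); rewrite prednK.
- by apply: h2 => q k hq; apply: hx; rewrite inE hq orbT.
Qed.

Lemma projection_formula G (J : finType) (P : ('I_(size G) + J -> V) -> Prop) (K : seq quo_sort)
    (i : forall s, var K s -> 'I_(size G) + J) : home_def P ->
  exists chi : formula quo_sig (G ++ K), forall (b : env U G) (h : env U K),
    sat chi (ecat b h) <-> exists x : 'I_(size G) + J -> V,
      [/\ P x, proj_env (x \o inl) = b & forall s v, h s v = hpi s (x (i s v))].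
Proof.
move=> hP; pose I : Type := 'I_(size G) + J.
pose i1 s (v : var G s) : I := inl (vpos v).
pose k := @ecat quo_sort (fun _ => I) G K i1 i.
have [chi hchi] := mixed_formula k hP; exists chi => b h; rewrite hchi.
have E (x : I -> V) : (fun s v => hpi s (x (k s v))) =
    ecat (proj_env (x \o inl)) (fun s v => hpi s (x (i s v))) :> env U (G ++ K).
  exact: (@ecat_map quo_sig (fun _ => I) U (fun s o => hpi s (x o)) G K i1 i).
split=> [[x [h1 h2]]|[x [h1 h2 h3]]].
  exists x; have {}h2 : ecat b h = ecat (proj_env (x \o inl)) (fun s v => hpi s (x (i s v))).
    by rewrite -E; apply: env_eq.
  split=> // [|s v].
    apply: env_eq => s v.
    have := congr1 (fun e : env U (G ++ K) => e s (vleft K v)) h2.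
    by rewrite !(@ecat_left quo_sig).
  have := congr1 (fun e : env U (G ++ K) => e s (vright G v)) h2.
  by rewrite !(@ecat_right quo_sig).
exists x; split=> // s v.
have /(congr1 (fun e : env U (G ++ K) => e s v)) <- := esym (E x).
have -> : h = (fun s v => hpi s (x (i s v))) by apply: env_eq.
by rewrite -h2 -E.
Qed.

Lemma vars_tagged (I : Type) (hs : seq (quo_sort * I)) (P : quo_sort -> I -> Prop) :
  List.Forall (fun t => P t.1 t.2) hs ->
  forall s (v : var (map fst hs) s), P s (menv (g := @fst quo_sort I) (D := fun _ => I) (fun t _ => t.2) v).
Proof.
elim: hs => [|t hs IH] /=; first by move=> _; exact: var_nil_ind.
by move=> /List.Forall_cons_iff[h1 h2]; apply: var_cons_ind => //; exact: IH.
Qed.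

Lemma tagged_vars (I : Type) (hs : seq (quo_sort * I)) t : List.In t hs ->
  exists v : var (map fst hs) t.1,
  menv (g := @fst quo_sort I) (D := fun _ => I) (fun t _ => t.2) v = t.2.
Proof.
elim: hs => //= t' hs IH [->|/IH[v hv]]; first by exists V0.
by exists (VS v).
Qed.

Lemma In_mem (T : eqType) (x : T) (s : seq T) : x \in s -> List.In x s.
Proof. by elim: s => //= y s IH; rewrite inE => /orP[/eqP->|/IH]; [left | right]. Qed.

Lemma imaginary_weakly_coded (E : def_equiv U) (b0 : env U (de_ctx E)) :
  exists (H : seq quo_sort) (h : env U H),
  dcl (real_entries h) (Tagged (eq_structure U) (de_proj b0 : eq_structure U (Imag E))) /\
  real_entries h `<=` acl [set Tagged (eq_structure U) (de_proj b0 : eq_structure U (Imag E))].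
Proof.
pose X := 'I_(size (de_ctx E)).
pose EE (x y : X -> V) := de_rel (proj_env (G := de_ctx E) x) (proj_env y).
have dE : home_def (fun z : X + X -> V => EE (z \o inl) (z \o inr)).
  pose k1 s (v : var (de_ctx E) s) : option (X + X) := Some (inl (vpos v)).
  pose k2 s (v : var (de_ctx E) s) : option (X + X) := Some (inr (vpos v)).
  apply: hdef_ext (hdef_formula (fun _ : unit => U) (de_form E) (icat k1 k2)) => _ z.
  by rewrite (henv_cat (N := fun _ : unit => U) k1 k2 (j := tt) z).
have [a ha] := proj_env_surj b0.
have EErefl x : EE x x by exact: de_refl.
have EEsym x y : EE x y -> EE y x by exact: de_sym.
have EEtrans x y z : EE x y -> EE y z -> EE x z by exact: de_trans.
have [C [D [N [R [c [d [hR hcd finC finD]]]]]]] :=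
  finite_coding home_regular home_definability EErefl EEsym EEtrans dE a.
have hR' := class_of_coding home_definability dE hR.
have N0 := coding_gt0 hR.
have [ps [ps1 ps2]] := quotient_sorts N0.
pose I : finType := (C + D)%type.
pose P (z : X + I -> V) := class_of EE R (z \o inl) (z \o inr \o inl) (z \o inr \o inr).
have hP : home_def P.
  pose g (s : (X + C) + D) : X + I :=
    match s with inl (inl i) => inl i | inl (inr i) => inr (inl i) | inr i => inr (inr i) end.
  exact: (dfn_map home_definability g (coding_dfn hR')).
pose tC (j : C) : quo_sort * (X + I) := (Home, inr (inl j)).
pose tD (pk : primes_t * nat) (j : D) : quo_sort * (X + I) := (Quo pk.1 pk.2, inr (inr j)).
pose hs := map tC (enum C) ++ List.flat_map (fun pk => map (tD pk) (enum D)) ps.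
pose H := map fst hs.
pose iH : forall s, var H s -> X + I :=
  menv (g := @fst quo_sort (X + I)) (D := fun _ => (X + I)%type) (fun t _ => t.2).
pose z0 : X + I -> V := vcat a (vcat c d).
pose h : env U H := fun s v => hpi s (z0 (iH s v)).
have hsP (Q : quo_sort -> X + I -> Prop) : (forall j, Q Home (inr (inl j))) ->
    (forall p k j, (p, k) \in ps -> Q (Quo p k) (inr (inr j))) ->
    forall s (v : var H s), Q s (iH s v).
  move=> q1 q2; apply: vars_tagged; apply/List.Forall_app; split.
    by apply/List.Forall_map/List.Forall_forall => j _; exact: q1.
  apply/List.Forall_flat_map/List.Forall_forall => -[p k] hpk.
  apply/List.Forall_map/List.Forall_forall => j _; apply: q2.
  by elim: (ps) hpk => //= t s IH [->|/IH]; rewrite inE ?eqxx // orbC => ->.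
have hsC j : exists v : var H Home, iH _ v = inr (inl j).
  have [|v hv] := @tagged_vars (X + I) hs (tC j); last by exists v.
  by apply/List.in_or_app; left; apply: List.in_map; apply: In_mem; rewrite mem_enum.
have hsD p k j : (p, k) \in ps -> exists v : var H (Quo p k), iH _ v = inr (inr j).
  move=> hpk; have [|v hv] := @tagged_vars (X + I) hs (tD (p, k) j); last by exists v.
  apply/List.in_or_app; right; apply/List.in_flat_map; exists (p, k); split; first exact: In_mem.
  by apply: List.in_map; apply: In_mem; rewrite mem_enum.
exists H, h; split.
  have [chi hchi] := projection_formula iH hP.
  apply: (dcl_imaginary (chi := chi)) => b; rewrite hchi; split.
    move=> [z [hz <- hh]]; rewrite -ha.
    have zc : z \o inr \o inl = c.
      apply: funext => j; have [v hv] := hsC j.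
      by have := hh _ v; rewrite /h hv.
    have zd j : dvdV N ((z \o inr \o inr) j - d j).
      apply: ps2 => p k hpk; have [v hv] := hsD p k j hpk.
      by apply/home_pi_eq; have := hh _ v; rewrite /h hv => ->.
    have := coding_inv hR' zd hz; rewrite zc => h'.
    by apply/(hcd (z \o inl))/h'; exact: EErefl.
  have [x <-] := proj_env_surj b; rewrite -ha => hx.
  exists (vcat x (vcat c d)); split=> //.
    move=> y; rewrite (hcd y); split=> hy; first exact: EEtrans (EEsym _ _ hx) hy.
    exact: EEtrans hx hy.
  exact: (hsP (fun s i => hpi s (z0 i) = hpi s (vcat x (vcat c d) i))).
move=> _ [s [v ->]]; move: s v.
have main s i : finite_set [set hpi s (z i : U Home) | z in [set z | P z /\ EE a (z \o inl)]] ->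
    acl [set Tagged (eq_structure U) (de_proj b0 : eq_structure U (Imag E))]
      (Tagged (eq_structure U) (hpi s (z0 i) : eq_structure U (Real U s))).
  move=> fin; have [chi hchi] := projection_formula (@econs quo_sort (fun _ =>
    (X + I)%type) s [::] i enil) hP.
  apply: (acl_imaginary (chi := chi)).
    exists b0; split; first exact: de_refl.
    apply/hchi; exists z0; split=> //.
    by apply: var_cons_ind => //; exact: var_nil_ind.
  apply: sub_finite_set fin => y [b [hb /hchi[z [h1 h2 h3]]]].
  exists z; last by have := h3 _ V0.
  by split=> //; rewrite /EE ha h2.
have cz z : P z -> EE a (z \o inl) -> codes EE a R (z \o inr \o inl) (z \o inr \o inr).
  move=> hz hx y; rewrite (hz y); split=> hy; first exact: EEtrans hx hy.
  exact: EEtrans (EEsym _ _ hx) hy.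
apply: (hsP (fun s i => acl [set Tagged (eq_structure U) (de_proj b0 : eq_structure U (Imag E))]
      (Tagged (eq_structure U) (hpi s (z0 i) : eq_structure U (Real U s))))) => [j|p k j hpk];
  apply: main.
  apply: sub_finite_set (finite_image (fun c' : C -> V => c' j) finC) => y [z [h1 h2] <-].
  by exists (z \o inr \o inl) => //; exists (z \o inr \o inr); exact: cz.
apply: sub_finite_set (finite_image (fun r : D -> V => hpi (Quo p k) (r j : U Home)) finD).
move=> y [z [h1 h2] <-].
exists (fun j => residue N ((z \o inr \o inr) j)).
  by exists (z \o inr \o inr) => //; exists (z \o inr \o inl); exact: cz.
apply/home_pi_eq; apply: (dvdV_trans (ps1 _ _ hpk)).
by apply/dvdVC; exact: residueP.
Qed.
End Model.

Theorem theorem3p13 (M : porderZmodType) (hM : ordered_abelian_group M)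
    (hdense : dense_oag M) (hreg : regular M) :
  weak_elimination_of_imaginaries (Th (quo_structure M)).
Proof.
move=> K U [_ hU _ _] [[s|E] x].
  by exists [:: s], (@econs _ U s [::] x enil); split; [exact: dcl_self | exact: acl_self].
case: x => A [a hA].
have -> : exist _ A (ex_intro (fun a => A = de_class a) a hA) = de_proj a :> eq_structure U (Imag E).
  exact: eq_exist.
exact: (imaginary_weakly_coded hM hdense hreg hU).
Qed.
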